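(* The following problems either all have truly subcubic algorithms, or none of them do: (1) 2NPDA language recognition (for a fixed 2NPDA $\mathcal A$: given a word $w$, decide whether $w\in L(\mathcal A)$; the problem is said to have truly subcubic algorithms if it does so for every fixed $\mathcal A$); (2) PDA language emptiness (given a PDA $\mathcal P$, decide whether $L(\mathcal P)=\emptyset$); (3) Dyck-2 reachability.
   Context: An algorithm is truly subcubic if its worst-case running time is $O(n^{3-\varepsilon})$ for some constant $\varepsilon>0$, where $n$ is the bit length of the input. 2NPDA (two-way nondeterministic pushdown automaton): $\mathcal A=(Q,\Sigma,\Gamma,\delta,q_0,F)$ with finite set of states $Q$, finite input alphabet $\Sigma$ containing two designated end-of-tape symbols $\lhd$ and $\rhd$, finite stack alphabet $\Gamma$, initial state $q_0\in Q$, final states $F\subseteq Q$, and finite transition relation $\delta\subseteq Q\times\Sigma\times\Gamma\times Q\times\Gamma^*\times\{-1,0,+1\}$. $\Gamma$ contains a designated end-of-stack symbol $Z_0$ which is always kept at the bottom of the stack: transitions never remove or replace it and never push another copy of it. A configuration is $(q,w\hat a x,\gamma)$ with $q\in Q$, tape content $wax$, the hat marking the scanned letter, and stack $\gamma\in\Gamma^*$ (top at the left). There is a step $(q_1,a_1\ldots\hat a_i\ldots a_m,Z\gamma)\to(q_2,a_1\ldots\hat a_j\ldots a_m,\gamma'\gamma)$ whenever $(q_1,a_i,Z,q_2,\gamma',d)\in\delta$ and $j=i+d\in\{1,\ldots,m\}$. A word $w\in(\Sigma\setminus\{\lhd,\rhd\})^*$ is accepted if $(q_0,\hat{\lhd}w\rhd,Z_0)\to^*(q,\lhd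 w\hat{\rhd},Z_0)$ for some $q\in F$; $L(\mathcal A)$ is the set of accepted words. A PDA is a 2NPDA with $\delta\subseteq Q\times\Sigma\times\Gamma\times Q\times\Gamma^*\times\{0,+1\}$ (no left moves). Dyck-2 reachability: given a finite directed graph $G=(V,E)$, an edge labeling $\lambda\colon E\to\{\texttt{(},\texttt{)},\texttt{[},\texttt{]}\}$ and vertices $s,t\in V$, decide whether there is a walk from $s$ to $t$ (possibly empty, possibly repeating vertices and edges) such that the concatenation of the edge labels along it belongs to the Dyck-2 language, i.e. the language generated by $S\to SS \mid \texttt{(}\,S\,\texttt{)} \mid \texttt{[}\,S\,\texttt{]} \mid \varepsilon$. *)

(* Defs.v *)
From HB Require Import structures.
From Stdlib Require Import Relation_Operators.
From mathcomp Require Import all_boot all_order all_algebra.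
From mathcomp Require Import all_classical all_reals all_analysis.

Set Implicit Arguments.
Unset Strict Implicit.
Unset Printing Implicit Defensive.

Import Order.TTheory GRing.Theory Num.Theory.
Import numFieldNormedType.Exports.

Local Open Scope classical_set_scope.
Local Open Scope nat_scope.

(** * Word RAM

    A program acts on registers and a random-access memory, both indexed by
    [nat] and both holding words.  Programs are structured rather than
    goto-based: a fixed goto program is simulated by a single loop dispatching
    on a program counter with constant overhead per step. *)

Inductive op : Set :=
  | OpAdd | OpSub | OpMul | OpDiv | OpMod | OpEq | OpLt
  | OpAnd | OpOr | OpXor | OpShl | OpShr.

(* Subtraction is truncated; [x %/ 0 = 0] and [x %% 0 = x]. *)
Definition op_sem (o : op) (x y : nat) : nat :=
  match o with
  | OpAdd => x + y
  | OpSub => x - y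
  | OpMul => x * y
  | OpDiv => x %/ y
  | OpMod => x %% y
  | OpEq => x == y
  | OpLt => x < y
  | OpAnd => Nat.land x y
  | OpOr => Nat.lor x y
  | OpXor => Nat.lxor x y
  | OpShl => x * 2 ^ y
  | OpShr => x %/ 2 ^ y
  end.

Inductive cmd : Set :=
  | CSkip
  | CConst of nat & nat         (* CConst r k    : r := k       *)
  | COp of op & nat & nat & nat (* COp o r r1 r2 : r := r1 o r2 *)
  | CRead of nat & nat          (* CRead r r1    : r := M[r1]   *)
  | CWrite of nat & nat         (* CWrite r1 r   : M[r1] := r   *)
  | CSeq of cmd & cmd
  | CIf of nat & cmd & cmd      (* tests whether the register is nonzero *)
  | CWhile of nat & cmd.

Record ram_state := RamState { reg : nat -> nat; mem : nat -> nat }.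

Definition upd (f : nat -> nat) (i v : nat) : nat -> nat :=
  fun j => if j == i then v else f j.

Definition set_reg (s : ram_state) (r v : nat) : ram_state :=
  RamState (upd (reg s) r v) (mem s).

Definition set_mem (s : ram_state) (a v : nat) : ram_state :=
  RamState (reg s) (upd (mem s) a v).

(* [exec W c s s' t]: started in [s], the program [c] halts in [s'] after [t]
   unit-cost steps, and all words it computes are smaller than [W].  Overflow
   blocks the execution: there is no rule computing a value [>= W]. *)
Inductive exec (W : nat) : cmd -> ram_state -> ram_state -> nat -> Prop :=
  | exec_skip s : exec W CSkip s s 1
  | exec_const r k s :
      k < W -> exec W (CConst r k) s (set_reg s r k) 1
  | exec_op o r r1 r2 s :
      op_sem o (reg s r1) (reg s r2) < W ->
      exec W (COp o r r1 r2) s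
        (set_reg s r (op_sem o (reg s r1) (reg s r2))) 1
  | exec_read r r1 s :
      exec W (CRead r r1) s (set_reg s r (mem s (reg s r1))) 1
  | exec_write r1 r s :
      exec W (CWrite r1 r) s (set_mem s (reg s r1) (reg s r)) 1
  | exec_seq c1 c2 s1 s2 s3 t1 t2 :
      exec W c1 s1 s2 t1 -> exec W c2 s2 s3 t2 ->
      exec W (CSeq c1 c2) s1 s3 (t1 + t2)
  | exec_if_true r c1 c2 s s' t :
      reg s r != 0 -> exec W c1 s s' t -> exec W (CIf r c1 c2) s s' t.+1
  | exec_if_false r c1 c2 s s' t :
      reg s r = 0 -> exec W c2 s s' t -> exec W (CIf r c1 c2) s s' t.+1
  | exec_while_stop r c s :
      reg s r = 0 -> exec W (CWhile r c) s s 1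
  | exec_while_loop r c s1 s2 s3 t1 t2 :
      reg s1 r != 0 -> exec W c s1 s2 t1 -> exec W (CWhile r c) s2 s3 t2 ->
      exec W (CWhile r c) s1 s3 (t1 + t2).+1.

(* The input bits occupy the memory cells 0, ..., n - 1, register 0 holds n,
   and everything else is 0. *)
Definition ram_input (x : seq bool) : ram_state :=
  RamState (fun r => if r == 0 then size x else 0)
           (fun a => nat_of_bool (nth false x a)).

(** * Decision problems and truly subcubic algorithms *)

Record problem := Problem {
  instance : Type;
  encode : instance -> seq bool;
  answer : instance -> Prop
}.

(* Words have O(log n) bits: on inputs of bit length n all words are smaller
   than (n + 2) ^ k, for a constant k that belongs to the algorithm.  The
   answer is yes iff register 0 is nonzero on halting. *)
Definition truly_subcubic (R : realType) (P : problem) : Prop :=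
  exists (c : cmd) (k : nat) (T : nat -> R) (eps : R),
    [/\ (0 < eps)%R,
        (T =O_\oo (fun n : nat => n%:R `^ (3 - eps)))%R
      & forall x : instance P, exists (s : ram_state) (t : nat),
        [/\ exec ((size (encode x) + 2) ^ k) c (ram_input (encode x)) s t,
            (t%:R <= T (size (encode x)))%R
          & answer x <-> reg s 0 != 0]].

(** * Binary encodings *)

Definition bits (w n : nat) : seq bool := mkseq (fun i => odd (n %/ 2 ^ i)) w.

(* An element of a finite type is written as its index in the enumeration of
   the type, on ceil (log2 #|T|) bits. *)
Definition code_elt (T : finType) (x : T) : seq bool :=
  bits (up_log 2 #|T|) (enum_rank x).

Definition unary (n : nat) : seq bool := rcons (nseq n true) false.

(* Each item is preceded by the bit 1, and the list is ended by the bit 0. *)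
Definition code_list (T : Type) (f : T -> seq bool) (s : seq T) : seq bool :=
  rcons (flatten [seq true :: f x | x <- s]) false.

(** * Two-way nondeterministic pushdown automata *)

(* The finite set of transitions is given as a list, in no specific order.
   Stacks are written with the top at the left, so that a transition on the
   end-of-stack symbol puts back that symbol as its last pushed symbol. *)
Record npda := NPDA {
  state : finType;
  letter : finType;
  stacksym : finType;
  delta : seq (state * letter * stacksym * state * seq stacksym * int);
  start : state;
  final : {set state};
  lend : letter;
  rend : letter;
  stackend : stacksym;
  lend_neq_rend : lend != rend;
  delta_move : forall q1 a Z q2 g d, (q1, a, Z, q2, g, d) \in delta ->
    d \in [:: -1; 0; 1]%R;
  delta_stackend : forall q1 a Z q2 g d, (q1, a, Z, q2, g, d) \in delta ->
    if Z == stackend then exists2 g', g = rcons g' stackend & stackend \notin g'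
    else stackend \notin g
}.

Definition is_pda (A : npda) : bool :=
  all (fun tr => tr.2 \in [:: 0; 1]%R) (delta A).

Definition is_word (A : npda) (w : seq (letter A)) : bool :=
  (lend A \notin w) && (rend A \notin w).

(* State, head position (counted from 0) and stack; the tape is constant
   along a computation and therefore a parameter of [step]. *)
Definition config (A : npda) : Type :=
  (state A * nat * seq (stacksym A))%type.

Inductive step (A : npda) (tape : seq (letter A)) :
    config A -> config A -> Prop :=
  | Step q1 Z q2 g' d g i j :
      i < size tape -> j < size tape -> (j%:Z = i%:Z + d)%R ->
      (q1, nth (lend A) tape i, Z, q2, g', d) \in delta A ->
      step tape (q1, i, Z :: g) (q2, j, g' ++ g).

Definition accepts (A : npda) (w : seq (letter A)) : Prop :=
  exists2 q, q \in final A &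
    clos_refl_trans _ (step (lend A :: rcons w (rend A)))
      (start A, 0, [:: stackend A]) (q, (size w).+1, [:: stackend A]).

Definition language (A : npda) : classical_sets.set (seq (letter A)) :=
  [set w | is_word w /\ accepts w]%classic.
Arguments language : clear implicits.

Definition recognition (A : npda) : problem :=
  @Problem {w : seq (letter A) | is_word w}
    (fun w => flatten [seq code_elt a | a <- sval w])
    (fun w => language A (sval w)).

(* The sets of states, letters and stack symbols are listed explicitly, hence
   contribute their cardinalities to the bit length. *)
Definition code_npda (A : npda) : seq bool :=
  unary #|state A| ++ unary #|letter A| ++ unary #|stacksym A|
  ++ code_elt (start A) ++ [seq q \in final A | q <- enum (state A)]
  ++ code_elt (lend A) ++ code_elt (rend A) ++ code_elt (stackend A)
  ++ code_list (fun tr : state A * letter A * stacksym A * state A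
                         * seq (stacksym A) * int =>
       let: (q1, a, Z, q2, g, d) := tr in
       code_elt q1 ++ code_elt a ++ code_elt Z ++ code_elt q2
       ++ code_list (@code_elt (stacksym A)) g ++ bits 2 (absz (d + 1)%R))
     (delta A).

Definition pda_emptiness : problem :=
  @Problem {A : npda | is_pda A}
    (fun A => code_npda (sval A))
    (fun A => language (sval A) = classical_sets.set0).

(** * Dyck-2 reachability *)

Inductive paren : Set := RoundO | RoundC | SquareO | SquareC.

Inductive dyck2 : seq paren -> Prop :=
  | dyck2_cat u v : dyck2 u -> dyck2 v -> dyck2 (u ++ v)
  | dyck2_round u : dyck2 u -> dyck2 (RoundO :: rcons u RoundC)
  | dyck2_square u : dyck2 u -> dyck2 (SquareO :: rcons u SquareC)
  | dyck2_nil : dyck2 [::].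

(* The edge set is given as a duplicate-free list, in no specific order;
   values of [label] outside of it are irrelevant. *)
Record dyck_graph := DyckGraph {
  vertex : finType;
  edges : seq (vertex * vertex);
  label : vertex * vertex -> paren;
  source : vertex;
  target : vertex;
  edges_uniq : uniq edges
}.

Definition dyck_reachable (G : dyck_graph) : Prop :=
  exists p : seq (vertex G),
    [/\ path (fun u v => (u, v) \in edges G) (source G) p,
        last (source G) p = target G
      & dyck2 (pairmap (fun u v => label (u, v)) (source G) p)].

Definition code_paren (p : paren) : seq bool :=
  match p with
  | RoundO => [:: false; false]
  | RoundC => [:: false; true]
  | SquareO => [:: true; false]
  | SquareC => [:: true; true]
  end.

Definition code_graph (G : dyck_graph) : seq bool :=
  unary #|vertex G| ++ code_elt (source G) ++ code_elt (target G)
  ++ code_list (fun e => code_elt e.1 ++ code_elt e.2 ++ code_paren (label e))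
       (edges G).

Definition dyck2_reachability : problem :=
  @Problem dyck_graph code_graph dyck_reachable.

(* Main.v *)
(** A walk labelled by a Dyck-2 word is a run of a machine with a binary stack.
    A labelled graph therefore is a PDA that reads nothing: its states are the
    vertices, and its language is nonempty iff the target is reachable.
    Conversely, the pairs (state, head position) of a 2NPDA on a word [w] are the
    vertices of a graph with O(|w|) vertices and edges, in which a transition
    replacing the stack symbol [Z] by [g] becomes a path whose label pops a binary
    code of [Z] and then pushes the code of [g].  Finally, nonemptiness of a PDA
    [P] is decided by one fixed 2NPDA: [P] is written on the tape as a list of
    blocks of parentheses, one per transition, and the machine keeps a whole
    configuration of [P] in its stack, moves its head to a block of its choice and
    executes it on the stack; a block for each letter guesses the next letter of
    the input of [P].  The head of a PDA never comes back, so that the word read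
    so far need not be remembered.

    Each reduction is a program whose loops of linear length are nested at most
    twice, the others having logarithmic length.  It runs in time
    n^2 (log n)^O(1) with an output of size O(n log n), and since
    O((n log n)^(3 - eps)) is O(n^(3 - eps')) for every eps' < eps, the three
    reductions transport truly subcubic algorithms around the cycle. *)

From HB Require Import structures.
Require Import Defs.
From mathcomp Require Import all_boot all_order all_algebra.
From mathcomp Require Import all_classical all_reals all_analysis.
From mathcomp Require Import zify.
From Stdlib Require Import Relation_Operators.

Set Implicit Arguments.
Unset Strict Implicit.
Unset Printing Implicit Defensive.

Local Open Scope nat_scope.

(** * A small imperative language and its compilation to the RAM *)

(** An overflowing word blocks a RAM execution, so a reduction must be an actual program with a
    bound on every word that it computes. The programs are therefore written in a loop language
    whose loop counts are fixed on entry: termination and running time are read off the syntax, and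
    [wp] only has to bound assigned values and loop counts. A reduction can be followed by another
    algorithm only if it leaves exactly the state [ram_input y], so its output is moved to address 0
    and all its other traces are erased.

    Three features of the problems shape the constructions. A Dyck graph carries one label per
    ordered pair of vertices, whereas many transitions can join the same two configurations; each of
    them needs vertices of its own. A walk can only match symbols bit by bit, so stack symbols and
    states are written in codes that can be decoded uniquely from the top of the stack. A Dyck walk
    starts and ends with an empty stack and cannot test emptiness in between, so a bottom mark or a
    whole configuration is pushed at the start and popped at acceptance. *)

Inductive aop : Set := Add | Sub | Mul | Div | Mod | Eq | Lt.

Definition op_of (o : aop) : op :=
  match o with
  | Add => OpAdd | Sub => OpSub | Mul => OpMul | Div => OpDiv | Mod => OpMod
  | Eq => OpEq | Lt => OpLt
  end.

Inductive expr : Set :=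
  | Var of nat
  | Cst of nat
  | Rd of expr
  | Bin of aop & expr & expr.

Inductive prog : Set :=
  | Skip
  | Set_ of nat & expr
  | Emit of seq bool
  | Seq of prog & prog
  | If of expr & prog & prog
  | For of bool & expr & prog.

Record lstate := LState { vars : seq nat; out : seq bool }.

Definition env (s : lstate) (x : nat) : nat := nth 0 (vars s) x.

Section Semantics.
Variable inp : seq bool.

(* The output is appended to the input in memory, so that reads past the input
   see the output. *)
Fixpoint eval (s : lstate) (e : expr) : nat :=
  match e with
  | Var x => env s x
  | Cst k => k
  | Rd e => nth false (inp ++ out s) (eval s e)
  | Bin o e1 e2 => op_sem (op_of o) (eval s e1) (eval s e2)
  end.

Definition set_var (s : lstate) x v := LState (set_nth 0 (vars s) x v) (out s).
Definition emit (s : lstate) l := LState (vars s) (out s ++ l).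

Lemma env_set_var s x v y :
  env (set_var s x v) y = if y == x then v else env s y.
Proof. by rewrite /env /= nth_set_nth. Qed.

(* Weakest precondition: assigned values are below [B], and a loop
   [For true] (resp. [For false]) runs at most [N] (resp. [M]) times. *)
Fixpoint wp (N M B : nat) (p : prog) (Q : lstate -> Prop) (s : lstate) : Prop :=
  match p with
  | Skip => Q s
  | Set_ x e => eval s e < B /\ Q (set_var s x (eval s e))
  | Emit l => Q (emit s l)
  | Seq p1 p2 => wp N M B p1 (wp N M B p2 Q) s
  | If e p1 p2 => if eval s e != 0 then wp N M B p1 Q s else wp N M B p2 Q s
  | For b e p => eval s e <= (if b then N else M) /\
      iter (eval s e) (wp N M B p) Q s
  end.

Fixpoint expr_time (e : expr) : nat :=
  match e with
  | Var _ => 2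
  | Cst _ => 1
  | Rd e => (expr_time e).+1
  | Bin _ e1 e2 => (expr_time e1 + expr_time e2).+1
  end.

Fixpoint prog_time (N M : nat) (p : prog) : nat :=
  match p with
  | Skip => 1
  | Set_ _ e => (expr_time e).+2
  | Emit l => (4 * size l).+1
  | Seq p1 p2 => prog_time N M p1 + prog_time N M p2
  | If e p1 p2 => expr_time e + (prog_time N M p1 + prog_time N M p2).+1
  | For b e p =>
      expr_time e + ((if b then N else M) * (prog_time N M p).+3).+1
  end.

(** An exponent: with variables below [B], the value of [e] is below [B ^ expr_deg e]. A constant
    [k] gets [k.+1], as [k < B ^ k.+1] for [1 < B] and the exponent stays positive for [k = 0]. *)
Fixpoint expr_deg (e : expr) : nat :=
  match e with
  | Var _ => 1
  | Cst k => k.+1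
  | Rd e => expr_deg e
  | Bin _ e1 e2 => expr_deg e1 + expr_deg e2
  end.

Fixpoint prog_deg (p : prog) : nat :=
  match p with
  | Skip | Emit _ => 2
  | Set_ _ e => (expr_deg e).+1
  | Seq p1 p2 => maxn (prog_deg p1) (prog_deg p2)
  | If e p1 p2 => maxn (expr_deg e).+1 (maxn (prog_deg p1) (prog_deg p2))
  | For _ e p => maxn (expr_deg e).+1 (prog_deg p)
  end.

Lemma expr_deg_gt0 e : 0 < expr_deg e.
Proof. by elim: e => //= o e1 H1 e2 H2; lia. Qed.

Lemma prog_deg_gt1 p : 1 < prog_deg p.
Proof.
elim: p => //=; try by move=> *; lia.
by move=> _ e; have := expr_deg_gt0 e; lia.
Qed.

(** This is the reason why [aop] has no left shift: multiplication by [2 ^ y] is not bounded by a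
    fixed power of [B]. *)
Lemma op_sem_lt B a b x y o : 1 < B -> 0 < a -> 0 < b ->
  x < B ^ a -> y < B ^ b -> op_sem (op_of o) x y < B ^ (a + b).
Proof.
move=> B1 a0 b0 xa yb; rewrite expnD.
have Ba : 1 < B ^ a by rewrite -(exp1n a) ltn_exp2r.
have Bb : 1 < B ^ b by rewrite -(exp1n b) ltn_exp2r.
have := leq_div x y; have := leq_mod x y.
have := leq_b1 (x == y); have := leq_b1 (x < y).
by case: o => /= *; nia.
Qed.

Lemma eval_lt B s e : 1 < B -> (forall x, env s x < B) ->
  eval s e < B ^ expr_deg e.
Proof.
move=> B1 sB; elim: e => [x|k|e IH|o e1 H1 e2 H2] /=.
- by rewrite expn1.
- by apply: leq_trans (ltn_expl k B1) _; rewrite leq_exp2l.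
- apply: leq_ltn_trans (leq_b1 _) _.
  by rewrite -(exp1n (expr_deg e)) ltn_exp2r // expr_deg_gt0.
- by apply: op_sem_lt => //; apply: expr_deg_gt0.
Qed.

(* Variables live in the even registers; the odd ones form the evaluation stack,
   whose bottom [sreg 0] is the address of the next output bit. *)
Definition vreg x := x.*2.
Definition sreg d := d.*2.+1.

Lemma vreg_inj x y : (vreg x == vreg y) = (x == y).
Proof. by rewrite /vreg; apply/eqP/eqP; lia. Qed.
Lemma sreg_inj x y : (sreg x == sreg y) = (x == y).
Proof. by rewrite /sreg; apply/eqP/eqP; lia. Qed.
Lemma vreg_sreg x y : (vreg x == sreg y) = false.
Proof. by rewrite /vreg /sreg; apply/eqP; lia. Qed.
Lemma sreg_vreg x y : (sreg x == vreg y) = false.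
Proof. by rewrite /vreg /sreg; apply/eqP; lia. Qed.
Definition regE := (vreg_inj, sreg_inj, vreg_sreg, sreg_vreg, eqxx).

(** The RAM has no move instruction: a register is copied by adding 0 to it. *)
Fixpoint comp_expr (e : expr) (d : nat) : cmd :=
  match e with
  | Var x => CSeq (CConst (sreg d) 0) (COp OpAdd (sreg d) (vreg x) (sreg d))
  | Cst k => CConst (sreg d) k
  | Rd e => CSeq (comp_expr e d) (CRead (sreg d) (sreg d))
  | Bin o e1 e2 => CSeq (comp_expr e1 d) (CSeq (comp_expr e2 d.+1)
      (COp (op_of o) (sreg d) (sreg d) (sreg d.+1)))
  end.

Fixpoint comp_emit (l : seq bool) (d : nat) : cmd :=
  match l with
  | [::] => CSkip
  | b :: l => CSeq (CConst (sreg d) b) (CSeq (CWrite (sreg 0) (sreg d))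
      (CSeq (CConst (sreg d) 1) (CSeq (COp OpAdd (sreg 0) (sreg 0) (sreg d))
      (comp_emit l d))))
  end.

(** A loop counter stays in [sreg d] while the body is compiled at depth [d.+1], so nested code does
    not disturb it. *)
Fixpoint comp (p : prog) (d : nat) : cmd :=
  match p with
  | Skip => CSkip
  | Set_ x e => CSeq (comp_expr e d) (CSeq (CConst (sreg d.+1) 0)
      (COp OpAdd (vreg x) (sreg d) (sreg d.+1)))
  | Emit l => comp_emit l d
  | Seq p1 p2 => CSeq (comp p1 d) (comp p2 d)
  | If e p1 p2 => CSeq (comp_expr e d) (CIf (sreg d) (comp p1 d) (comp p2 d))
  | For _ e p => CSeq (comp_expr e d) (CWhile (sreg d) (CSeq (comp p d.+1)
      (CSeq (CConst (sreg d.+1) 1) (COp OpSub (sreg d) (sreg d) (sreg d.+1)))))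
  end.

Definition simulates (s : lstate) (r : ram_state) :=
  [/\ forall x, reg r (vreg x) = env s x,
      Defs.mem r = (fun a => nat_of_bool (nth false (inp ++ out s) a))
    & reg r (sreg 0) = size inp + size (out s)].

(** Index 0 is excluded because [sreg 0] is the output pointer, which advances. *)
Definition keeps d (r r' : ram_state) :=
  forall j, 0 < j < d -> reg r' (sreg j) = reg r (sreg j).

Lemma updE f i v j : upd f i v j = if j == i then v else f j.
Proof. by []. Qed.

Lemma exec_seq1 W c1 c2 s1 s2 s3 t : exec W c1 s1 s2 t ->
  exec W c2 s2 s3 1 -> exec W (CSeq c1 c2) s1 s3 t.+1.
Proof. by move=> E1 E2; rewrite -addn1; apply: exec_seq E1 E2. Qed.

Lemma comp_expr_sound W B s e d r : 1 < B -> (forall x, env s x < B) ->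
  0 < d -> simulates s r -> B ^ expr_deg e <= W ->
  exists r', [/\ exec W (comp_expr e d) r r' (expr_time e),
    simulates s r', keeps d r r' & reg r' (sreg d) = eval s e].
Proof.
move=> B1 sB; have W1 : forall e, B ^ expr_deg e <= W -> 1 < W.
  move=> e' /(leq_trans _); apply.
  by rewrite -(exp1n (expr_deg e')) ltn_exp2r // expr_deg_gt0.
elim: e d r => [x|k|e IH|o e1 H1 e2 H2] d r d0 [sr sm so] eW.
- eexists; split.
  + apply: (@exec_seq _ _ _ _ _ _ 1 1); first by apply: exec_const; apply: ltnW (W1 _ eW).
    apply: exec_op; rewrite /= !updE !regE addn0 sr.
    by apply: leq_trans eW; rewrite /= expn1.
  + by split => //= [y|]; rewrite !updE !regE ?sr //; case: eqP => // -; lia.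
  + by move=> j jd /=; rewrite !updE !regE; case: eqP => // -; lia.
  + by rewrite /= !updE !regE sr addn0.
- eexists; split.
  + by apply: exec_const; apply: leq_trans (@eval_lt B s (Cst k) B1 sB) eW.
  + by split => //= [y|]; rewrite !updE !regE ?sr //; case: eqP => // -; lia.
  + by move=> j jd /=; rewrite !updE !regE; case: eqP => // -; lia.
  + by rewrite /= !updE !regE.
- have [r1 [E1 [sr1 sm1 so1] K1 V1]] := IH d r d0 (And3 sr sm so) eW.
  eexists; split.
  + by apply: (exec_seq1 E1); apply: exec_read.
  + by split => //= [y|]; rewrite !updE !regE ?sr1 //; case: eqP => // -; lia.
  + by move=> j jd /=; rewrite !updE !regE -(K1 j jd); case: eqP => // -; lia.
  + by rewrite /= !updE !regE V1 sm1.
- have p1 := expr_deg_gt0 e1; have p2 := expr_deg_gt0 e2.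
  have le1 : B ^ expr_deg e1 <= W.
    by apply: leq_trans eW; rewrite leq_exp2l //= leq_addr.
  have le2 : B ^ expr_deg e2 <= W.
    by apply: leq_trans eW; rewrite leq_exp2l //= leq_addl.
  have [r1 [E1 s1 K1 V1]] := H1 d r d0 (And3 sr sm so) le1.
  have [r2 [E2 [sr2 sm2 so2] K2 V2]] := H2 d.+1 r1 isT s1 le2.
  have V1' : reg r2 (sreg d) = eval s e1 by rewrite K2 ?V1 //; lia.
  eexists; split.
  + rewrite /= -addnS; apply: (exec_seq E1); apply: (exec_seq1 E2).
    apply: exec_op; rewrite V1' V2.
    by apply: leq_trans eW; apply: op_sem_lt => //; apply: eval_lt.
  + by split => //= [y|]; rewrite !updE !regE ?sr2 //; case: eqP => // -; lia.
  + move=> j jd /=; rewrite !updE !regE.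
    by case: eqP => [|_]; [lia | rewrite K2 ?K1 //; lia].
  + by rewrite /= !updE !regE V1' V2.
Qed.

Lemma comp_emit_sound W s l d r : 0 < d -> simulates s r ->
  size inp + size (out s) + (4 * size l).+2 <= W ->
  exists r', [/\ exec W (comp_emit l d) r r' (4 * size l).+1,
    simulates (emit s l) r' & keeps d r r'].
Proof.
move=> d0; elim: l s r => [|b l IH] s r [sr sm so] sW.
  exists r; split => //; first exact: exec_skip.
  by split => //=; rewrite cats0.
set r1 := set_reg (set_reg (Defs.set_mem (set_reg r (sreg d) b)
   (size inp + size (out s)) b) (sreg d) 1) (sreg 0) (size inp + size (out s) + 1).
have d0F : (d == 0) = false by lia.
have F0d : (0 == d) = false by lia.
have s1 : simulates (emit s [:: b]) r1.
  split => //= [y||]; rewrite ?updE ?regE //=.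
    apply/funext => a; rewrite updE sm catA.
    rewrite [in RHS]nth_cat size_cat.
    have [->|ne] := eqVneq a; first by rewrite ltnn subnn.
    have [//|ge] := ltnP a (size inp + size (out s)).
    by rewrite !nth_default ?size_cat //=; lia.
  by rewrite size_cat addnA.
have sW1 : size inp + size (out (emit s [:: b])) + (4 * size l).+2 <= W.
  by rewrite /= size_cat /= in sW *; lia.
have [r2 [E2 s2 K2]] := IH _ _ s1 sW1.
exists r2; split.
- rewrite (_ : (4 * size (b :: l)).+1 = 1 + (1 + (1 + (1 + (4 * size l).+1)))); last by rewrite /=; lia.
  apply: exec_seq; first by apply: exec_const; case: b sW {s1 sW1 E2 s2 K2 r1} => /=; lia.
  apply: exec_seq; first exact: exec_write.
  apply: exec_seq; first by apply: exec_const; lia.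
  apply: exec_seq E2.
  have -> : r1 = set_reg (set_reg (Defs.set_mem (set_reg r (sreg d) b)
      (reg (set_reg r (sreg d) b) (sreg 0)) (reg (set_reg r (sreg d) b) (sreg d)))
      (sreg d) 1) (sreg 0) (op_sem OpAdd
      (reg (set_reg (Defs.set_mem (set_reg r (sreg d) b)
      (reg (set_reg r (sreg d) b) (sreg 0)) (reg (set_reg r (sreg d) b) (sreg d)))
      (sreg d) 1) (sreg 0))
      (reg (set_reg (Defs.set_mem (set_reg r (sreg d) b)
      (reg (set_reg r (sreg d) b) (sreg 0)) (reg (set_reg r (sreg d) b) (sreg d)))
      (sreg d) 1) (sreg d))).
    by rewrite /= !updE !regE F0d so.
  by apply: exec_op; rewrite /= !updE !regE F0d so; move: sW => /=; lia.
- by rewrite /emit /= -catA in s2 *.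
- move=> j jd; rewrite (K2 j jd) /= !updE !regE.
  by case: eqP => [|_]; [lia | case: eqP => [|//]; lia].
Qed.

Lemma comp_sound N M B W p d Q s r : 1 < B -> (forall x, env s x < B) ->
  0 < d -> simulates s r ->
  size inp + size (out s) + (prog_time N M p).+1 <= W ->
  B ^ prog_deg p <= W -> wp N M B p Q s ->
  exists s' r' t, [/\ exec W (comp p d) r r' t, t <= prog_time N M p,
    Q s', simulates s' r' &
    [/\ forall x, env s' x < B,
        size (out s') <= size (out s) + prog_time N M p & keeps d r r']].
Proof.
move=> B1; elim: p d Q s r => [|x e|l|p1 H1 p2 H2|e p1 H1 p2 H2|b e p IH] d Q s r
  sB d0 sr oW dW /=.
- move=> Qs; exists s, r, 1; split => //; first exact: exec_skip.
  by split => //; lia.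
- move=> [eB Qs]; have eW : B ^ expr_deg e <= W.
    by apply: leq_trans dW; rewrite leq_exp2l.
  have W1 : 1 < W.
    by apply: leq_trans dW; rewrite -(exp1n (prog_deg (Set_ x e))) ltn_exp2r.
  have BW : B <= W.
    by apply: leq_trans dW; rewrite /= expnS leq_pmulr // expn_gt0; lia.
  have [r1 [E1 [s1 m1 o1] K1 V1]] := comp_expr_sound B1 sB d0 sr eW.
  have Fd : (d == d.+1) = false by lia.
  do 3 eexists; split; [| |exact: Qs | |].
  + apply: (exec_seq E1); apply: exec_seq; first by apply: exec_const; lia.
    apply: exec_op; rewrite /= !updE !regE Fd V1 addn0; lia.
  + by lia.
  + split => [y||] //=; rewrite !updE !regE // Fd V1 addn0 /=.
    by rewrite env_set_var s1.
  + split => [y|| j jd] /=; first by rewrite env_set_var; case: eqP.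
      by lia.
    by rewrite !updE !regE -(K1 j jd); case: eqP => [|//]; lia.
- move=> Qs; have lW : size inp + size (out s) + (4 * size l).+2 <= W by move: oW => /=; lia.
  have [r1 [E1 s1 K1]] := comp_emit_sound d0 sr lW.
  do 3 eexists; split; [exact: E1 | by [] | exact: Qs | exact: s1 |].
  by split => //=; rewrite size_cat; lia.
- move=> wp12; move: oW dW => /= oW dW.
  have dW1 : B ^ prog_deg p1 <= W by apply: leq_trans dW; rewrite leq_exp2l // leq_maxl.
  have dW2 : B ^ prog_deg p2 <= W by apply: leq_trans dW; rewrite leq_exp2l // leq_maxr.
  have oW1 : size inp + size (out s) + (prog_time N M p1).+1 <= W by lia.
  have [s1 [r1 [t1 [E1 T1 Q1 S1 [B1' O1 K1]]]]] := H1 d _ _ _ sB d0 sr oW1 dW1 wp12.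
  have oW2 : size inp + size (out s1) + (prog_time N M p2).+1 <= W by lia.
  have [s2 [r2 [t2 [E2 T2 Q2 S2 [B2 O2 K2]]]]] := H2 d _ _ _ B1' d0 S1 oW2 dW2 Q1.
  exists s2, r2, (t1 + t2); split => //; [exact: exec_seq E1 E2 | lia |].
  by split => //; [lia | move=> j jd; rewrite K2 ?K1].
- move: oW dW => /= oW dW.
  have dW0 : B ^ expr_deg e <= W by apply: leq_trans dW; rewrite leq_exp2l //; lia.
  have dW1 : B ^ prog_deg p1 <= W by apply: leq_trans dW; rewrite leq_exp2l //; lia.
  have dW2 : B ^ prog_deg p2 <= W by apply: leq_trans dW; rewrite leq_exp2l //; lia.
  have [r0 [E0 s0 K0 V0]] := comp_expr_sound B1 sB d0 sr dW0.
  have oW1 : size inp + size (out s) + (prog_time N M p1).+1 <= W by lia.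
  have oW2 : size inp + size (out s) + (prog_time N M p2).+1 <= W by lia.
  have [z|/eqP nz] := boolP (eval s e == 0).
    move=> /= wp2.
    have [s2 [r2 [t2 [E2 T2 Q2 S2 [B2 O2 K2]]]]] := H2 d _ _ _ sB d0 s0 oW2 dW2 wp2.
    exists s2, r2, (expr_time e + t2.+1); split => //.
    + by apply: (exec_seq E0); apply: exec_if_false => //; rewrite V0 (eqP z).
    + lia.
    + by split => //; [lia | move=> j jd; rewrite K2 ?K0].
  move=> /= wp2.
  have [s2 [r2 [t2 [E2 T2 Q2 S2 [B2 O2 K2]]]]] := H1 d _ _ _ sB d0 s0 oW1 dW1 wp2.
  exists s2, r2, (expr_time e + t2.+1); split => //.
  + by apply: (exec_seq E0); apply: exec_if_true => //; rewrite V0; apply/eqP.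
  + lia.
  + by split => //; [lia | move=> j jd; rewrite K2 ?K0].
- move: oW dW => /= oW dW [eN wpn].
  have dW0 : B ^ expr_deg e <= W by apply: leq_trans dW; rewrite leq_exp2l //; lia.
  have dW1 : B ^ prog_deg p <= W by apply: leq_trans dW; rewrite leq_exp2l //; lia.
  have W1 : 1 < W.
    apply: leq_trans dW1; rewrite -(exp1n (prog_deg p)) ltn_exp2r //.
    by have := prog_deg_gt1 p; lia.
  have [r0 [E0 s0 K0 V0]] := comp_expr_sound B1 sB d0 sr dW0.
  have vW : eval s e < W by apply: leq_trans (eval_lt e B1 sB) dW0.
  set n := eval s e in eN wpn V0 vW.
  set c := CWhile _ _.
  (* A round costs the body, two steps to decrement the counter and one for the test, whence the
     [.+3]. *)
  suff [s' [r' [t [E T Q' S [B' O K]]]]] :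
    exists s' r' t, [/\ exec W c r0 r' t, t <= (n * (prog_time N M p).+3).+1,
    Q s', simulates s' r' & [/\ forall x, env s' x < B,
      size (out s') <= size (out s) + n * (prog_time N M p).+3 & keeps d r0 r']].
    have mono : n * (prog_time N M p).+3 <=
      (if b then N else M) * (prog_time N M p).+3 by rewrite leq_mul2r eN orbT.
    exists s', r', (expr_time e + t); split => //; [exact: exec_seq E0 E | lia |].
    by split => //; [lia | move=> j jd; rewrite K ?K0].
  have {}oW : size inp + size (out s) + (n * (prog_time N M p).+3).+1 <= W.
    have mono : n * (prog_time N M p).+3 <=
      (if b then N else M) * (prog_time N M p).+3 by rewrite leq_mul2r eN orbT.
    lia.
  clearbody n; clear sr E0 K0 eN.
  elim: n s r0 sB s0 wpn V0 oW vW => [|n IHn] s0 r0 sB sr wpn V0 oW vW.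
    exists s0, r0, 1; split => //; [exact: exec_while_stop | by split => //; lia].
  have oW1 : size inp + size (out s0) + (prog_time N M p).+1 <= W by lia.
  have [s1 [r1 [t1 [E1 T1 Q1 S1 [B1' O1 K1]]]]] :=
    IH d.+1 _ _ _ sB isT sr oW1 dW1 wpn.
  have V1 : reg r1 (sreg d) = n.+1 by rewrite K1 ?V0 //; lia.
  pose r2 := set_reg (set_reg r1 (sreg d.+1) 1) (sreg d) n.
  have Fd : (d == d.+1) = false by lia.
  have F0d : (0 == d) = false by lia.
  have E2 : exec W (CSeq (CConst (sreg d.+1) 1)
      (COp OpSub (sreg d) (sreg d) (sreg d.+1))) r1 r2 2.
    apply: (@exec_seq _ _ _ _ _ _ 1 1); first exact: exec_const.
    rewrite (_ : r2 = set_reg (set_reg r1 (sreg d.+1) 1) (sreg d)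
      (op_sem OpSub (reg (set_reg r1 (sreg d.+1) 1) (sreg d))
                    (reg (set_reg r1 (sreg d.+1) 1) (sreg d.+1)))).
      by apply: exec_op; rewrite /= !updE !regE Fd V1; lia.
    by rewrite /= !updE !regE Fd V1 subn1.
  have S2 : simulates s1 r2.
    case: S1 => s1r s1m s1o; split => //= [y|]; rewrite !updE !regE //.
    by rewrite F0d.
  have oW2 : size inp + size (out s1) + (n * (prog_time N M p).+3).+1 <= W.
    by move: oW; rewrite mulSn; lia.
  have V2 : reg r2 (sreg d) = n by rewrite /= !updE !regE.
  have [s' [r' [t [E T Q' S [B' O K]]]]] :=
    IHn _ _ B1' S2 Q1 V2 oW2 (ltnW vW).
  exists s', r', ((t1 + 2) + t).+1; split => //.
  + by apply: exec_while_loop E; [rewrite V0 | apply: exec_seq E1 E2].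
  + by rewrite mulSn; lia.
  + split => //; first by rewrite mulSn; lia.
    move=> j jd; rewrite K // /= !updE !regE.
    case: eqP => [|_]; first lia.
    by case: eqP => [|_]; [lia | rewrite K1 //; lia].
Qed.

End Semantics.

(** * Turning the output of one program into the input of the next *)

Fixpoint regs_bound (c : cmd) : nat :=
  match c with
  | CConst r _ | COp _ r _ _ | CRead r _ => r.+1
  | CSeq c1 c2 | CIf _ c1 c2 => maxn (regs_bound c1) (regs_bound c2)
  | CWhile _ c => regs_bound c
  | CSkip | CWrite _ _ => 0
  end.

Lemma exec_frame W c s s' t r : exec W c s s' t -> regs_bound c <= r ->
  reg s' r = reg s r.
Proof.
move=> E; elim: E => //=; try by move=> *; rewrite updE; case: eqP => // ?; lia.
- move=> c1 c2 s1 s2 s3 t1 t2 _ H1 _ H2; rewrite geq_max => /andP[l1 l2].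
  by rewrite H2 ?H1.
- by move=> r0 c1 c2 s1 s2 t1 _ _ H1; rewrite geq_max => /andP[l1 l2]; rewrite H1.
- by move=> r0 c1 c2 s1 s2 t1 _ _ H1; rewrite geq_max => /andP[l1 l2]; rewrite H1.
- by move=> r0 c1 s1 s2 s3 t1 t2 _ _ H1 _ H2 l; rewrite H2 ?H1.
Qed.

Lemma exec_opE W o r r1 r2 s v : op_sem o (reg s r1) (reg s r2) = v -> v < W ->
  exec W (COp o r r1 r2) s (set_reg s r v) 1.
Proof. by move=> <-; apply: exec_op. Qed.

Lemma exec_readE W r r1 s a v : reg s r1 = a -> Defs.mem s a = v ->
  exec W (CRead r r1) s (set_reg s r v) 1.
Proof. by move=> <- <-; apply: exec_read. Qed.

Lemma exec_writeE W r1 r s a v : reg s r1 = a -> reg s r = v ->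
  exec W (CWrite r1 r) s (Defs.set_mem s a v) 1.
Proof. by move=> <- <-; apply: exec_write. Qed.

(* The output follows the input in memory; it is moved to address 0 and the rest
   is erased, so as to reach the state [ram_input y].  Register 3 holds the size
   of the input, then the number of cells to be erased, 5 the address to be
   written, 11 the constant 1 and 13 the number of bits to be copied. *)
Definition copy_loop : cmd :=
  CWhile 13 (CSeq (COp OpAdd 7 3 5) (CSeq (CRead 9 7) (CSeq (CWrite 5 9)
    (CSeq (COp OpAdd 5 5 11) (COp OpSub 13 13 11))))).

Definition erase_loop : cmd :=
  CWhile 3 (CSeq (CWrite 5 9) (CSeq (COp OpAdd 5 5 11) (COp OpSub 3 3 11))).

Lemma ram_state_eq s1 s2 : reg s1 =1 reg s2 -> Defs.mem s1 =1 Defs.mem s2 ->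
  s1 = s2.
Proof.
by case: s1 s2 => [r1 m1] [r2 m2] /= /funext -> /funext ->.
Qed.

(** The two ranges may overlap. The copy runs upwards and reads at [size inp + i], never below the
    write address [i], so no bit is overwritten before it is read. *)
Lemma copy_loop_sound W inp y s i k : i + k = size y ->
  size inp + size y + 1 < W ->
  reg s 3 = size inp -> reg s 5 = i -> reg s 11 = 1 -> reg s 13 = k ->
  Defs.mem s =1 (fun a => nat_of_bool
    (if a < i then nth false y a else nth false (inp ++ y) a)) ->
  exists s', [/\ exec W copy_loop s s' (6 * k).+1,
    [/\ reg s' 0 = reg s 0, reg s' 3 = size inp & reg s' 5 = size y],
    reg s' 11 = 1 &
    Defs.mem s' =1 (fun a => nat_of_bool
      (if a < size y then nth false y a else nth false (inp ++ y) a))].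
Proof.
move=> ik sW; elim: k i s ik => [|k IH] i s ik r3 r5 r11 r13 m.
  rewrite addn0 in ik; exists s; split => //; rewrite -?ik //.
  exact: exec_while_stop.
pose v : nat := nth false y i.
pose s1 := set_reg (set_reg (Defs.set_mem (set_reg (set_reg s 7 (size inp + i)) 9 v)
  i v) 5 i.+1) 13 k.
have [||||||s' [E [e1 e2 e3] e4 e5]] := IH i.+1 s1 => //; first by lia.
- move=> a; rewrite /= updE m; have [->|ne] := eqVneq a i; first by rewrite ltnSn.
  by rewrite ltnS [a <= i]leq_eqVlt (negPf ne).
exists s'; split => //.
rewrite (_ : (6 * k.+1).+1 = (5 + (6 * k).+1).+1); last by lia.
apply: exec_while_loop E; first by rewrite r13.
have mv : Defs.mem (set_reg s 7 (size inp + i)) (size inp + i) = v.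
  by rewrite [LHS]m nth_cat !ltnNge leq_addl leq_addr /= addKn.
apply: (@exec_seq _ _ _ _ _ _ 1 4).
  by apply: (@exec_opE _ _ _ _ _ _ (size inp + i)); rewrite /= ?updE /= ?r3 ?r5 //; lia.
apply: (@exec_seq _ _ _ _ _ _ 1 3); first by apply: (@exec_readE _ _ _ _ (size inp + i) v).
apply: (@exec_seq _ _ _ _ _ _ 1 2); first by apply: (@exec_writeE _ _ _ _ i v).
apply: (@exec_seq _ _ _ _ _ _ 1 1).
  by apply: (@exec_opE _ _ _ _ _ _ i.+1); rewrite /= ?updE /= ?r5 ?r11 ?addn1 //; lia.
by apply: (@exec_opE _ _ _ _ _ _ k); rewrite /= ?updE /= ?r13 ?r11 ?subn1 //; lia.
Qed.

Lemma erase_loop_sound W y s i k : i + k < W ->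
  reg s 3 = k -> reg s 5 = i -> reg s 9 = 0 -> reg s 11 = 1 ->
  (forall a, a < i -> Defs.mem s a = nth false y a) -> size y <= i ->
  (forall a, i + k <= a -> Defs.mem s a = 0) ->
  exists s', [/\ exec W erase_loop s s' (4 * k).+1,
    reg s' 0 = reg s 0 & Defs.mem s' =1 (fun a => nat_of_bool (nth false y a))].
Proof.
move=> ik; elim: k i s ik => [|k IH] i s ik r3 r5 r9 r11 m sy z.
  exists s; split => //; first exact: exec_while_stop.
  move=> a; have [/m //|ge] := ltnP a i.
  by rewrite nth_default ?z ?addn0 //; apply: leq_trans ge.
pose s1 := set_reg (set_reg (Defs.set_mem s i 0) 5 i.+1) 3 k.
have [||||||||s' [E e1 e2]] := IH i.+1 s1 => //; first by lia.
- move=> a; rewrite ltnS leq_eqVlt /= updE.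
  by case: eqVneq => [->|ne] /=; [rewrite nth_default | exact: m].
- exact: leqW.
- by move=> a ia; rewrite /= updE; case: eqP => // _; apply: z; lia.
exists s'; split => //.
rewrite (_ : (4 * k.+1).+1 = (3 + (4 * k).+1).+1); last by lia.
apply: exec_while_loop E; first by rewrite r3.
apply: (@exec_seq _ _ _ _ _ _ 1 2); first by apply: (@exec_writeE _ _ _ _ i 0).
apply: (@exec_seq _ _ _ _ _ _ 1 1).
  by apply: (@exec_opE _ _ _ _ _ _ i.+1); rewrite /= ?updE /= ?r5 ?r11 ?addn1 //; lia.
by apply: (@exec_opE _ _ _ _ _ _ k); rewrite /= ?updE /= ?r3 ?r11 ?subn1 //; lia.
Qed.

Fixpoint clear_regs (n : nat) : cmd :=
  match n with
  | 0 => CSkip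
  | n.+1 => CSeq (CConst n.+1 0) (clear_regs n)
  end.

Lemma clear_regs_sound W n s : 0 < W ->
  exec W (clear_regs n) s
    (RamState (fun r => if 0 < r <= n then 0 else reg s r) (Defs.mem s)) n.+1.
Proof.
move=> W0; elim: n s => [|n IH] s.
  rewrite (_ : RamState _ _ = s); first exact: exec_skip.
  by apply: ram_state_eq => //= r; case: r.
rewrite -(add1n n.+1); apply: exec_seq (exec_const _ _ W0) _.
have := IH (set_reg s n.+1 0); congr exec; apply: ram_state_eq => //= r.
rewrite updE; case: r => [|r] //=; rewrite eqSS ltnS.
by case: ltngtP.
Qed.

(** Register 1 is [sreg 0], the output pointer. Register 3 is [sreg 1]: compiling the body at depth
    2 preserves the input size saved there. The first two additions copy register 0, because
    register 5 is initially 0. *)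
Definition translate (p : prog) : cmd :=
  CSeq (COp OpAdd 3 0 5) (CSeq (COp OpAdd 1 0 5) (CSeq (comp p 2)
  (CSeq (COp OpSub 0 1 3) (CSeq (CConst 5 0) (CSeq (CConst 11 1)
  (CSeq (COp OpAdd 13 0 5) (CSeq copy_loop (CSeq (CConst 9 0)
  erase_loop)))))))).

(** Registers from [regs_bound] on are never written ([exec_frame]), and register 0 holds the size
    of the output; clearing the registers in between therefore gives a state equal to [ram_input] of
    the output. *)
Definition compile (p : prog) : cmd :=
  CSeq (translate p) (clear_regs (regs_bound (translate p))).

Definition init (inp : seq bool) : lstate :=
  LState [:: size inp] [::].

Lemma translate_sound N M B W p inp y : 1 < B -> size inp < B ->
  (size inp + prog_time N M p) * 2 + 2 < W -> B ^ prog_deg p <= W ->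
  wp inp N M B p (fun s => out s = y) (init inp) ->
  exists s t, [/\ exec W (translate p) (ram_input inp) s t,
    t <= prog_time N M p + 6 * (size inp + size y) + 12,
    reg s 0 = size y & Defs.mem s =1 (fun a => nat_of_bool (nth false y a))] /\
    size y <= prog_time N M p.
Proof.
move=> B1 nB tW dW wpp.
pose s1 := set_reg (set_reg (ram_input inp) 3 (size inp)) 1 (size inp).
have S1 : simulates inp (init inp) s1.
  split => [[|x]||] //=; rewrite ?addn0 //; last by apply/funext => a; rewrite cats0.
  by rewrite !updE /vreg /env /= nth_nil; do ! case: eqP => //; lia.
have iB x : env (init inp) x < B by case: x => [|x] //; rewrite /env /= nth_nil; lia.
have oW : size inp + size (out (init inp)) + (prog_time N M p).+1 <= W.
  by rewrite /=; lia.
have [s' [s2 [t [E T Q [S2r S2m S2o] [_ O K]]]]] :=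
  comp_sound B1 iB (isT : 0 < 2) S1 oW dW wpp.
rewrite Q in S2m S2o O; rewrite /= add0n in O.
have r23 : reg s2 3 = size inp := K 1 isT.
pose s3 := set_reg (set_reg (set_reg (set_reg s2 0 (size y)) 5 0) 11 1) 13 (size y).
have [|||||||s4 [E4 [e40 e43 e45] e411 m4]] :=
    @copy_loop_sound W inp y s3 0 (size y) => //.
- by lia.
- by move=> a; rewrite /= S2m.
(* Before the copy the cells in use ended at [size inp + size y]; the first [size y] now hold the
   output, so [size inp] cells remain to be erased. *)
have [||||||||s5 [E5 e50 m5]] :=
    @erase_loop_sound W y (set_reg s4 9 0) (size y) (size inp) => //.
- by lia.
- by move=> a ay; rewrite /= m4 ay.
- move=> a ay; rewrite /= m4 ltnNge (leq_trans _ ay) ?leq_addr //=.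
  by rewrite nth_default ?size_cat //; lia.
exists s5, (1 + (1 + (t + (1 + (1 + (1 + (1 + ((6 * size y).+1 +
   (1 + (4 * size inp).+1))))))))); split => //; split => //.
- apply: exec_seq; first by apply: (@exec_opE _ _ _ _ _ _ (size inp)); rewrite /= ?updE /= ?addn0; lia.
  apply: exec_seq; first by apply: (@exec_opE _ _ _ _ _ _ (size inp)); rewrite /= ?updE /= ?addn0; lia.
  apply: exec_seq; first exact: E.
  apply: exec_seq.
    by apply: (@exec_opE _ _ _ _ _ _ (size y)); rewrite /= ?updE /= ?S2o ?r23 ?addKn; lia.
  apply: exec_seq; first by apply: exec_const; lia.
  apply: exec_seq; first by apply: exec_const; lia.
  apply: exec_seq.
    by apply: (@exec_opE _ _ _ _ _ _ (size y)); rewrite /= ?updE /= ?addn0; lia.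
  apply: exec_seq; first exact: E4.
  by apply: exec_seq E5; apply: exec_const; lia.
- by lia.
- by rewrite e50 /= updE e40.
Qed.

Lemma compile_sound N M B W p inp y : 1 < B -> size inp < B ->
  (size inp + prog_time N M p) * 2 + 2 < W -> B ^ prog_deg p <= W ->
  wp inp N M B p (fun s => out s = y) (init inp) ->
  (exists2 t, exec W (compile p) (ram_input inp) (ram_input y) t &
    t <= prog_time N M p + 6 * (size inp + size y) +
      (regs_bound (translate p) + 13)).
Proof.
move=> B1 nB tW dW wpp.
have [s [t [[E T r0 m] _]]] := translate_sound B1 nB tW dW wpp.
have W0 : 0 < W by lia.
exists (t + (regs_bound (translate p)).+1); last by lia.
rewrite /compile; set rb := regs_bound _.
apply: exec_seq (E) _.
have := clear_regs_sound rb s W0; congr exec; apply: ram_state_eq => [r|] //=.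
case: eqP => [->//|]; case: r => // r _ /=; case: ltnP => // rbr.
by rewrite (exec_frame E) //; apply: ltnW.
Qed.

(** * Quasilinear reductions *)

(* Time O(n ^ (3 - 1 / q)), raised to the power [q]. *)
Definition subcubic (P : problem) := exists c k q K, 0 < q /\
  forall x : instance P, let n := size (encode x) in exists s t,
    [/\ exec ((n + 2) ^ k) c (ram_input (encode x)) s t,
        t ^ q <= K * (n + 2) ^ (3 * q - 1)
      & answer x <-> reg s 0 != 0].

(** The second algorithm of a composition comes with a word bound in the size of its own input,
    which has to be enlarged to the common one. *)
Lemma exec_mono W W' c s s' t : W <= W' -> exec W c s s' t -> exec W' c s s' t.
Proof.
move=> WW E; elim: E; try by econstructor; eauto.
- by move=> r k s0 kW; apply: exec_const; apply: leq_trans WW.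
- by move=> o r r1 r2 s0 kW; apply: exec_op; apply: leq_trans WW.
Qed.

Fixpoint long_depth (p : prog) : nat :=
  match p with
  | Seq p1 p2 | If _ p1 p2 => maxn (long_depth p1) (long_depth p2)
  | For b _ p => b + long_depth p
  | _ => 0
  end.

Fixpoint short_depth (p : prog) : nat :=
  match p with
  | Seq p1 p2 | If _ p1 p2 => maxn (short_depth p1) (short_depth p2)
  | For b _ p => ~~ b + short_depth p
  | _ => 0
  end.

Lemma leq_pexp2l_homo m i j : 0 < m -> i <= j -> m ^ i <= m ^ j.
Proof. by move=> m0 ij; rewrite leq_pexp2l. Qed.

Lemma leq_exp2r_homo m1 m2 i : m1 <= m2 -> m1 ^ i <= m2 ^ i.
Proof. by case: i => // i; rewrite leq_exp2r. Qed.

Lemma prog_time_le p : exists K, forall N M,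
  prog_time N M p <= K * (N.+1 ^ long_depth p * M.+1 ^ short_depth p).
Proof.
elim: p => [|x e|l|p1 [K1 H1] p2 [K2 H2]|e p1 [K1 H1] p2 [K2 H2]|b e p [K H]].
- by exists 1.
- by exists (expr_time e).+2 => N M /=; rewrite !muln1.
- by exists (4 * size l).+1 => N M /=; rewrite !muln1.
- exists (K1 + K2) => N M; have {}H1 := H1 N M; have {}H2 := H2 N M.
  rewrite mulnDl /=; apply: leq_add.
    by apply: (leq_trans H1); rewrite leq_mul2l leq_mul ?orbT // leq_pexp2l_homo // leq_maxl.
  by apply: (leq_trans H2); rewrite leq_mul2l leq_mul ?orbT // leq_pexp2l_homo // leq_maxr.
- exists (expr_time e + 1 + K1 + K2) => N M; have {}H1 := H1 N M; have {}H2 := H2 N M.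
  rewrite /=; set D := N.+1 ^ _ * _ ^ maxn _ _.
  have D0 : 0 < D by rewrite muln_gt0 !expn_gt0.
  have H1' : prog_time N M p1 <= K1 * D.
    by apply: (leq_trans H1); rewrite leq_mul2l leq_mul ?orbT // leq_pexp2l_homo // leq_maxl.
  have H2' : prog_time N M p2 <= K2 * D.
    by apply: (leq_trans H2); rewrite leq_mul2l leq_mul ?orbT // leq_pexp2l_homo // leq_maxr.
  by nia.
- exists (expr_time e + 4 + K) => N M; have {}H := H N M.
  rewrite /=; set D := N.+1 ^ _ * _ in H.
  have D0 : 0 < D by rewrite muln_gt0 !expn_gt0.
  have -> : N.+1 ^ (b + long_depth p) * M.+1 ^ (~~ b + short_depth p) =
    (if b then N.+1 else M.+1) * D.
    by rewrite /D; case: b => /=; rewrite ?add0n ?add1n ?expnS; lia.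
  by case: b; nia.
Qed.

(** For the exponent [j.+1], raise [l <= j.+1 * 2 ^ (l %/ j.+1)] to the power [j.+1]. *)
Lemma exp_vs_exp2 j : exists C, forall l, l ^ j <= C * 2 ^ l.
Proof.
case: j => [|j]; first by exists 1 => l; rewrite mul1n expn_gt0.
exists (j.+1 ^ j.+1) => l.
apply: (@leq_trans ((j.+1 * 2 ^ (l %/ j.+1)) ^ j.+1)).
  apply: leq_exp2r_homo; apply: (@leq_trans (j.+1 * (l %/ j.+1).+1)).
    by rewrite mulnC ltnW // ltn_ceil.
  by rewrite leq_mul2l /= ltn_expl.
by rewrite expnMn -expnM leq_mul2l leq_pexp2l_homo ?orbT // leq_trunc_div.
Qed.

(** The shift by 2 makes [lg n] positive for every [n], so it can be used as a factor. *)
Definition lg n := up_log 2 (n + 2).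

Lemma lg_gt0 n : 0 < lg n.
Proof. by rewrite /lg up_log_gt0; lia. Qed.

Lemma exp2_lg n : 2 ^ lg n <= 2 * (n + 2).
Proof.
have n1 : 1 < n + 2 by lia.
have := up_log_bounds (isT : 1 < 2) n1; rewrite -/(lg n) => /andP[+ _].
by have := lg_gt0 n; case: (lg n) => // l _ /=; rewrite expnS; lia.
Qed.

Lemma lg_exp j : exists C, forall n, lg n ^ j <= C * (n + 2).
Proof.
have [C H] := exp_vs_exp2 j; exists (C * 2) => n.
by apply: leq_trans (H _) _; rewrite -mulnA leq_mul2l exp2_lg orbT.
Qed.

Lemma lg_le n : lg n <= n + 2.
Proof. by rewrite /lg; apply: up_log_min => //; rewrite ltnW // ltn_expl. Qed.

Lemma expnD_le x y m : (x + y) ^ m <= 2 ^ m * (x ^ m + y ^ m).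
Proof.
have le : x + y <= 2 * maxn x y by lia.
apply: leq_trans (leq_exp2r_homo m le) _; rewrite expnMn leq_mul2l; apply/orP; right.
by case: (leqP x y) => _; [rewrite leq_addl | rewrite leq_addr].
Qed.

Lemma mul_le_exp X x y i j : x <= X ^ i -> y <= X ^ j -> x * y <= X ^ (i + j).
Proof. by move=> xi yj; rewrite expnD leq_mul. Qed.

Lemma add_le_exp X x y i j : 1 < X -> x <= X ^ i -> y <= X ^ j -> x + y <= X ^ (i + j).+1.
Proof.
move=> X1 xi yj; rewrite expnS expnD.
have : 0 < X ^ i by rewrite expn_gt0; lia.
have : 0 < X ^ j by rewrite expn_gt0; lia.
move: (X ^ i) (X ^ j) xi yj => u v xu yv v0 u0.
have : u + v <= 2 * (u * v) by nia.
have : 2 * (u * v) <= X * (u * v) by rewrite leq_mul2r X1 orbT.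
by lia.
Qed.

Lemma self_le_exp X K : 1 < X -> K <= X ^ K.
Proof. by move=> X1; apply: ltnW; apply: ltn_expl. Qed.

(** The saving [1 / q] is halved. Squaring the bound on [t2 ^ q] gives the exponent [6 * q - 2], one
    less than [3 * (2 * q) - 1], and the spare factor [n + 2] absorbs any fixed power of [lg n] by
    [lg_exp]. The quadratic part ends with exponent [4 * q + 1], which is at most [6 * q - 1]
    because [0 < q]. *)
Lemma time_compose q j K1 K2 K3 : 0 < q -> exists K, forall n t1 t2 Y,
  t1 <= K1 * ((n + 2) ^ 2 * lg n ^ j) -> t2 ^ q <= K2 * Y ^ (3 * q - 1) ->
  Y <= K3 * ((n + 2) * lg n) ->
  (t1 + t2) ^ (2 * q) <= K * (n + 2) ^ (3 * (2 * q) - 1).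
Proof.
move=> q0; have [C HC] := lg_exp (j * (2 * q)).
have [C' HC'] := lg_exp (6 * q - 2).
exists (2 ^ (2 * q) * (K1 ^ (2 * q) * C + (K2 * K3 ^ (3 * q - 1)) ^ 2 * C')).
move=> n t1 t2 Y h1 h2 hY; apply: leq_trans (expnD_le _ _ _) _.
rewrite -mulnA leq_mul2l mulnDl; apply/orP; right; apply: leq_add.
  apply: leq_trans (leq_exp2r_homo _ h1) _; rewrite !expnMn -!expnM -!mulnA.
  rewrite leq_mul2l; apply/orP; right.
  apply: leq_trans (_ : (n + 2) ^ (2 * (2 * q)) * (C * (n + 2)) <= _).
    by rewrite mulnA -expnD addnn -mul2n leq_mul2l HC orbT.
  rewrite mulnCA leq_mul2l -expnSr; apply/orP; right; apply: leq_pexp2l_homo; lia.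
rewrite mulnC expnM; apply: leq_trans (leq_exp2r_homo 2 h2) _.
have hY' := leq_exp2r_homo (3 * q - 1) hY.
apply: (@leq_trans ((K2 * (K3 * ((n + 2) * lg n)) ^ (3 * q - 1)) ^ 2)).
  by apply: leq_exp2r_homo; rewrite leq_mul2l hY' orbT.
rewrite !(expnMn _ _ (3 * q - 1)) (mulnA K2) (expnMn (K2 * _)).
rewrite (expnMn ((n + 2) ^ _)) -!expnM -mulnA leq_mul2l; apply/orP; right.
rewrite (_ : (3 * q - 1) * 2 = 6 * q - 2); last by lia.
apply: leq_trans (_ : (n + 2) ^ (6 * q - 2) * (C' * (n + 2)) <= _).
  by rewrite leq_mul2l HC' orbT.
by rewrite mulnCA leq_mul2l -expnSr; apply/orP; right; apply: leq_pexp2l_homo; lia.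
Qed.

Lemma setup_time_le t P n m r A a D : t <= P + 6 * (n + m) + r ->
  P <= A * D -> n <= D -> m <= a * D -> 0 < D ->
  t + 2 <= (A + 6 * (1 + a) + r + 2) * D.
Proof.
move=> *; have : r <= r * D by rewrite leq_pmulr.
by lia.
Qed.

(* [For true] loops take O(n) rounds and [For false] loops O(log n) rounds. *)
Definition reduces (neg : bool) (P1 P2 : problem) :=
  exists (f : instance P1 -> instance P2) p a,
  [/\ 0 < a, long_depth p <= 2 & forall x, let n := size (encode x) in
    [/\ wp (encode x) (a * (n + 2)) (a * lg n) ((n + 2) ^ a) p
          (fun s => out s = encode (f x)) (init (encode x)),
        size (encode (f x)) <= a * ((n + 2) * lg n)
      & answer x <-> if neg then ~ answer (f x) else answer (f x)]].

Lemma reduces_subcubic neg P1 P2 :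
  reduces neg P1 P2 -> subcubic P2 -> subcubic P1.
Proof.
move=> [f [p [a [a0 dp Hf]]]] [c [k [q [K [q0 HP]]]]].
have [Kp Hp] := prog_time_le p.
pose rb := regs_bound (translate p) + 13.
pose j := (short_depth p).+1.
pose A := Kp * (a.+1 ^ 2 * a.+1 ^ short_depth p).
pose K1 := A + 6 * (1 + a) + rb + 2.
have [KK HK] := time_compose j K1 K a.+2 q0.
pose kt := Kp + ((a.+1 + 1) * 2 + (a.+1 + 1) * short_depth p).
(* The maximum of three demands on the word size: the values computed by the reduction ([WB]), its
   addresses ([tW]), and the words of the second algorithm on the translated input ([WE2]). *)
pose k1 := maxn (a * prog_deg p) (maxn (((1 + kt).+1 + 2 + 2).+1).+1 ((a.+2 + 2) * k)).
(* Two more instructions negate the answer in register 0; the summand 2 in [t + 2] below pays for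
   them. *)
exists (if neg then CSeq (compile p) (CSeq c (CSeq (CConst 1 0) (COp OpEq 0 0 1)))
        else CSeq (compile p) c), k1, (2 * q), KK; split; first by lia.
move=> x; have := Hf x; set y := f x; set ex := encode x; set ey := encode y.
move=> /=; set n := size ex; move=> [wpx szy ans].
set X := n + 2 in wpx szy *; have X1 : 1 < X by rewrite /X; lia.
set L := lg n in wpx szy *; have L0 : 0 < L by apply: lg_gt0.
have LX : L <= X by apply: lg_le.
have tp : prog_time (a * X) (a * L) p <=
    A * (X ^ 2 * L ^ short_depth p).
  apply: leq_trans (Hp _ _) _; rewrite /A -mulnA leq_mul2l; apply/orP; right.
  rewrite mulnACA -!expnMn; apply: leq_mul.
    apply: (@leq_trans ((a.+1 * X) ^ long_depth p)); first by apply: leq_exp2r_homo; nia.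
    by apply: leq_pexp2l_homo => //; nia.
  by apply: leq_exp2r_homo; nia.
have tpX : prog_time (a * X) (a * L) p <= X ^ kt.
  apply: leq_trans (Hp _ _) _; apply: mul_le_exp; first exact: self_le_exp.
  have pa : a.+1 * X <= X ^ (a.+1 + 1).
    by apply: mul_le_exp; rewrite ?expn1 //; apply: self_le_exp.
  apply: mul_le_exp; rewrite expnM.
    apply: (@leq_trans ((X ^ (a.+1 + 1)) ^ long_depth p)).
      by apply: leq_exp2r_homo; apply: leq_trans pa; nia.
    by apply: leq_pexp2l_homo => //; rewrite expn_gt0; lia.
  by apply: leq_exp2r_homo; apply: leq_trans pa; nia.
pose W := X ^ k1.
have WB : (X ^ a) ^ prog_deg p <= W.
  by rewrite -expnM; apply: leq_pexp2l_homo; [lia | rewrite /k1; lia].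
have tW : (n + prog_time (a * X) (a * L) p) * 2 + 2 < W.
  apply: (@leq_trans (X ^ (((1 + kt).+1 + 2 + 2).+1).+1)); last first.
    by apply: leq_pexp2l_homo; [lia | rewrite /k1; lia].
  rewrite expnS; apply: (@leq_trans (2 * X ^ ((1 + kt).+1 + 2 + 2).+1)); last first.
    by rewrite leq_mul2r; lia.
  have : (n + prog_time (a * X) (a * L) p) * 2 + 2 <= X ^ ((1 + kt).+1 + 2 + 2).+1.
    apply: add_le_exp => //; last exact: self_le_exp.
    apply: mul_le_exp; last exact: self_le_exp.
    by apply: add_le_exp => //; rewrite expn1 /X; lia.
  have : 0 < X ^ ((1 + kt).+1 + 2 + 2).+1 by rewrite expn_gt0; lia.
  by lia.
have XB : 1 < X ^ a by rewrite -(exp1n a) ltn_exp2r.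
have nB : n < X ^ a.
  by apply: leq_trans (leq_pexp2l_homo _ a0); rewrite ?expn1 /X; lia.
have [t Ec tc] := compile_sound XB nB tW WB wpx.
have [s2 [t2 [E2 T2 ans2]]] := HP y.
have yX : size ey + 2 <= a.+2 * (X * L) by rewrite -/ey -/X in szy *; nia.
have WE2 : (size ey + 2) ^ k <= W.
  apply: (@leq_trans (X ^ ((a.+2 + 2) * k))); last first.
    by apply: leq_pexp2l_homo; [lia | rewrite /k1; lia].
  rewrite expnM; apply: leq_exp2r_homo; apply: leq_trans yX _.
  by apply: mul_le_exp; [exact: self_le_exp | rewrite -mulnn leq_mul2l LX orbT].
have {}E2 := exec_mono WE2 E2.
have W1 : 1 < W by lia.
have T1 : t + 2 <= K1 * (X ^ 2 * L ^ j).
  have D1 : X ^ 2 * L ^ short_depth p <= X ^ 2 * L ^ j.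
    by rewrite leq_mul2l leq_pexp2l_homo ?orbT // /j.
  have D2 : X * L <= X ^ 2 * L ^ j.
    by rewrite leq_mul ?orbT // -[leqLHS]expn1 leq_pexp2l_homo // ltnW.
  have D3 : n <= X ^ 2 * L ^ j.
    by apply: leq_trans D2; apply: leq_trans (leq_pmulr _ L0); rewrite /X; lia.
  have D0 : 0 < X ^ 2 * L ^ j by apply: leq_trans D2; rewrite muln_gt0; lia.
  have tp' : prog_time (a * X) (a * L) p <=
    A * (X ^ 2 * L ^ j).
    by apply: leq_trans tp _; rewrite leq_mul2l D1 orbT.
  have ea : size ey <= a * (X ^ 2 * L ^ j).
    by apply: leq_trans szy _; rewrite leq_mul2l D2 orbT.
  exact: setup_time_le tc tp' D3 ea D0.
clear Hf; case: neg ans => ans; last first.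
  exists s2, (t + t2); split.
  - exact: exec_seq Ec E2.
  - apply: leq_trans (HK n (t + 2) t2 _ T1 T2 yX); apply: leq_exp2r_homo; lia.
  - by rewrite ans.
exists (set_reg (set_reg s2 1 0) 0 (reg s2 0 == 0)), (t + (t2 + (1 + 1))); split.
- apply: exec_seq Ec _; apply: exec_seq E2 _; apply: exec_seq.
    by apply: exec_const; lia.
  by apply: exec_opE => //; case: eqP; lia.
- apply: leq_trans (HK n (t + 2) t2 _ T1 T2 yX); apply: leq_exp2r_homo; lia.
- rewrite ans ans2 /= updE /=; case: eqP => /= H; split=> //.
Qed.

(** * Real exponents and integer powers *)

Section TrulySubcubic.
Import Order.TTheory GRing.Theory Num.Theory.
Import numFieldNormedType.Exports.
Variable R : realType.
Local Open Scope ring_scope.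

Lemma subcubic_of_truly P : truly_subcubic R P -> subcubic P.
Proof.
move=> [c [k [T [eps [e0 TO HP]]]]].
(* Only a saving of the form [1 / q] is kept, with [q] so large that [1 / q < eps]. *)
have [m qe] := ltr_add_invr e0; rewrite add0r in qe.
set q := m.+1 in qe.
move/eqO_exP: TO => [C C0 [N _ HN]].
have q0 : (q%:R : R) != 0 by rewrite pnatr_eq0.
pose K1 := Num.bound (C ^+ q).
(* [K0] takes care of the finitely many sizes up to [N], on which the asymptotic bound says
   nothing. *)
pose K0 := Num.bound (\sum_(i < N.+1) `|T i|).
exists c, k, q, (K1 + K0 ^ q)%N; split=> // x.
have [s [t [E tT ans]]] := HP x; exists s, t; split => //.
set n := size _ in tT *; rewrite mulnDl.
have [nN|Nn] := leqP n N.
  apply: leq_trans (leq_addl _ _).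
  rewrite -[leqLHS]muln1 leq_mul ?expn_gt0 ?addn2 //.
  apply: leq_exp2r_homo; rewrite -(ler_nat R); apply: (le_trans tT).
  apply: le_trans (ltW (archi_boundP _)); last by apply: sumr_ge0.
  rewrite (bigD1 (Ordinal (nN : (n < N.+1)%N))) //=.
  by apply: le_trans (ler_norm _) _; rewrite lerDl sumr_ge0.
apply: leq_trans (leq_addr _ _); rewrite -(ler_nat R) natrX.
have n1 : 1 <= n%:R :> R by rewrite ler1n; lia.
have tC : t%:R <= C * n%:R `^ (3 - q%:R^-1).
  apply: (le_trans tT); apply: (le_trans (ler_norm _)).
  apply: le_trans (HN n (ltnW Nn)) _.
  rewrite ler_pM2l // ger0_norm ?powR_ge0 // ler_powR // lerD2l lerN2.
  exact: ltW.
apply: (@le_trans _ _ ((C * n%:R `^ (3 - q%:R^-1)) ^+ q)).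
  by rewrite lerXn2r ?nnegrE // mulr_ge0 ?powR_ge0 // ltW.
rewrite exprMn natrM ler_pM //.
- by rewrite exprn_ge0 // ltW.
- by apply/ltW/archi_boundP; rewrite exprn_ge0 // ltW.
rewrite -powR_mulrn ?powR_ge0 // -powRrM mulrBl mulVf //.
rewrite (_ : 3 * q%:R - 1 = (3 * q - 1)%:R); last first.
  by rewrite natrB ?natrM //; lia.
rewrite powR_mulrn // natrX lerXn2r ?nnegrE // ler_nat; lia.
Qed.

Lemma truly_of_subcubic P : subcubic P -> truly_subcubic R P.
Proof.
move=> [c [k [q [K [q0 HP]]]]].
have qn0 : (q%:R : R) != 0 by rewrite pnatr_eq0 -lt0n.
pose T n : R := (K * (n + 2) ^ (3 * q - 1))%:R `^ q%:R^-1.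
exists c, k, T, q%:R^-1; split.
- by rewrite invr_gt0 ltr0n.
- apply/eqO_exP; pose C : R := (K * 2 ^ (3 * q - 1))%:R `^ q%:R^-1.
  have C0 : 0 <= C by apply: powR_ge0.
  exists (C + 1); first by rewrite ltr_wpDl.
  exists 2%N => // n /= n2; rewrite !ger0_norm ?powR_ge0 //.
  apply: (@le_trans _ _ (C * n%:R `^ (3 - q%:R^-1))); last first.
    by rewrite ler_wpM2r ?powR_ge0 // lerDl.
  have -> : n%:R `^ (3 - q%:R^-1) = (n ^ (3 * q - 1))%:R `^ q%:R^-1 :> R.
    rewrite natrX -powR_mulrn // -powRrM natrB ?natrM; last by lia.
    by rewrite mulrBl mul1r mulfK.
  rewrite /C /T -powRM // -natrM; apply: ge0_ler_powR; rewrite ?nnegrE ?invr_ge0 //.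
  rewrite ler_nat.
  by rewrite -mulnA -expnMn leq_mul2l leq_exp2r_homo ?orbT //; lia.
- move=> x; have [s [t [E tT ans]]] := HP x; exists s, t; split => //.
  have -> : t%:R = (t ^ q)%:R `^ q%:R^-1 :> R.
    by rewrite natrX -powR_mulrn // -powRrM mulfV // powRr1.
  by apply: ge0_ler_powR; rewrite ?nnegrE ?invr_ge0 // ler_nat.
Qed.

End TrulySubcubic.

(** * Parentheses, bit strings and program fragments *)

Definition opn (b : bool) : paren := if b then SquareO else RoundO.
Definition cls (b : bool) : paren := if b then SquareC else RoundC.

(** The reversal puts the head of [l] on top of the stack, so that [pops l] undoes [pushes l]. *)
Definition pushes (l : seq bool) : seq paren := map opn (rev l).
Definition pops (l : seq bool) : seq paren := map cls l.

(* [false] and [true] stand for an open round or square parenthesis. *)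
Fixpoint drun (u : seq paren) (st : seq bool) : option (seq bool) :=
  match u with
  | [::] => Some st
  | RoundO :: u => drun u (false :: st)
  | SquareO :: u => drun u (true :: st)
  | RoundC :: u => if st is false :: st' then drun u st' else None
  | SquareC :: u => if st is true :: st' then drun u st' else None
  end.

Lemma drun_cat u v st : drun (u ++ v) st = obind (drun v) (drun u st).
Proof. by elim: u st => //= -[] u IH [|[] st] //=. Qed.

Lemma drun_pushes l st : drun (pushes l) st = Some (l ++ st).
Proof.
rewrite /pushes; elim: l st => //= b l IH st.
by rewrite rev_cons map_rcons -cats1 drun_cat IH; case: b.
Qed.

Lemma drun_pops l st : drun (pops l) (l ++ st) = Some st.
Proof. by elim: l => //= -[] l IH. Qed.

Lemma drun_popsP l st st' : drun (pops l) st = Some st' -> st = l ++ st'.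
Proof. by elim: l st => [|[] l IH] //= => [st [->]|[|[] st]|[|[] st]] // /IH ->. Qed.

Lemma dyck2_drun u st : dyck2 u -> drun u st = Some st.
Proof.
move=> D; elim: D st => // [u1 v _ H1 _ H2|u1 _ H1|u1 _ H1] st.
- by rewrite drun_cat H1 /= H2.
- by rewrite /= -cats1 drun_cat H1.
- by rewrite /= -cats1 drun_cat H1.
Qed.

(** The induction on [u] needs words that close a given stack: the folded predicate says that [u]
    consists of Dyck words separated by the parentheses closing [st] from its top down. For the
    empty stack this is [dyck2 u]. *)
Lemma drun_dyck2_closes u st : drun u st = Some [::] ->
  foldr (fun b (P : seq paren -> Prop) w =>
           exists d v, [/\ w = d ++ cls b :: v, dyck2 d & P v]) dyck2 st u.
Proof.
set closes := foldr _ _.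
have prep d w st' : dyck2 d -> closes st' w -> closes st' (d ++ w).
  move=> Dd; case: st' => [|b st'] /=; first exact: dyck2_cat.
  move=> [d' [v [-> Dd' H]]]; exists (d ++ d'), v; split; rewrite ?catA //.
  exact: dyck2_cat.
have pop b d v st' : dyck2 d -> closes st' v -> closes st' (opn b :: d ++ cls b :: v).
  move=> Dd H; rewrite -cat_rcons -cat_cons; apply: prep H.
  by case: b; [apply: dyck2_square | apply: dyck2_round].
elim: u st => [|[] u IH] st /=.
- by move=> [->]; apply: dyck2_nil.
- by move=> /IH /= [d [v [-> Dd H]]]; apply: (pop false).
- by case: st => [|[] st] // /IH H; exists [::], u; split => //; apply: dyck2_nil.
- by move=> /IH /= [d [v [-> Dd H]]]; apply: (pop true).
- by case: st => [|[] st] // /IH H; exists [::], u; split => //; apply: dyck2_nil.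
Qed.

Lemma dyck2P u : dyck2 u <-> drun u [::] = Some [::].
Proof. by split=> [/dyck2_drun|/drun_dyck2_closes]; last by []. Qed.

Arguments bits : simpl never.

Lemma size_bits w n : size (bits w n) = w.
Proof. by rewrite size_mkseq. Qed.

Lemma nth_bits w n i : i < w -> nth false (bits w n) i = odd (n %/ 2 ^ i).
Proof. by move=> iw; rewrite nth_mkseq. Qed.

Lemma bits_rcons w n : bits w.+1 n = rcons (bits w n) (odd (n %/ 2 ^ w)).
Proof. by rewrite /bits mkseqS. Qed.

Lemma bitsS w n : bits w.+1 n = odd n :: bits w (n %/ 2).
Proof.
rewrite /bits /mkseq /= divn1; congr cons.
rewrite -[1]add1n iotaDl -map_comp; apply: eq_map => i /=.
by rewrite expnD expn1 divnMA.
Qed.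

Lemma bits_inj w : {in gtn (2 ^ w) &, injective (bits w)}.
Proof.
elim: w => [|w IH] x y; rewrite !inE.
  by rewrite expn0 !ltnS !leqn0 => /eqP -> /eqP ->.
rewrite expnS => xw yw; rewrite !bitsS => -[oxy] /IH exy.
have {exy} : x %/ 2 = y %/ 2 by apply: exy; rewrite !inE ltn_divLR // mulnC.
by rewrite !divn2 => h; rewrite -[x]odd_double_half -[y]odd_double_half oxy h.
Qed.

Section Macros.
Variables (inp : seq bool) (N M B : nat).
Notation wp := (wp inp N M B).
Notation eval := (eval inp).

Lemma wp_mono p Q Q' s : (forall s, Q s -> Q' s) -> wp p Q s -> wp p Q' s.
Proof.
elim: p Q Q' s => [|x e|l|p1 H1 p2 H2|e p1 H1 p2 H2|b e p IH] Q Q' s QQ' //=.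
- exact: QQ'.
- by case=> ? /QQ'.
- exact: QQ'.
- by apply: H1 => s'; apply: H2.
- by case: ifP => _; [apply: H1 | apply: H2].
- case=> le H; split=> //; move: (eval s e) H; clear le => n; elim: n s => [|n IHn] s /=.
    exact: QQ'.
  by apply: IH => s'; apply: IHn.
Qed.

Lemma wp_seq p1 p2 (I Q : lstate -> Prop) s :
  wp p1 I s -> (forall s, I s -> wp p2 Q s) -> wp (Seq p1 p2) Q s.
Proof. by move=> H1 H2; apply: wp_mono H1. Qed.

Lemma wp_for b e p Q s (I : nat -> lstate -> Prop) :
  eval s e <= (if b then N else M) -> I 0 s ->
  (forall i s', i < eval s e -> I i s' -> wp p (I i.+1) s') ->
  (forall s', I (eval s e) s' -> Q s') -> wp (For b e p) Q s.
Proof.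
move=> le I0 IS IQ; split=> //; move: (eval s e) IS IQ {le} => n IS IQ.
have: forall k i s, i + k = n -> I i s -> iter k (wp p) Q s; last first.
  by move/(_ n 0 s (add0n n)); apply.
elim=> [|k IH] i s' ik Ii; first by apply: IQ; rewrite -ik addn0.
apply: (@wp_mono _ (I i.+1)); last by apply: IS => //; lia.
by move=> s2; apply: IH; lia.
Qed.

Lemma envE l x v o y : env (LState (set_nth 0 l x v) o) y =
  if y == x then v else env (LState l o) y.
Proof. by rewrite /env /= nth_set_nth. Qed.

Definition emit_code f0 f1 (b : bool) : seq bool := if b then f1 else f0.

(* Least significant bit first; [x] is a scratch variable, [w] holds the
   width. *)
Definition emit_low (f0 f1 : seq bool) (x w : nat) (e : expr) : prog :=
  Seq (Set_ x e) (For false (Var w)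
    (Seq (If (Bin Mod (Var x) (Cst 2)) (Emit f1) (Emit f0))
         (Set_ x (Bin Div (Var x) (Cst 2))))).

Lemma set_nth_set_nth (T : Type) (d : T) l i u v :
  set_nth d (set_nth d l i u) i v = set_nth d l i v.
Proof. by rewrite set_set_nth eqxx. Qed.

Lemma wp_emit_low f0 f1 (x w : nat) e Q s :
  x != w -> eval s e < B -> env s w <= M ->
  (forall v, Q (LState (set_nth 0 (vars s) x v)
     (out s ++ flatten (map (emit_code f0 f1) (bits (env s w) (eval s e)))))) ->
  wp (emit_low f0 f1 x w e) Q s.
Proof.
move=> xw eB wM HQ; split=> //; set v := eval s e in HQ eB *.
apply: (@wp_for _ _ _ _ _ (fun i s' => s' = LState (set_nth 0 (vars s) x (v %/ 2 ^ i))
  (out s ++ flatten (map (emit_code f0 f1) (bits i v))))).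
- by rewrite /= env_set_var eq_sym (negPf xw).
- by rewrite /= divn1 cats0.
- move=> i s' _ ->; cbv beta; rewrite bits_rcons map_rcons flatten_rcons catA.
  rewrite expnSr divnMA /= /env /= !nth_set_nth /= eqxx modn2.
  have lt : v %/ 2 ^ i %/ 2 < B.
    by apply: leq_ltn_trans eB; apply: leq_trans (leq_div _ _) (leq_div _ _).
  by case: (odd _) => /=; split => //;
    rewrite /set_var /emit /= set_nth_set_nth.
- by move=> s' ->; rewrite /= env_set_var eq_sym (negPf xw).
Qed.

(** Most significant bit first, the order required by [pushes]: [pw] is raised to [2 ^ w], then
    halved before each bit is extracted by a division. *)
Definition emit_high (f0 f1 : seq bool) (x pw w : nat) (e : expr) : prog :=
  Seq (Set_ x e) (Seq (Set_ pw (Cst 1))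
  (Seq (For false (Var w) (Set_ pw (Bin Mul (Var pw) (Cst 2))))
  (For false (Var w) (Seq (Set_ pw (Bin Div (Var pw) (Cst 2)))
    (If (Bin Mod (Bin Div (Var x) (Var pw)) (Cst 2)) (Emit f1) (Emit f0)))))).

Lemma wp_emit_high f0 f1 (x pw w : nat) e Q s :
  x != w -> pw != w -> x != pw ->
  eval s e < B -> env s w <= M -> 2 ^ env s w < B ->
  Q (LState (set_nth 0 (set_nth 0 (vars s) x (eval s e)) pw 1)
     (out s ++ flatten (map (emit_code f0 f1)
        (rev (bits (env s w) (eval s e)))))) ->
  wp (emit_high f0 f1 x pw w e) Q s.
Proof.
move=> xw pww xpw eB wM pB HQ.
have wx : (w == x) = false by rewrite eq_sym (negPf xw).
have wp' : (w == pw) = false by rewrite eq_sym (negPf pww).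
have B1 : 1 < B by apply: leq_ltn_trans pB; rewrite expn_gt0.
split=> //; set v := eval s e in HQ eB *; split=> //.
have Ew u k o : env (LState (set_nth 0 (set_nth 0 (vars s) x u) pw k) o) w = env s w.
  by rewrite !envE wp' wx.
apply: (@wp_seq _ _ (fun s' => s' = LState
  (set_nth 0 (set_nth 0 (vars s) x v) pw (2 ^ env s w)) (out s))).
  apply: (@wp_for _ _ _ _ _ (fun i s' => s' = LState
    (set_nth 0 (set_nth 0 (vars s) x v) pw (2 ^ i)) (out s))) => //.
  - by rewrite /= Ew.
  - move=> i s' iw ->; rewrite /= /set_var /= !envE eqxx.
    rewrite set_nth_set_nth expnSr; split=> //; rewrite -expnSr.
    by apply: leq_ltn_trans pB; rewrite leq_exp2l //; move: iw; rewrite /= Ew.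
  - by move=> s' ->; rewrite /= Ew.
move=> s' -> {s'}; set W := env s w in HQ Ew wM pB *.
apply: (@wp_for _ _ _ _ _ (fun i s' => s' = LState
    (set_nth 0 (set_nth 0 (vars s) x v) pw (2 ^ (W - i)))
    (out s ++ flatten (map (emit_code f0 f1) (take i (rev (bits W v))))))).
- by rewrite /= Ew.
- by rewrite subn0 take0 cats0.
- move=> i s'; rewrite [eval _ _]/= Ew => iW ->; cbv beta.
  have -> : 2 ^ (W - i) = 2 ^ (W - i.+1) * 2 by rewrite -expnSr; congr (_ ^ _); lia.
  rewrite (take_nth false) ?size_rev ?size_bits // map_rcons flatten_rcons catA.
  rewrite nth_rev ?size_bits // nth_bits; last by lia.
  rewrite /= /set_var /= !envE !eqxx (negPf xpw) mulnK // modn2 set_nth_set_nth.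
  split; last by case: (odd _).
  by apply: leq_ltn_trans pB; rewrite leq_exp2l //; lia.
- move=> s' ->; rewrite /= Ew subnn take_oversize //.
  by rewrite size_rev size_bits.
Qed.

Definition at_ (p : nat) (l : seq bool) := prefix l (drop p inp).

Lemma at_cat p (l1 l2 : seq bool) : at_ p (l1 ++ l2) = at_ p l1 && at_ (p + size l1) l2.
Proof.
rewrite /at_ addnC -drop_drop; elim: l1 (drop p inp) => [|b l1 IH] [|c d] //=.
by rewrite IH andbA.
Qed.

Lemma at_size p (l : seq bool) : 0 < size l -> at_ p l -> p + size l <= size inp.
Proof.
move=> l0 /size_prefix; rewrite size_drop => h.
by have := leq_trans l0 h; rewrite subn_gt0 => /ltnW pn; rewrite -leq_subRL.
Qed.

Lemma at_nth p (l : seq bool) o i : at_ p l -> i < size l ->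
  nth false (inp ++ o) (p + i) = nth false l i.
Proof.
move=> apl il; have := at_size (leq_ltn_trans (leq0n i) il) apl => sz.
rewrite nth_cat ifT; last by lia.
case/prefixP: apl => r /(congr1 (fun l => nth false l i)).
by rewrite nth_drop nth_cat il.
Qed.

Lemma modn_exp2S v i : v %% 2 ^ i.+1 = v %% 2 ^ i + odd (v %/ 2 ^ i) * 2 ^ i.
Proof.
rewrite -modn2 {1}(divn_eq v (2 ^ i)) {1}(divn_eq (v %/ 2 ^ i) 2).
rewrite mulnDl -mulnA -expnS -addnA modnMDl modn_small; first by rewrite addnC.
have := ltn_pmod v (_ : 0 < 2 ^ i); rewrite expn_gt0 => /(_ isT).
have := ltn_pmod (v %/ 2 ^ i) (isT : 0 < 2); rewrite expnS.
by case: (_ %% 2) => [|[|]] //; lia.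
Qed.

(** A round of [read_num] reassigns [p], [x] and [pw] in the order in which they were first set, so
    the nested updates collapse and the loop invariant keeps its form. *)
Lemma set_nth3 l (p x pw : nat) (a b c a' b' c' : nat) :
  x != pw -> x != p -> pw != p ->
  set_nth 0 (set_nth 0 (set_nth 0 (set_nth 0 (set_nth 0 (set_nth 0 l p a) x b)
    pw c) p a') x b') pw c' = set_nth 0 (set_nth 0 (set_nth 0 l p a') x b') pw c'.
Proof.
move=> /negPf xpw /negPf xp /negPf pwp.
rewrite [set_nth 0 _ p a'](set_set_nth 0) pwp.
rewrite [set_nth 0 _ p a'](set_set_nth 0) xp set_nth_set_nth.
rewrite [set_nth 0 _ x b'](set_set_nth 0) eq_sym xpw !set_nth_set_nth.
by [].
Qed.

(* Sets [p] to [e], reads [w] bits there into [x] and moves [p] past them. *)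
Definition read_num (x p w pw : nat) (e : expr) : prog :=
  Seq (Set_ p e) (Seq (Set_ x (Cst 0)) (Seq (Set_ pw (Cst 1)) (For false (Var w)
    (Seq (Set_ p (Bin Add (Var p) (Cst 1)))
    (Seq (Set_ x (Bin Add (Var x)
       (Bin Mul (Rd (Bin Sub (Var p) (Cst 1))) (Var pw))))
    (Set_ pw (Bin Mul (Var pw) (Cst 2)))))))).

Lemma wp_read_num (x p w pw : nat) e v Q s :
  x != w -> pw != w -> p != w -> x != pw -> x != p -> p != pw ->
  env s w <= M -> 2 ^ env s w < B -> eval s e + env s w < B ->
  at_ (eval s e) (bits (env s w) v) -> v < 2 ^ env s w ->
  Q (LState (set_nth 0 (set_nth 0 (set_nth 0 (vars s) p (eval s e + env s w))
      x v) pw (2 ^ env s w)) (out s)) ->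
  wp (read_num x p w pw e) Q s.
Proof.
move=> xw pww pw' xpw xp ppw wM pB eB Hat vW HQ.
have B1 : 1 < B by apply: leq_ltn_trans pB; rewrite expn_gt0.
have sym (i j : nat) (ij : i != j) : ((i == j) = false) * ((j == i) = false).
  by rewrite [j == i]eq_sym (negPf ij).
have NE := (sym _ _ xw, sym _ _ pww, sym _ _ pw', sym _ _ xpw, sym _ _ xp, sym _ _ ppw).
set W := env s w in wM pB eB Hat vW HQ *.
set P := eval s e in eB Hat HQ *.
have Ew a b c o : env (LState (set_nth 0 (set_nth 0 (set_nth 0 (vars s) p a) x b)
   pw c) o) w = W.
  by rewrite !envE !NE.
split; first by rewrite -/P; lia.
split; first by rewrite /=; lia.
split=> //; rewrite -/P.
apply: (@wp_for _ _ _ _ _ (fun i s' => s' = LState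
  (set_nth 0 (set_nth 0 (set_nth 0 (vars s) p (P + i)) x (v %% 2 ^ i)) pw (2 ^ i))
  (out s))).
- by rewrite /= Ew.
- by rewrite addn0 modn1.
- move=> i s'; rewrite [eval _ _]/= Ew => iW ->; cbv beta.
  have lt1 : v %% 2 ^ i.+1 < B.
    apply: leq_ltn_trans (leq_mod _ _) _; exact: ltn_trans pB.
  have lt2 : 2 ^ i.+1 < B by apply: leq_ltn_trans pB; rewrite leq_exp2l.
  rewrite /= /set_var /= !envE !(NE, eqxx).
  have bt : nth false (inp ++ out s) (P + i + 1 - 1) = odd (v %/ 2 ^ i).
    by rewrite addnK (at_nth _ Hat) ?size_bits // nth_bits.
  rewrite bt -modn_exp2S -expnSr addn1 -addnS set_nth3 // 1?eq_sym //.
  by split; first lia.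
- by move=> s'; rewrite [eval _ _]/= Ew => ->; rewrite modn_small.
Qed.

(** A loop count is fixed on entry, so the search for the first 0 runs for [n] rounds and idles once
    it is found. *)
Definition scan_ones (p n : nat) (e : expr) : prog :=
  Seq (Set_ p e) (For true (Var n)
    (If (Rd (Var p)) (Set_ p (Bin Add (Var p) (Cst 1))) Skip)).

Lemma wp_scan_ones (p n : nat) e k Q s :
  p != n -> k <= env s n -> env s n <= N -> eval s e + k < B ->
  at_ (eval s e) (unary k) ->
  Q (LState (set_nth 0 (vars s) p (eval s e + k)) (out s)) ->
  wp (scan_ones p n e) Q s.
Proof.
move=> pn kn nN eB Hat HQ; set P := eval s e in eB Hat HQ *.
have Ep a o : env (LState (set_nth 0 (vars s) p a) o) n = env s n.
  by rewrite envE eq_sym (negPf pn).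
split; first by rewrite -/P; lia.
apply: (@wp_for _ _ _ _ _ (fun i s' => s' = LState
  (set_nth 0 (vars s) p (P + minn i k)) (out s))).
- by rewrite /= Ep.
- by rewrite min0n addn0.
- move=> i s' _ ->; rewrite /= /set_var !envE !eqxx /= set_nth_set_nth.
  rewrite (at_nth _ Hat) /unary ?size_rcons ?size_nseq ?ltnS ?geq_minr //.
  rewrite nth_rcons size_nseq nth_nseq; have [ik|ki] := ltnP i k.
    by rewrite /= (minn_idPl ik) ik addn1 -addnS; split => //; lia.
  by rewrite ltnn eqxx /= (minn_idPr (leqW ki)).
- by move=> s'; rewrite [eval _ _]/= Ep => ->; rewrite (minn_idPr kn).
Qed.

Definition compute_up_log (x pw y : nat) : prog :=
  Seq (Set_ x (Cst 0)) (Seq (Set_ pw (Cst 1)) (For true (Var y)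
    (If (Bin Lt (Var pw) (Var y))
      (Seq (Set_ x (Bin Add (Var x) (Cst 1))) (Set_ pw (Bin Mul (Var pw) (Cst 2))))
      Skip))).

Lemma up_log_gt n i : (2 ^ i < n) = (i < up_log 2 n).
Proof.
rewrite !ltnNge; congr negb; apply/idP/idP=> h; first exact: up_log_min.
by apply: leq_trans (up_logP n (isT : 1 < 2)) _; rewrite leq_exp2l.
Qed.

Lemma up_log_le n : up_log 2 n <= n.
Proof. by apply: up_log_min => //; rewrite ltnW // ltn_expl. Qed.

Lemma wp_compute_up_log (x pw y : nat) Q s :
  x != pw -> x != y -> pw != y ->
  env s y <= N -> 2 * env s y < B -> 1 < B ->
  Q (LState (set_nth 0 (set_nth 0 (vars s) x (up_log 2 (env s y)))
       pw (2 ^ up_log 2 (env s y))) (out s)) ->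
  wp (compute_up_log x pw y) Q s.
Proof.
move=> xpw xy pwy yN yB B1 HQ; set V := env s y in yN yB HQ *.
have yx : (y == x) = false by rewrite eq_sym (negPf xy).
have ypw : (y == pw) = false by rewrite eq_sym (negPf pwy).
have Ey a b o : env (LState (set_nth 0 (set_nth 0 (vars s) x a) pw b) o) y = V.
  by rewrite !envE yx ypw.
split; first by rewrite /=; lia.
split=> //.
apply: (@wp_for _ _ _ _ _ (fun i s' => s' = LState
  (set_nth 0 (set_nth 0 (vars s) x (minn i (up_log 2 V))) pw
     (2 ^ minn i (up_log 2 V))) (out s))).
- by rewrite /= Ey.
- by rewrite min0n.
- move=> i s' _ ->; rewrite /= Ey /set_var /= !envE !eqxx (negPf xpw) up_log_gt.
  have [iu|ui] := ltnP i (up_log 2 V); last first.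
    by rewrite ltnn /= (minn_idPr (leqW ui)).
  rewrite iu (minn_idPl iu) /= [pw == x]eq_sym (negPf xpw) addn1 -expnSr.
  have : 2 ^ i < V by rewrite up_log_gt.
  move=> iV; split; first by have := up_log_le V; lia.
  split; first by rewrite expnS; lia.
  congr LState; rewrite [set_nth 0 _ x i.+1](set_set_nth 0) eq_sym (negPf xpw).
  by rewrite !set_nth_set_nth.
- move=> s'; rewrite [eval _ _]/= Ey => ->.
  by rewrite (minn_idPr (up_log_le V)).
Qed.

Definition emit_unary (e : expr) : prog :=
  Seq (For true e (Emit [:: true])) (Emit [:: false]).

Lemma wp_emit_unary e Q s : eval s e <= N ->
  Q (LState (vars s) (out s ++ unary (eval s e))) -> wp (emit_unary e) Q s.
Proof.
move=> eN HQ; apply: (@wp_seq _ _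
  (fun s' => s' = LState (vars s) (out s ++ nseq (eval s e) true))).
  apply: (@wp_for _ _ _ _ _ (fun i s' =>
    s' = LState (vars s) (out s ++ nseq i true))) => //.
  - by rewrite cats0; case: (s).
  - move=> i s' _ ->; rewrite /= /emit /= -catA; congr (LState _ (_ ++ _)).
    by rewrite -[[:: true]]/(nseq 1 true) -nseqD addn1.
by move=> s' ->; rewrite /= /emit /= -catA cats1.
Qed.

End Macros.

(** * From Dyck-2 reachability to PDA emptiness *)

Lemma clos_rt_invariant (T : Type) (r : T -> T -> Prop) (P : T -> Prop) x y :
  (forall a b, P a -> r a b -> P b) -> clos_refl_trans _ r x y -> P x -> P y.
Proof.
move=> Pr; elim=> [a b rab Pa|//|a b c _ H1 _ H2 Pa]; first exact: Pr rab.
exact: H2 (H1 Pa).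
Qed.

Lemma code_elt_ord n (i : 'I_n) : code_elt i = bits (up_log 2 n) i.
Proof. by rewrite /code_elt enum_rank_ord /= card_ord. Qed.

Section DyckToPDA.
Variable G : dyck_graph.
Let V := vertex G.

Definition bottom : 'I_3 := inord 0.
Definition sym (b : bool) : 'I_3 := inord (if b then 2 else 1).

Lemma sym_neq_bottom b : (sym b == bottom) = false.
Proof. by rewrite -val_eqE /= !inordK //; case: b. Qed.

Lemma sym_inj : injective sym.
Proof. by move=> a b /(congr1 val); rewrite /= !inordK; case: a; case: b. Qed.

(** A transition always removes the top symbol, so a push is one transition for each possible top
    [Z], which is put back. All of them read the left end marker, letter 0, and do not move. *)
Definition edge_trans (e : V * V) :
    seq (V * 'I_2 * 'I_3 * V * seq 'I_3 * int) :=
  let push b := [seq (e.1, inord 0, inord Z, e.2, [:: sym b; inord Z], 0%R)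
                | Z <- [:: 0; 1; 2]] in
  let pop b := [:: (e.1, inord 0, sym b, e.2, [::], 0%R)] in
  match label e with
  | RoundO => push false | RoundC => pop false
  | SquareO => push true | SquareC => pop true
  end.

(** The end markers are the only letters, so the empty word is the only candidate. The last
    transition goes from one marker to the other, at the target and with an empty stack. *)
Definition graph_delta : seq (V * 'I_2 * 'I_3 * V * seq 'I_3 * int) :=
  rcons (flatten [seq edge_trans e | e <- edges G])
    (target G, inord 0, bottom, target G, [:: bottom], 1%R).

Lemma edge_transP e tr : tr \in edge_trans e ->
  exists b, (label e = opn b /\ exists2 Z, Z < 3 &
      tr = (e.1, inord 0, inord Z, e.2, [:: sym b; inord Z], 0%R)) \/
    (label e = cls b /\ tr = (e.1, inord 0, sym b, e.2, [::], 0%R)).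
Proof.
rewrite /edge_trans; case: (label e).
- case/mapP => Z; rewrite !inE => Z3 ->; exists false; left; split=> //.
  by exists Z => //; move: Z3; do 2 (case: eqP => [->|_] //); move/eqP->.
- by rewrite inE => /eqP ->; exists false; right.
- case/mapP => Z; rewrite !inE => Z3 ->; exists true; left; split=> //.
  by exists Z => //; move: Z3; do 2 (case: eqP => [->|_] //); move/eqP->.
- by rewrite inE => /eqP ->; exists true; right.
Qed.

Lemma graph_delta_move q1 a Z q2 g d : (q1, a, Z, q2, g, d) \in graph_delta ->
  d \in [:: -1; 0; 1]%R.
Proof.
rewrite mem_rcons in_cons => /orP[/eqP[_ _ _ _ _ ->] //|].
by case/flatten_mapP => e _ /edge_transP[b [[_ [Z' _ []]]|[_ []]]] *; subst d.
Qed.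

Lemma graph_delta_stackend q1 a Z q2 g d :
  (q1, a, Z, q2, g, d) \in graph_delta ->
  if Z == bottom then exists2 g', g = rcons g' bottom & bottom \notin g'
  else bottom \notin g.
Proof.
rewrite mem_rcons in_cons => /orP[/eqP[_ _ -> _ -> _]|].
  by rewrite eqxx; exists [::].
case/flatten_mapP => e _ /edge_transP[b [[_ [Z' Z3 []]]|[_ []]]].
  move=> _ _ -> _ -> _; case: eqP => [->|/eqP ZN].
    by exists [:: sym b] => //; rewrite inE eq_sym sym_neq_bottom.
  by rewrite !inE eq_sym sym_neq_bottom eq_sym (negPf ZN).
by move=> _ _ -> _ -> _; rewrite sym_neq_bottom.
Qed.

Lemma lend_neq_rend2 : (inord 0 : 'I_2) != inord 1.
Proof. by rewrite -val_eqE /= !inordK. Qed.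

Definition graph_pda : npda :=
  @NPDA V 'I_2 'I_3 graph_delta (source G) [set target G] (inord 0) (inord 1)
    bottom lend_neq_rend2 graph_delta_move graph_delta_stackend.

Lemma graph_pda_is_pda : is_pda graph_pda.
Proof.
apply/allP => /= tr; rewrite mem_rcons in_cons => /orP[/eqP->//|].
by case/flatten_mapP => e _ /edge_transP[b [[_ [Z' _ ->]]|[_ ->]]].
Qed.

Definition stack_of (st : seq bool) : seq 'I_3 := rcons (map sym st) bottom.

Let lab (u v : V) := label (u, v).
Let adj (u v : V) := (u, v) \in edges G.

Lemma sym_val b : val (sym b) = if b then 2 else 1.
Proof. by rewrite /= inordK //; case: b. Qed.

Lemma stack_ofE st : exists Z g, stack_of st = inord Z :: g /\ Z < 3.
Proof.
case: st => [|b st]; first by exists 0, [::].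
by exists (val (sym b)), (stack_of st); rewrite inord_val sym_val; case: b.
Qed.

Lemma edge_run u v st st' : adj u v -> drun [:: lab u v] st = Some st' ->
  @Defs.step graph_pda [:: inord 0; inord 1] (u, 0, stack_of st) (v, 0, stack_of st').
Proof.
move=> uv; have sub tr : tr \in edge_trans (u, v) -> tr \in graph_delta.
  move=> h; rewrite mem_rcons in_cons; apply/orP; right.
  by apply/flatten_mapP; exists (u, v).
have [Z [g [eS Z3]]] := stack_ofE st.
have push b : label (u, v) = opn b ->
    @Defs.step graph_pda [:: inord 0; inord 1] (u, 0, stack_of st)
      (v, 0, stack_of (b :: st)).
  move=> lb; have -> : stack_of (b :: st) = sym b :: inord Z :: g by rewrite -eS.
  rewrite eS.
  apply: (@Defs.Step graph_pda _ _ _ _ [:: sym b; inord Z] 0%R) => //.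
  apply: sub; rewrite /edge_trans lb.
  by case: b {lb} => /=; rewrite !inE; case: Z Z3 {eS} => [|[|[|]]] // _;
    rewrite eqxx ?orbT.
have pop b st0 : label (u, v) = cls b -> st = b :: st0 ->
    @Defs.step graph_pda [:: inord 0; inord 1] (u, 0, stack_of st)
      (v, 0, stack_of st0).
  move=> lb ->; apply: (@Defs.Step graph_pda _ _ _ _ [::] 0%R) => //.
  by apply: sub; rewrite /edge_trans lb; case: b {lb} => /=; rewrite inE.
rewrite /= /lab; case El: (label (u, v)).
- by move=> [<-]; apply: (push false).
- by case: st push pop eS => [|[] st] // _ pop _ [<-]; apply: (pop false).
- by move=> [<-]; apply: (push true).
- by case: st push pop eS => [|[] st] // _ pop _ [<-]; apply: (pop true).
Qed.

Lemma graph_run u p st st' : path adj u p ->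
  drun (pairmap lab u p) st = Some st' ->
  clos_refl_trans _ (@Defs.step graph_pda [:: inord 0; inord 1])
    (u, 0, stack_of st) (last u p, 0, stack_of st').
Proof.
elim: p u st => [|v p IH] u st; first by move=> _ [<-]; apply: rt_refl.
case/andP => uv pp; rewrite [pairmap _ _ _]/= -cat1s drun_cat.
case E: (drun [:: lab u v] st) => [st1|//] H.
apply: rt_trans (IH _ _ pp H); apply: rt_step; exact: edge_run.
Qed.

(** The head position is left out: only the transition at the target moves the head, and it changes
    neither state nor stack. *)
Definition reached (c : config graph_pda) := exists st p,
  [/\ c.2 = stack_of st, path adj (source G) p, last (source G) p = c.1.1
    & drun (pairmap lab (source G) p) [::] = Some st].

Lemma reached_step tape c c' : reached c -> Defs.step tape c c' -> reached c'.
Proof.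
move=> [st [p [Ec Hp Hl Hd]]] S.
case: S Ec Hl => q1 Z q2 g' d g i j _ _ _ tr /= Ec Hl.
move: tr; rewrite mem_rcons in_cons => /orP[/eqP[eq1 _ eZ -> -> _]|].
  by exists st, p; split; rewrite //= -?eZ // Hl.
case/flatten_mapP => -[u v] uv /edge_transP[b]; rewrite /= => h.
have {h} [eq1 eq2 [st' [Hd' ->]]] : [/\ q1 = u, q2 = v &
    exists st', drun [:: lab u v] st = Some st' /\ g' ++ g = stack_of st'].
  case: h => [[lb [Z' Z3 [-> _ eZ -> -> _]]]|[lb [-> _ eZ -> -> _]]]; split => //.
    exists (b :: st); rewrite /lab lb; split; first by case: (b).
    by rewrite /stack_of /= -/(stack_of st) -Ec eZ.
  case: st Ec Hd => [|b' st] /=.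
    by case=> e; move: (sym_neq_bottom b); rewrite -eZ e eqxx.
  case=> e1 e2 Hd; have eb : b = b' by apply: sym_inj; rewrite -eZ.
  by exists st; rewrite /lab lb e2; split=> //; rewrite eb; case: (b').
exists st', (rcons p v); split=> //.
- by rewrite rcons_path Hp Hl eq1.
- by rewrite last_rcons.
- by rewrite -cats1 pairmap_cat drun_cat Hd /= Hl eq1.
Qed.

Lemma graph_pdaP : dyck_reachable G <-> language graph_pda <> classical_sets.set0.
Proof.
split.
  move=> [p [Hp Hl /dyck2P Hd]] /(congr1 (fun L => L [::])) /= E.
  suff [] : False by [].
  rewrite -E; split=> //; exists (target G); first by rewrite inE.
  apply: rt_trans; first exact: graph_run Hp Hd.
  apply: rt_step; rewrite Hl.
  apply: (@Defs.Step graph_pda _ _ bottom _ [:: bottom] 1%R) => //.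
  by rewrite mem_rcons inE eqxx.
move=> /eqP/classical_sets.set0P[w [_ [q qf H]]].
have [st [p [/= Est Hp Hl Hd]]] : reached (q, (size w).+1, [:: bottom]).
  apply: clos_rt_invariant H _; first exact: reached_step.
  by exists [::], [::].
exists p; split=> //.
  by move: qf; rewrite /= inE Hl => /eqP.
apply/dyck2P; rewrite Hd; case: st Est {Hd} => // b st [].
by case: st.
Qed.

End DyckToPDA.

(** * Program fragments for encoded lists *)

Section MoreMacros.
Variables (inp : seq bool) (N M B : nat).
Notation wp := (wp inp N M B).
Notation eval := (eval inp).

Lemma wp_seqI p1 p2 Q s : wp p1 (wp p2 Q) s -> wp (Seq p1 p2) Q s.
Proof. by []. Qed.

Lemma wp_set x e Q s : eval s e < B ->
  Q (LState (set_nth 0 (vars s) x (eval s e)) (out s)) -> wp (Set_ x e) Q s.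
Proof. by []. Qed.

Lemma wp_emit l Q s : Q (LState (vars s) (out s ++ l)) -> wp (Emit l) Q s.
Proof. by []. Qed.

Lemma wp_if e p1 p2 Q s : (eval s e <> 0 -> wp p1 Q s) ->
  (eval s e = 0 -> wp p2 Q s) -> wp (If e p1 p2) Q s.
Proof. by move=> H1 H2 /=; case: eqP. Qed.

Definition list_pos (T : Type) (f : T -> seq bool) p l :=
  p + size (flatten [seq true :: f x | x <- l]).

Definition list_loop (p n : nat) (body : prog) : prog :=
  For true (Var n) (If (Rd (Var p)) body Skip).

(* The items of an encoded list are parsed one by one; once the closing bit 0 is
   reached the remaining iterations are idle. *)
Lemma wp_list_loop (T : Type) (f : T -> seq bool) (l : seq T) p n p0 body
    (J : seq T -> lstate -> Prop) Q s :
  env s n = size inp -> env s n <= N ->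
  at_ inp p0 (code_list f l) -> J [::] s ->
  (forall l1 s, J l1 s -> env s p = list_pos f p0 l1) ->
  (forall l1 x l2 s, l = l1 ++ x :: l2 -> J l1 s ->
     at_ inp (list_pos f p0 l1) (true :: f x) -> wp body (J (rcons l1 x)) s) ->
  (forall s, J l s -> Q s) ->
  wp (list_loop p n body) Q s.
Proof.
move=> sn nN Hat J0 Jp Jbody JQ.
have szl : size l <= size inp.
  have := at_size _ Hat; rewrite /code_list size_rcons => /(_ isT) h.
  apply: leq_trans h; apply: leq_trans (leq_addl _ _); apply: leqW.
  elim: (l) => //= x l' IH; rewrite ltnS size_cat.
  by apply: leq_trans IH _; apply: leq_addl.
apply: (@wp_for _ _ _ _ _ _ _ _ _ (fun i s => J (take i l) s)) => //.
- by rewrite take0.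
- move=> i s' _ Ji; have [il|li] := ltnP i (size l); last first.
    rewrite take_oversize // in Ji; rewrite take_oversize; last exact: leqW.
    move: Hat; rewrite /code_list -cats1 at_cat => /andP[_ h].
    have r0 := at_nth (out s') h (isT : 0 < 1); rewrite addn0 in r0.
    by apply: wp_if => //=; rewrite (Jp _ _ Ji) r0.
  have x : T by case: (l) il => [|x] //.
  have el : l = take i l ++ nth x l i :: drop i.+1 l.
    by rewrite -drop_nth // cat_take_drop.
  have h : at_ inp (list_pos f p0 (take i l)) (true :: f (nth x l i)).
    move: Hat; rewrite {1}el /code_list map_cat flatten_cat rcons_cat at_cat.
    by move=> /andP[_ /=]; rewrite rcons_cat -cat_cons at_cat => /andP[].
  have := at_nth (out s') h (ltn0Sn _); rewrite addn0 => r1.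
  apply: wp_if => /=; rewrite (Jp _ _ Ji) r1 // => _.
  by rewrite (take_nth x) //; apply: (Jbody _ _ (drop i.+1 l)).
- by rewrite /= sn => s'; rewrite take_oversize //; apply: JQ.
Qed.

Definition emit_bits := emit_low [:: false] [:: true].

Lemma flatten_code01 l : flatten (map (emit_code [:: false] [:: true]) l) = l.
Proof. by elim: l => //= -[] l ->. Qed.

Lemma wp_emit_bits x w e Q s :
  x != w -> eval s e < B -> env s w <= M ->
  (forall v, Q (LState (set_nth 0 (vars s) x v)
     (out s ++ bits (env s w) (eval s e)))) ->
  wp (emit_bits x w e) Q s.
Proof.
by move=> xw eB wM HQ; apply: wp_emit_low => // v; rewrite flatten_code01.
Qed.

(** The shape of an encoded transition: source state, then letter and top symbol, target state, then
    pushed word and move. Only the two states are computed at run time; the rest is literal. *)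
Definition emit_items (x w u v : nat) (items : seq (seq bool * seq bool)) : prog :=
  foldr (fun pp c => Seq (Emit [:: true]) (Seq (emit_bits x w (Var u))
    (Seq (Emit pp.1) (Seq (emit_bits x w (Var v)) (Seq (Emit pp.2) c)))))
  Skip items.

Definition items_code (a b : seq bool) (items : seq (seq bool * seq bool)) :=
  flatten [seq true :: a ++ pp.1 ++ b ++ pp.2 | pp <- items].

Lemma wp_emit_items (x w u v : nat) items Q s :
  x != w -> x != u -> x != v -> x < size (vars s) ->
  env s u < B -> env s v < B -> env s w <= M ->
  (forall k, Q (LState (set_nth 0 (vars s) x k)
     (out s ++ items_code (bits (env s w) (env s u)) (bits (env s w) (env s v))
        items))) ->
  wp (emit_items x w u v items) Q s.
Proof.
move=> xw xu xv; have sym (i : nat) (xi : x != i) : (i == x) = false.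
  by rewrite eq_sym (negPf xi).
elim: items s => [|[pre post] items IH] s xs uB vB wM HQ.
  (* No item, no assignment: the postcondition is instantiated with the current value of [x], and
     storing it again changes nothing because [x < size (vars s)]. *)
  change (Q s); have := HQ (nth 0 (vars s) x); rewrite /items_code /= cats0.
  rewrite (_ : set_nth _ _ _ _ = vars s); first by case: (s).
  apply: (@eq_from_nth _ 0) => [|i _].
    by rewrite size_set_nth; apply/maxn_idPr.
  by rewrite nth_set_nth /=; case: eqP => [->|].
rewrite [emit_items _ _ _ _ _]/=.
apply: wp_seqI; apply: wp_emit; apply: wp_seqI; apply: wp_emit_bits => // k1.
apply: wp_seqI; apply: wp_emit; apply: wp_seqI; apply: wp_emit_bits => [//|||k2].
- by rewrite /= envE sym.
- by rewrite /= envE sym.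
apply: wp_seqI; apply: wp_emit; apply: IH.
- by rewrite /= !size_set_nth; lia.
- by rewrite /= !envE sym.
- by rewrite /= !envE sym.
- by rewrite /= !envE sym.
move=> k; rewrite /= !envE !sym //.
have := HQ k; rewrite /= !set_nth_set_nth /items_code /= -!catA /=.
by rewrite -?catA.
Qed.

End MoreMacros.

(** * Writing the automaton of a graph *)

Definition succ x := Bin Add (Var x) (Cst 1).

(* [zify] is slowed down by the hypotheses on bit strings. *)
Ltac alia := repeat match goal with H : is_true (at_ _ _ _) |- _ => clear H end; lia.

Ltac simp_state :=
  cbn [vars out set_nth env nth eval op_sem op_of set_var emit ncons iter succ].

(** The prefix is the letter 0 on one bit and the top symbol on two; the suffix is the pushed word
    and the move 0, encoded as [0 + 1]. *)
Definition edge_items (l : paren) : seq (seq bool * seq bool) :=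
  let push k := [seq (false :: bits 2 Z, code_list (bits 2) [:: k; Z] ++ bits 2 1)
                | Z <- [:: 0; 1; 2]] in
  let pop k := [:: (false :: bits 2 k, code_list (bits 2) [::] ++ bits 2 1)] in
  match l with
  | RoundO => push 1 | RoundC => pop 1
  | SquareO => push 2 | SquareC => pop 2
  end.

Definition last_item : seq (seq bool * seq bool) :=
  [:: (false :: bits 2 0, code_list (bits 2) [:: 0] ++ bits 2 2)].

Section GraphCode.
Variable G : dyck_graph.
Let V := vertex G.
Let code (v : V) := bits (up_log 2 #|V|) (enum_rank v).

Definition edge_code (e : V * V) := items_code (code e.1) (code e.2) (edge_items (label e)).

Lemma inord_code n (Z : nat) : Z <= n -> code_elt (inord Z : 'I_n.+1) = bits (up_log 2 n.+1) Z.
Proof. by move=> Zn; rewrite code_elt_ord inordK. Qed.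

Definition one_hot (n i : nat) := [seq k == i | k <- iota 0 n].

Lemma one_hot_final (t : V) :
  [seq q \in [set t] | q <- enum V] = one_hot #|V| (enum_rank t).
Proof.
have sV : size (enum V) = #|V| by rewrite cardE.
rewrite /one_hot; apply: (@eq_from_nth _ false) => [|i].
  by rewrite size_map sV size_map size_iota.
rewrite size_map sV => iV.
rewrite (nth_map t) ?sV // (nth_map 0) ?size_iota // nth_iota // inE.
have -> : nth t (enum V) i = enum_val (Ordinal iV : 'I_#|V|) by rewrite (enum_val_nth t).
by rewrite -(inj_eq enum_rank_inj) enum_valK.
Qed.

Definition trans_code (A : npda)
    (tr : state A * letter A * stacksym A * state A * seq (stacksym A) * int) :=
  let: (q1, a, Z, q2, g, d) := tr in
  code_elt q1 ++ code_elt a ++ code_elt Z ++ code_elt q2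
    ++ code_list (@code_elt (stacksym A)) g ++ bits 2 (absz (d + 1)%R).

Lemma up_log22 : up_log 2 2 = 1. Proof. by []. Qed.
Lemma up_log23 : up_log 2 3 = 2. Proof. by []. Qed.

Lemma sym_code b : code_elt (sym b) = bits 2 (if b then 2 else 1).
Proof. by rewrite inord_code; case: b. Qed.

Lemma edge_trans_code e :
  flatten [seq true :: @trans_code (graph_pda G) tr | tr <- edge_trans e] = edge_code e.
Proof.
have c0 : code_elt (inord 0 : 'I_2) = [:: false] by rewrite inord_code.
have cZ Z : Z <= 2 -> code_elt (inord Z : 'I_3) = bits 2 Z by move=> ?; rewrite inord_code.
rewrite /edge_code /edge_items /edge_trans; case: (label e);
  rewrite /items_code /trans_code /code_list; cbn [map];
  cbn -[bits code_elt inord] ;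
  rewrite ?c0 ?sym_code ?cZ //.
Qed.

Lemma graph_pda_code : code_npda (graph_pda G) =
  unary #|V| ++ unary 2 ++ unary 3 ++ code (source G) ++
  one_hot #|V| (enum_rank (target G)) ++ [:: false; true; false; false] ++
  flatten [seq edge_code e | e <- edges G] ++
  items_code (code (target G)) (code (target G)) last_item ++ [:: false].
Proof.
rewrite /code_npda /= !card_ord -one_hot_final !inord_code //.
do 4 congr (_ ++ _); congr (_ ++ _); rewrite up_log22 up_log23.
(* The four literal bits are the two end markers on one bit each and the bottom symbol on two. *)
rewrite -[RHS]/(bits 1 0 ++ bits 1 1 ++ bits 2 0 ++ _); do 3 congr (_ ++ _).
change (code_list (@trans_code (graph_pda G)) (graph_delta G) =
  flatten [seq edge_code e | e <- edges G] ++
  items_code (code (target G)) (code (target G)) last_item ++ [:: false]).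
rewrite /code_list /graph_delta map_rcons flatten_rcons -cats1 -!catA; congr (_ ++ _).
  elim: (edges G) => //= e es IH.
  by rewrite map_cat flatten_cat IH edge_trans_code.
congr (_ ++ _); rewrite /last_item /items_code /trans_code; cbn [map].
by cbn -[bits code_elt inord]; rewrite inord_code // inord_code // cats0 /= -?catA.
Qed.
End GraphCode.

Definition one_hot_loop (i n t : nat) : prog :=
  Seq (Set_ i (Cst 0)) (For true (Var n)
    (Seq (If (Bin Eq (Var i) (Var t)) (Emit [:: true]) (Emit [:: false]))
         (Set_ i (succ i)))).

Lemma one_hotS n i : one_hot n.+1 i = one_hot n i ++ [:: n == i].
Proof. by rewrite /one_hot -addn1 iotaD map_cat. Qed.

Lemma wp_one_hot_loop inp N M B (i n t : nat) Q s : i != n -> i != t ->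
  0 < B -> env s n < B -> env s n <= N ->
  Q (LState (set_nth 0 (vars s) i (env s n)) (out s ++ one_hot (env s n) (env s t))) ->
  wp inp N M B (one_hot_loop i n t) Q s.
Proof.
move=> ni ti B0 nB nN HQ.
have En a o : env (LState (set_nth 0 (vars s) i a) o) n = env s n.
  by rewrite envE eq_sym (negPf ni).
have Et a o : env (LState (set_nth 0 (vars s) i a) o) t = env s t.
  by rewrite envE eq_sym (negPf ti).
apply: wp_seqI; apply: wp_set; first by [].
apply: (@wp_for _ _ _ _ _ _ _ _ _ (fun k s' => s' =
   LState (set_nth 0 (vars s) i k) (out s ++ one_hot k (env s t)))).
- by rewrite /= En.
- by rewrite cats0.
- move=> k s'; rewrite [eval _ _ _]/= En => kn ->.
  rewrite one_hotS catA; apply: wp_seqI.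
  have eE o : eval inp (LState (set_nth 0 (vars s) i k) o)
    (Bin Eq (Var i) (Var t)) = (k == env s t).
    by rewrite /= Et envE eqxx.
  have Q2 o : wp inp N M B (Set_ i (succ i))
      (eq^~ (LState (set_nth 0 (vars s) i k.+1) o)) (LState (set_nth 0 (vars s) i k) o).
    apply: wp_set; rewrite [eval _ _ _]/= envE eqxx addn1; first by lia.
    by rewrite /= set_nth_set_nth.
  by apply: wp_if; rewrite eE; case: (k == env s t) => // _; apply: wp_emit; apply: Q2.
- by rewrite [eval _ _ _]/= En => s' ->.
Qed.

(* Variables: 0 the size of the input, 1 the reading position, 2 the number of
   vertices, 3 the width of their codes, 5 the source, 6 the target, 7 and 8 the
   ends of the current edge; the others are scratch. *)
Definition dyck_body : prog :=
  Seq (read_num 7 1 3 4 (succ 1)) (Seq (read_num 8 1 3 4 (Var 1))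
  (Seq (If (Rd (Var 1))
     (If (Rd (succ 1)) (emit_items 9 3 7 8 (edge_items SquareC))
                       (emit_items 9 3 7 8 (edge_items SquareO)))
     (If (Rd (succ 1)) (emit_items 9 3 7 8 (edge_items RoundC))
                       (emit_items 9 3 7 8 (edge_items RoundO))))
  (Set_ 1 (Bin Add (Var 1) (Cst 2))))).

Definition dyck_prog : prog :=
  Seq (scan_ones 1 0 (Cst 0)) (Seq (Set_ 2 (Var 1)) (Seq (compute_up_log 3 4 2)
  (Seq (read_num 5 1 3 4 (succ 1)) (Seq (read_num 6 1 3 4 (Var 1))
  (Seq (emit_unary (Var 2)) (Seq (Emit (unary 2 ++ unary 3))
  (Seq (emit_bits 9 3 (Var 5)) (Seq (one_hot_loop 10 2 6)
  (Seq (Emit [:: false; true; false; false])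
  (Seq (list_loop 1 0 dyck_body)
  (Seq (emit_items 9 3 6 6 last_item) (Emit [:: false])))))))))))).

Lemma at_full inp : at_ inp 0 inp.
Proof. by rewrite /at_ drop0; apply: prefix_refl. Qed.

Lemma exp2_up_log n : 2 ^ up_log 2 n <= 2 * n + 1.
Proof.
case: n => [//|[//|n]]; have /andP[+ _] := up_log_bounds (isT : 1 < 2) (isT : 1 < n.+2).
have : 0 < up_log 2 n.+2 by rewrite up_log_gt0.
by case: (up_log _ _) => // l _ /=; rewrite expnS; lia.
Qed.

Lemma enum_rank_lt (T : finType) (x : T) : enum_rank x < 2 ^ up_log 2 #|T|.
Proof. by apply: leq_trans (up_logP _ _); rewrite ?ltn_ord. Qed.

Lemma list_pos_rcons (T : Type) (f : T -> seq bool) p l x :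
  list_pos f p (rcons l x) = list_pos f p l + (size (f x)).+1.
Proof. by rewrite /list_pos map_rcons flatten_rcons size_cat /= addnA. Qed.

Lemma dyck_prog_spec (G : dyck_graph) N M B : let n := size (code_graph G) in
  n + 2 <= N -> lg n <= M -> 8 * (n + 2) <= B ->
  wp (code_graph G) N M B dyck_prog (fun s => out s = code_npda (graph_pda G))
    (init (code_graph G)).
Proof.
set inp := code_graph G; move=> n nN nM nB.
set V := #|vertex G|; set w := up_log 2 V.
pose f (e : vertex G * vertex G) := code_elt e.1 ++ code_elt e.2 ++ code_paren (label e).
have Hat : at_ inp 0 (unary V ++ bits w (enum_rank (source G)) ++
    bits w (enum_rank (target G)) ++ code_list f (edges G)) := at_full inp.
rewrite !at_cat !size_bits in Hat; case/and4P: Hat => at1 at2 at3 at4.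
have sV : size (unary V) = V.+1 by rewrite /unary size_rcons size_nseq.
have Vn : V < n by have := at_size _ at1; rewrite sV; apply.
rewrite add0n sV in at2 at3 at4.
have pn : V.+1 + w + w < n.
  have := at_size _ at4; rewrite /code_list size_rcons => /(_ isT).
  by apply: leq_trans; rewrite addnS ltnS leq_addr.
have wM : w <= M by apply: leq_trans nM; apply: leq_up_log; alia.
have w2 : 2 ^ w < B by have := exp2_up_log V; rewrite -/w; alia.
have rs2 : enum_rank (source G) < 2 ^ w := enum_rank_lt _.
have rt2 : enum_rank (target G) < 2 ^ w := enum_rank_lt _.
rewrite graph_pda_code -/V -/w /init.
set rs := nat_of_ord (enum_rank (source G)) in at2 rs2 *.
set rt := nat_of_ord (enum_rank (target G)) in at3 rt2 *.
have ltB x : x < 2 ^ w -> x < B by move=> h; apply: ltn_trans h w2.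
apply: wp_seqI; apply: (@wp_scan_ones _ _ _ _ _ _ _ V) => //; simp_state; try by rewrite -/n; alia.
apply: wp_seqI; apply: wp_set; simp_state; first by alia.
apply: wp_seqI; apply: wp_compute_up_log => //; simp_state; try alia.
rewrite -/w add0n.
apply: wp_seqI; apply: (@wp_read_num _ _ _ _ _ _ _ _ _ rs) => //; simp_state; rewrite ?addn1 //; try alia.
apply: wp_seqI; apply: (@wp_read_num _ _ _ _ _ _ _ _ _ rt) => //; simp_state => //; try alia.
apply: wp_seqI; apply: wp_emit_unary; simp_state; first alia.
apply: wp_seqI; apply: wp_emit; simp_state.
apply: wp_seqI; apply: wp_emit_bits => //; simp_state; [exact: ltB | move=> k1].
apply: wp_seqI; apply: wp_one_hot_loop => //; simp_state; try alia.
apply: wp_seqI; apply: wp_emit; simp_state.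
pose hdr := unary V ++ unary 2 ++ unary 3 ++ bits w rs ++ one_hot V rt ++
  [:: false; true; false; false].
rewrite -![in X in LState _ X]catA.
apply: wp_seqI; apply: (@wp_list_loop _ _ _ _ _ f (edges G) _ _ (V.+1 + w + w) _
  (fun l1 s => exists u v k, s = LState [:: n; list_pos f (V.+1 + w + w) l1; V; w;
     2 ^ w; rs; rt; u; v; k; V] (hdr ++ flatten [seq edge_code e | e <- l1]))) => //.
- by simp_state; rewrite -/n; alia.
- by exists 0, 0, k1; rewrite /list_pos addn0 cats0.
- by move=> l1 s [u [v [k ->]]].
- move=> l1 e l2 s el [u [v [k ->]]] ate.
  have fE : f e = code_elt e.1 ++ code_elt e.2 ++ code_paren (label e) by [].
  have sp : size (code_paren (label e)) = 2 by case: (label e).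
  rewrite list_pos_rcons; move: ate; rewrite -cat1s at_cat fE !at_cat !size_bits -/V -/w.
  rewrite addn1 => /and4P[_ a1 a2 a3].
  have := at_size _ a3; rewrite sp => /(_ isT); rewrite -/n !size_cat !size_bits sp -/V -/w.
  set P := list_pos _ _ _ in a1 a2 a3 * => Pn.
  pose ru := nat_of_ord (enum_rank e.1); pose rv := nat_of_ord (enum_rank e.2).
  have ru2 : ru < 2 ^ w := enum_rank_lt _.
  have rv2 : rv < 2 ^ w := enum_rank_lt _.
  apply: wp_seqI; apply: (@wp_read_num _ _ _ _ _ _ _ _ _ ru) => //; simp_state;
    rewrite ?addn1 //; try alia.
  apply: wp_seqI; apply: (@wp_read_num _ _ _ _ _ _ _ _ _ rv) => //; simp_state => //;
    try alia.
  have a3' o i : i < 2 -> nth false (inp ++ o) (P.+1 + w + w + i) = nth false (code_paren (label e)) i.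
    by move=> i2; apply: at_nth a3 _; rewrite sp.
  have := a3' (hdr ++ flatten [seq edge_code e | e <- l1]) 0 isT; rewrite addn0 => r0.
  have := a3' (hdr ++ flatten [seq edge_code e | e <- l1]) 1 isT => r1.
  apply: wp_seqI.
  have Hitems : wp inp N M B (emit_items 9 3 7 8 (edge_items (label e)))
     (fun s => exists k, s = LState [:: n; P.+1 + w + w; V; w; 2 ^ w; rs; rt; ru; rv; k; V]
        (hdr ++ flatten [seq edge_code e | e <- rcons l1 e]))
     (LState [:: n; P.+1 + w + w; V; w; 2 ^ w; rs; rt; ru; rv; k; V]
        (hdr ++ flatten [seq edge_code e | e <- l1])).
    apply: wp_emit_items => //; simp_state; try exact: ltB.
    by move=> k'; exists k'; rewrite map_rcons flatten_rcons catA.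
  apply: (@wp_mono _ _ _ _ _ (fun s => exists k, s = LState [:: n; P.+1 + w + w; V; w; 2 ^ w; rs; rt; ru; rv; k; V]
        (hdr ++ flatten [seq edge_code e | e <- rcons l1 e]))).
    move=> s' [k' ->]; apply: wp_set; simp_state; first alia.
    exists ru, rv, k'; congr (LState [:: _, _ & _] _); alia.
  apply: wp_if; simp_state; rewrite r0 => z0; apply: wp_if; simp_state; rewrite r1 => z1;
    by move: z0 z1 Hitems; case: (label e).
move=> s [u [v [k ->]]].
apply: wp_seqI; apply: wp_emit_items => //; simp_state; try exact: ltB.
by move=> k'; apply: wp_emit; simp_state; rewrite /hdr -!catA.
Qed.

Lemma linear_le_poly c a n : c < a -> c * (n + 2) <= (n + 2) ^ a.
Proof.
move=> ca; apply: (@leq_trans ((n + 2) ^ c.+1)); last by apply: leq_pexp2l_homo => //; lia.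
rewrite expnSr leq_mul2r; apply/orP; right; apply: self_le_exp; lia.
Qed.

Lemma size_flatten_map_le (T : Type) c (g h : T -> seq bool) l :
  (forall x, size (g x) <= c * size (h x)) ->
  size (flatten (map g l)) <= c * size (flatten (map h l)).
Proof.
by move=> gh; elim: l => //= x l IH; rewrite !size_cat mulnDr leq_add.
Qed.

Lemma size_items_code a b items : size (items_code a b items) =
  \sum_(pp <- items) (size a + size b + size pp.1 + size pp.2).+1.
Proof.
elim: items => [|pp items IH]; first by rewrite big_nil.
by rewrite big_cons -IH /items_code /= !size_cat; lia.
Qed.

Lemma graph_pda_size (G : dyck_graph) :
  size (code_npda (graph_pda G)) <= 40 * (size (code_graph G) + 2).
Proof.
rewrite graph_pda_code /code_graph /code_list.
set it := items_code _ _ last_item.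
have sit := size_items_code _ _ _ : size it = _; clearbody it.
rewrite !size_cat size_rcons sit.
pose f (e : vertex G * vertex G) :=
  true :: code_elt e.1 ++ code_elt e.2 ++ code_paren (label e).
(* The worst case is a push: three transitions of [2 * w + 13] bits against [2 * w + 3] bits for the
   edge, and [3 * 13] is [13 * 3]. *)
have := @size_flatten_map_le _ 13 (@edge_code G) f (edges G).
rewrite /unary !size_rcons !size_nseq !size_bits /one_hot size_map size_iota.
rewrite big_seq1 ?size_bits.
set V := #|_|; set w := up_log _ _.
set F := size (flatten (map f _)).
move=> H; have {H} : size (flatten [seq edge_code i | i <- edges G]) <= 13 * F.
  apply: H => e; rewrite /edge_code size_items_code /f /= !size_cat !size_bits -/w.
  by case: (label e); rewrite /= ?big_cons big_nil /=; lia.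
by rewrite /=; lia.
Qed.

Lemma dyck_reduces_pda : reduces true dyck2_reachability pda_emptiness.
Proof.
exists (fun G => exist _ (graph_pda G) (graph_pda_is_pda G) : instance pda_emptiness).
exists dyck_prog, 40; split=> // G n; split.
- apply: dyck_prog_spec; first by rewrite leq_pmull.
    by rewrite leq_pmull.
  exact: linear_le_poly.
- apply: leq_trans (graph_pda_size G) _; rewrite leq_mul2l /=.
  by rewrite leq_pmulr // lg_gt0.
- exact: graph_pdaP.
Qed.

(** * From 2NPDA recognition to Dyck-2 reachability *)

Definition paren_code (p : paren) : nat :=
  match p with RoundO => 0 | RoundC => 1 | SquareO => 2 | SquareC => 3 end.
Definition paren_decode (n : nat) : paren :=
  match n with 0 => RoundO | 1 => RoundC | 2 => SquareO | _ => SquareC end.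
Lemma paren_codeK : cancel paren_code paren_decode. Proof. by case. Qed.
HB.instance Definition _ := Equality.copy paren (can_type paren_codeK).

(** * Subdivision of edges labelled by words *)

Inductive walk (E : seq (nat * nat * paren)) : nat -> seq paren -> nat -> Prop :=
  | walk_nil x : walk E x [::] x
  | walk_cons x y z c l : (x, y, c) \in E -> walk E y l z -> walk E x (c :: l) z.

Inductive word_walk (E : seq (nat * seq paren * nat)) :
    nat -> seq paren -> nat -> Prop :=
  | word_walk_nil x : word_walk E x [::] x
  | word_walk_cons x y z w l :
      (x, w, y) \in E -> word_walk E y l z -> word_walk E x (w ++ l) z.

Lemma word_walk_cat E x y z l1 l2 :
  word_walk E x l1 y -> word_walk E y l2 z -> word_walk E x (l1 ++ l2) z.
Proof.
elim=> //= x' y' z' w l xy _ IH /IH; rewrite -catA; exact: word_walk_cons.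
Qed.

Lemma walk_sub E1 E2 x l y : {subset E1 <= E2} -> walk E1 x l y -> walk E2 x l y.
Proof.
move=> sub; elim=> [|x' y' z c l' xy _ IH]; first exact: walk_nil.
exact: walk_cons (sub _ xy) IH.
Qed.

Lemma walk_cat E x y z l1 l2 :
  walk E x l1 y -> walk E y l2 z -> walk E x (l1 ++ l2) z.
Proof. by elim=> //= x' y' z' w l xy _ IH /IH; exact: walk_cons. Qed.

Fixpoint chain (x : nat) (w : seq paren) (f v : nat) : seq (nat * nat * paren) :=
  if w is c :: w' then
    if w' is _ :: _ then (x, f, c) :: chain f w' f.+1 v else [:: (x, v, c)]
  else [::].

(* Subdivides word-labelled edges, taking new vertices from [f] on. *)
Fixpoint expand (f : nat) (E : seq (nat * seq paren * nat)) :=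
  if E is (u, w, v) :: E' then chain u w f v ++ expand (f + (size w).-1) E'
  else [::].

(* The rest of the word and the final vertex of the subdivided edge on which the
   new vertex [x] lies. *)
Fixpoint residue (f : nat) (E : seq (nat * seq paren * nat)) (x : nat) :=
  if E is (u, w, v) :: E' then
    if x < f + (size w).-1 then (drop (x - f).+1 w, v)
    else residue (f + (size w).-1) E' x
  else ([::], 0).

Definition fresh_end f (E : seq (nat * seq paren * nat)) :=
  f + sumn [seq (size e.1.2).-1 | e <- E].

Lemma chain_walk x w f v : w != [::] -> walk (chain x w f v) x w v.
Proof.
elim: w x f => [//|c [|c' w] IH] x f _.
  by apply: walk_cons (walk_nil _ _); rewrite inE.
apply: (@walk_cons _ _ f); first by rewrite inE eqxx.
by apply: walk_sub (IH f f.+1 isT) => e; rewrite inE orbC => ->.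
Qed.

Lemma chain_edge x w f v x' y' c : (x', y', c) \in chain x w f v ->
  exists2 j, j < size w & [/\ drop j w = c :: drop j.+1 w,
    x' = if j is j'.+1 then f + j' else x
    & y' = if j.+1 < size w then f + j else v].
Proof.
elim: w x f => [//|c0 [|c1 w] IH] x f.
  by rewrite inE => /eqP[-> -> ->]; exists 0.
rewrite inE => /orP[/eqP[-> -> ->]|]; first by exists 0 => //; rewrite addn0.
move/IH => [j jw [dj -> ->]]; exists j.+1 => //; split => //=.
  by case: j {jw dj} => [|j]; rewrite ?addn0 // addSnnS.
by rewrite [in RHS]ltnS; case: ifP => //; lia.
Qed.

Section Expand.
Variable Nb : nat.
Implicit Type E : seq (nat * seq paren * nat).

(** With at least two letters per word, subdivision puts a new vertex on every edge; parallel edges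
    with different labels then become distinct pairs of vertices, as [edges_uniq] demands. *)
Definition well_formed E := forall e, e \in E ->
  [/\ e.1.1 < Nb, e.2 < Nb & 1 < size e.1.2].

Lemma well_formed_cons e E : well_formed (e :: E) ->
  [/\ e.1.1 < Nb, e.2 < Nb, 1 < size e.1.2 & well_formed E].
Proof.
move=> H; have [h1 h2 h3] := H _ (mem_head _ _).
by split=> // e' e'E; apply: H; rewrite inE e'E orbT.
Qed.

Lemma word_walk_expand f E x l y : well_formed E ->
  word_walk E x l y -> walk (expand f E) x l y.
Proof.
move=> wf; elim=> [x'|x' y' z w l' xy _ IH]; first exact: walk_nil.
apply: walk_cat IH; elim: E f wf xy => //= -[[u w0] v] E IH f.
move=> /well_formed_cons[_ _ w2 wf]; rewrite inE => /orP[/eqP[-> -> ->]|h].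
  have w0n : w0 != [::] by case: (w0) w2.
  by apply: walk_sub (chain_walk u f v w0n) => e; rewrite mem_cat => ->.
by apply: walk_sub (IH (f + (size w0).-1) wf h) => e; rewrite mem_cat orbC => ->.
Qed.

(** What remains after an edge into [y]: nothing if the subdivided edge ends there, otherwise the
    residue of the new vertex [y]. *)
Definition continues f E y w v :=
  w = [::] /\ y = v \/ f <= y /\ residue f E y = (w, v).

Lemma expand_edge f E x y c : well_formed E -> Nb <= f ->
  (x, y, c) \in expand f E -> exists w v, [/\ continues f E y w v, v < Nb
    & x < Nb /\ (x, c :: w, v) \in E \/ f <= x /\ residue f E x = (c :: w, v)].
Proof.
elim: E f => //= -[[u w0] v0] E IH f /well_formed_cons/=[uN vN w2 wf] Nf.
rewrite mem_cat => /orP[/chain_edge[j jw [dj ex ey]]|h].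
  exists (drop j.+1 w0), v0; split => //.
    rewrite /continues ey /=; have [jw'|jw'] := ltnP j.+1 (size w0).
      by right; rewrite leq_addr ltn_add2l addKn ltn_predRL jw'.
    by left; rewrite drop_oversize.
  case: j jw dj ex ey => [|j] jw dj ex ey.
    by left; rewrite ex uN inE -dj drop0 eqxx.
  by right; rewrite ex /= leq_addr ltn_add2l addKn ltn_predRL jw dj.
have Nf' : Nb <= f + (size w0).-1 by rewrite (leq_trans Nf) // leq_addr.
have [w [v [Hc vN' Hx]]] := IH _ wf Nf' h; exists w, v; split=> //.
  case: Hc => [?|[fy ry]]; [by left | right].
  by rewrite /= ltnNge fy /=; split=> //; apply: leq_trans fy; apply: leq_addr.
case: Hx => [[xN xE]|[fx rx]]; [left | right].
  by rewrite inE xE orbT.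
by rewrite /= ltnNge fx /=; split=> //; apply: leq_trans fx; apply: leq_addr.
Qed.

(** The induction consumes a walk from its head, hence also meets walks that start on a new vertex.
    Such a vertex has only one way out, so the walk has to finish the subdivided edge before it can
    do anything else. *)
Lemma walk_expand f E x l y : well_formed E -> Nb <= f -> y < Nb ->
  walk (expand f E) x l y ->
  (x < Nb -> word_walk E x l y) /\
  (f <= x -> exists l', l = (residue f E x).1 ++ l' /\
     word_walk E (residue f E x).2 l' y).
Proof.
move=> wf Nf yN W; elim: W yN => [x'|x' y' z c l' xy _ IH] zN.
  by split; [move=> _; apply: word_walk_nil | lia].
have {IH} [IH1 IH2] := IH zN.
have [w [v [Hc vN Hx]]] := expand_edge wf Nf xy.
have {Hc IH1 IH2} [l2 el2 W2] : exists2 l2, l' = w ++ l2 & word_walk E v l2 z.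
  case: Hc => [[-> ey]|[fy ry]]; first by exists l' => //; rewrite -ey; apply: IH1; rewrite ey.
  by have [l2] := IH2 fy; rewrite ry => -[-> ?]; exists l2.
case: Hx => [[xN xE]|[fx rx]]; split.
- by move=> _; rewrite el2 -cat_cons; apply: word_walk_cons W2.
- lia.
- lia.
- by move=> _; exists l2; rewrite rx el2.
Qed.

Lemma fresh_end_cons f e E : fresh_end f (e :: E) = fresh_end (f + (size e.1.2).-1) E.
Proof. by rewrite /fresh_end /= addnA. Qed.

Lemma expand_bounds f E x y c : well_formed E -> Nb <= f ->
  (x, y, c) \in expand f E -> x < fresh_end f E /\ y < fresh_end f E.
Proof.
elim: E f => //= -[[u w0] v0] E IH f /well_formed_cons/=[uN vN w2 wf] Nf.
rewrite fresh_end_cons /= mem_cat => /orP[/chain_edge[j jw [_ -> ->]]|]; last first.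
  by apply: IH => //; lia.
rewrite /fresh_end; split; first by case: j jw => [|j]; lia.
by case: ifP; lia.
Qed.

Lemma chain_fresh u w f v e : u < f -> v < f -> 1 < size w -> e \in chain u w f v ->
  f <= e.1.1 < f + (size w).-1 \/ f <= e.1.2 < f + (size w).-1.
Proof.
move=> uf vf w2; case: e => [[x y] c] /= /chain_edge[[|j] jw [_ -> ->]].
  by right; rewrite addn0; case: ifP; lia.
by left; lia.
Qed.

Lemma expand_not_fresh f0 f E x y c : well_formed E -> Nb <= f0 <= f ->
  (x, y, c) \in expand f E -> ~~ (f0 <= x < f) && ~~ (f0 <= y < f).
Proof.
move=> wf Nf; elim: E f wf Nf => //= -[[u w0] v0] E IH f /well_formed_cons/=[uN vN w2 wf] Nf.
rewrite mem_cat => /orP[/chain_edge[j jw [_ -> ->]]|h].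
  by apply/andP; split; [case: j jw => [|j]; lia | case: ifP; lia].
have := IH (f + (size w0).-1) wf; move=> /(_ _ h); lia.
Qed.

Lemma chain_uniq u w f v : u < f -> v < f ->
  uniq [seq e.1 | e <- chain u w f v].
Proof.
elim: w u f => [//|c [//|c' w] IH] u f uf vf.
rewrite [chain _ _ _ _]/= -/(chain f (c' :: w) f.+1 v) map_cons cons_uniq IH ?andbT //; try lia.
apply/mapP => -[[[x y] c0] /chain_edge[j jw [_ -> _]]] /= [e _].
by case: j e {jw} => [|j]; lia.
Qed.

(** Every edge of a chain touches a new vertex of that chain ([chain_fresh]) and no edge of a later
    chain does ([expand_not_fresh]); within a chain the sources are distinct. *)
Lemma expand_uniq f E : well_formed E -> Nb <= f ->
  uniq [seq e.1 | e <- expand f E].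
Proof.
elim: E f => //= -[[u w0] v0] E IH f /well_formed_cons/=[uN vN w2 wf] Nf.
rewrite map_cat cat_uniq chain_uniq ?IH ?andbT //; try lia.
apply/hasPn => _ /mapP[[[x y] c] h -> /=].
apply/mapP => -[[[x' y'] c'] h' [ex ey]].
have := @chain_fresh u w0 f v0 _ _ _ w2 h'; rewrite /= -ex -ey.
have := @expand_not_fresh f (f + (size w0).-1) E x y c wf _ h.
by move=> H1 H2; have := H1 ltac:(lia); have := H2 ltac:(lia) ltac:(lia); lia.
Qed.

End Expand.

(** * Graphs from numbered edge lists *)

Section MakeGraph.
Variables (n : nat) (E : seq (nat * nat * paren)) (s t : nat).
Hypothesis E_uniq : uniq [seq e.1 | e <- E].
Hypothesis E_lt : forall x y c, (x, y, c) \in E -> x < n.+1 /\ y < n.+1.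
Hypothesis s_lt : s < n.+1.
Hypothesis t_lt : t < n.+1.

Definition ord_edge (e : nat * nat) : 'I_n.+1 * 'I_n.+1 := (inord e.1, inord e.2).

Definition ord_edges := [seq ord_edge e.1 | e <- E].

Lemma ord_edge_inj : {in [seq e.1 | e <- E] &, injective ord_edge}.
Proof.
move=> _ _ /mapP[[[x y] c] h ->] /mapP[[[x' y'] c'] h' ->] /= [/(congr1 val)/= e1 /(congr1 val)/= e2].
have [x1 y1] := E_lt h; have [x2 y2] := E_lt h'.
by move: e1 e2; rewrite !inordK // => -> ->.
Qed.

Lemma ord_edges_uniq : uniq ord_edges.
Proof.
by rewrite /ord_edges (map_comp ord_edge) map_inj_in_uniq //; exact: ord_edge_inj.
Qed.

Definition ord_label (e : 'I_n.+1 * 'I_n.+1) : paren :=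
  nth RoundO [seq e.2 | e <- E] (index e ord_edges).

Lemma ord_labelE x y c : (x, y, c) \in E -> ord_label (inord x, inord y) = c.
Proof.
move=> h; pose i := index (x, y, c) E.
have iE : i < size E by rewrite index_mem.
have ei : nth (x, y, c) E i = (x, y, c) by apply: nth_index.
rewrite /ord_label (_ : index _ _ = i).
  by rewrite (nth_map (x, y, c)) ?ei.
have -> : (inord x, inord y) = nth (inord x, inord y) ord_edges i.
  by rewrite (nth_map (x, y, c)) ?ei.
by rewrite index_uniq ?size_map // ord_edges_uniq.
Qed.

Definition make_graph : dyck_graph :=
  @DyckGraph 'I_n.+1 ord_edges ord_label (inord s) (inord t) ord_edges_uniq.

Lemma make_graphP : dyck_reachable make_graph <->
  exists2 l, walk E s l t & drun l [::] = Some [::].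
Proof.
pose adj (u v : 'I_n.+1) := (u, v) \in ord_edges.
pose lab (u v : 'I_n.+1) := ord_label (u, v).
split.
  move=> [p [Hp Hl /dyck2P Hd]]; exists (pairmap lab (inord s) p) => //.
  move: Hp Hl; rewrite /= -/adj => Hp Hl.
  have W : forall (u : 'I_n.+1), path adj u p -> walk E u (pairmap lab u p) (last u p).
    elim: (p) => [|v p' IH] u; first by move=> _; apply: walk_nil.
    case/andP => /mapP[[[x y] c] h [eu ev]] /IH W; apply: walk_cons W.
    have [x1 y1] := E_lt h.
    by rewrite /lab eu ev (ord_labelE h) !inordK.
  have := W _ Hp; rewrite Hl !inordK //.
move=> [l W Hd].
have H : forall x l y, walk E x l y -> exists p, [/\ path adj (inord x) p,
    last (inord x) p = inord y & pairmap lab (inord x) p = l].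
  move=> x l0 y; elim=> [x'|x' y' z c l' xy _ [p [H1 H2 H3]]]; first by exists [::].
  exists (inord y' :: p); split => //=; last by rewrite H3 /lab (ord_labelE xy).
  by rewrite H1 andbT; apply/mapP; exists (x', y', c).
have [p [H1 H2 H3]] := H _ _ _ W; exists p; split=> //.
by apply/dyck2P; rewrite -Hd -H3.
Qed.

Definition edge_bits w (e : nat * nat * paren) :=
  bits w e.1.1 ++ bits w e.1.2 ++ code_paren e.2.

Lemma make_graph_code : let w := up_log 2 n.+1 in code_graph make_graph =
  unary n.+1 ++ bits w s ++ bits w t ++ code_list (edge_bits w) E.
Proof.
move=> w; rewrite /code_graph /= card_ord !inord_code //.
do 3 congr (_ ++ _); rewrite /code_list -map_comp; congr (rcons (flatten _) _).
apply/eq_in_map => -[[x y] c] h /=; have [x1 y1] := E_lt h.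
by rewrite !inord_code // (ord_labelE h).
Qed.

End MakeGraph.

Section PrefixCode.
Variable T : finType.

(** A unary prefix code: the final [true] makes decoding unique, and every code has at least two
    bits, as [well_formed] requires of labels. Its length is harmless because the automaton is
    fixed. *)
Definition sym_word (Z : T) : seq bool := rcons (nseq (enum_rank Z).+1 false) true.
Definition stack_word (g : seq T) : seq bool := flatten [seq sym_word Z | Z <- g].

Lemma sym_word_inj Z Z' l l' : sym_word Z ++ l = sym_word Z' ++ l' -> Z = Z' /\ l = l'.
Proof.
rewrite /sym_word !cat_rcons => H.
have nseq_inj i j : nseq i false ++ true :: l = nseq j false ++ true :: l' -> i = j /\ l = l'.
  elim: i j => [|i IH] [|j] //=; first by case.
  by case=> /IH[-> ->].
by have [[/ord_inj/enum_rank_inj ->] ->] := nseq_inj _ _ H.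
Qed.

Lemma stack_word_pop Z g l : stack_word g = sym_word Z ++ l ->
  exists2 g', g = Z :: g' & l = stack_word g'.
Proof.
case: g => [|Z' g].
  by move/(congr1 size); rewrite size_cat size_rcons.
by move=> /sym_word_inj[-> <-]; exists g.
Qed.

Lemma stack_word_nil g : stack_word g = [::] -> g = [::].
Proof. by case: g => // Z g /(congr1 size); rewrite /= size_cat size_rcons. Qed.

Lemma stack_word_cat g1 g2 : stack_word (g1 ++ g2) = stack_word g1 ++ stack_word g2.
Proof. by rewrite /stack_word map_cat flatten_cat. Qed.

Definition replace_word (Z : T) (g : seq T) : seq paren :=
  pops (sym_word Z) ++ pushes (stack_word g).

Lemma drun_replace Z g st : drun (replace_word Z g) (sym_word Z ++ st) =
  Some (stack_word g ++ st).
Proof. by rewrite drun_cat drun_pops /= drun_pushes. Qed.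

Lemma drun_replaceP Z g st st' : drun (replace_word Z g) st = Some st' ->
  exists2 st0, st = sym_word Z ++ st0 & st' = stack_word g ++ st0.
Proof.
rewrite drun_cat; case E: (drun _ st) => [st1|] //=.
by rewrite drun_pushes => -[<-]; exists st1 => //; exact: drun_popsP E.
Qed.

End PrefixCode.

(** * The configuration graph of a 2NPDA on a word *)

Section AutomatonGraph.
Variable A : npda.
Notation S := #|state A|.
Notation rank := enum_rank.

Definition config_vertex (q : state A) (i : nat) : nat := i * S + rank q.

Lemma config_vertex_inj q i q' i' :
  config_vertex q i = config_vertex q' i' -> q = q' /\ i = i'.
Proof.
rewrite /config_vertex => H.
have hq : rank q < S := ltn_ord _; have hq' : rank q' < S := ltn_ord _.
have S0 : 0 < S by apply: leq_ltn_trans hq.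
have ei : i = i'.
  have := congr1 (fun x => x %/ S) H; rewrite !divnMDl //.
  by rewrite !divn_small // !addn0.
split=> //; apply: enum_rank_inj; apply: ord_inj; apply/eqP.
by move/eqP: H; rewrite ei eqn_add2l.
Qed.

Lemma config_vertex_lt q i m : i < m -> config_vertex q i < m * S.
Proof.
rewrite /config_vertex => im; have hq : rank q < S := ltn_ord _.
apply: (@leq_trans (i.+1 * S)); last by rewrite leq_mul2r im orbT.
by rewrite mulSn addnC ltn_add2r.
Qed.

Local Notation trans := (state A * letter A * stacksym A * state A * seq (stacksym A) * int)%type.

(** The truncated predecessor at [i = 0] never occurs in an edge, because [can_move] then forbids
    the left move. *)
Definition moved (d : int) (i : nat) : nat :=
  if d == 1%R then i.+1 else if d == 0%R then i else i.-1.

Definition can_move (d : int) (i m1 : nat) : bool :=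
  if d == 1%R then i < m1 else if d == 0%R then true else 0 < i.

Definition trans_edge (i : nat) (tr : trans) : nat * seq paren * nat :=
  let: (q1, a, Z, q2, g, d) := tr in
  (config_vertex q1 i, replace_word Z g, config_vertex q2 (moved d i)).

Definition enabled (i m1 : nat) (a : letter A) (tr : trans) : bool :=
  (tr.1.1.1.1.2 == a) && can_move tr.2 i m1.

Definition tape (w : seq (letter A)) := lend A :: rcons w (rend A).

Definition position_edges (w : seq (letter A)) (i : nat) :=
  [seq trans_edge i tr | tr <- delta A &
     enabled i (size w).+1 (nth (lend A) (tape w) i) tr].

(** Two vertices beyond the configurations: the end-of-stack symbol is pushed on leaving the first
    and popped on entering the second, so that the walk starts and ends with an empty Dyck stack. *)
Definition start_vertex (w : seq (letter A)) := (size w).+2 * S.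
Definition goal_vertex (w : seq (letter A)) := ((size w).+2 * S).+1.

Definition final_edges (w : seq (letter A)) :=
  [seq (config_vertex q (size w).+1, pops (sym_word (stackend A)), goal_vertex w)
  | q <- enum (final A)].

Definition automaton_edges (w : seq (letter A)) :=
  (start_vertex w, pushes (sym_word (stackend A)), nat_of_ord (rank (start A))) ::
  final_edges w ++
  flatten [seq position_edges w i | i <- iota 0 (size w).+2].

Lemma moved_eq (d : int) i j : d \in [:: -1; 0; 1]%R -> (j%:Z = i%:Z + d)%R ->
  j = moved d i /\ forall m, j <= m -> can_move d i m.
Proof.
rewrite !inE /moved /can_move => /or3P[] /eqP -> /=; split; rewrite -?[(_ == _)]/false; try lia.
all: move=> m; rewrite /=; lia.
Qed.

Lemma moved_step (d : int) i m : d \in [:: -1; 0; 1]%R -> can_move d i m -> i <= m ->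
  ((moved d i)%:Z = i%:Z + d)%R /\ moved d i <= m.
Proof.
rewrite !inE /moved /can_move => /or3P[] /eqP -> /=; lia.
Qed.

Lemma automaton_edges_wf w : well_formed ((size w).+2 * S).+2 (automaton_edges w).
Proof.
have lt q i : i < (size w).+2 -> config_vertex q i < ((size w).+2 * S).+2.
  by move=> h; have := config_vertex_lt q h; lia.
move=> e; rewrite inE mem_cat => /or3P[/eqP->|/mapP[q _ ->]|].
- rewrite /= /start_vertex /pushes size_map size_rev size_rcons; split => //.
  by have := lt (start A) 0 isT; rewrite /config_vertex mul0n.
- by rewrite /= /goal_vertex /pops size_map size_rcons; split=> //; apply: lt.
case/flatten_mapP => i; rewrite mem_iota add0n => /= im /mapP[[[[[[q1 a] Z] q2] g] d]].
rewrite mem_filter => /andP[/andP[_ /= cm] tr] ->; split=> /=.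
- exact: lt.
- apply: lt; have [//|_] := moved_step (delta_move tr) cm _; lia.
- by rewrite /replace_word size_cat /pops size_map size_rcons.
Qed.

Lemma size_tape (w : seq (letter A)) : size (tape w) = (size w).+2.
Proof. by rewrite /= size_rcons. Qed.

Lemma steps_walk w (c c' : config A) :
  clos_refl_trans _ (Defs.step (tape w)) c c' ->
  exists2 l, word_walk (automaton_edges w) (config_vertex c.1.1 c.1.2) l
                (config_vertex c'.1.1 c'.1.2)
    & drun l (stack_word c.2) = Some (stack_word c'.2).
Proof.
elim=> [_ _ [q1 Z q2 g' d g i j it jt ij tr]|x|x y z _ [l1 W1 D1] _ [l2 W2 D2]].
- rewrite size_tape in it jt; exists (replace_word Z g' ++ [::]).
    have cm : can_move d i (size w).+1.
      by have [_] := moved_eq (delta_move tr) ij; apply; rewrite -ltnS.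
    have [-> _] := moved_eq (delta_move tr) ij.
    apply: word_walk_cons (word_walk_nil _ _).
    rewrite inE mem_cat; apply/or3P; apply: Or33; apply/flatten_mapP.
    exists i; first by rewrite mem_iota.
    apply/mapP; exists (q1, nth (lend A) (tape w) i, Z, q2, g', d) => //.
    by rewrite mem_filter tr andbT /enabled /= eqxx.
  by rewrite cats0 drun_replace stack_word_cat.
- by exists [::] => //; apply: word_walk_nil.
- by exists (l1 ++ l2); [apply: word_walk_cat W1 W2 | rewrite drun_cat D1].
Qed.

(** At the goal the end-of-stack symbol is already popped, so the invariant records the
    configuration before the pop; an empty Dyck stack there means that this symbol was all the
    stack. *)
Definition visited w (x : nat) (st : seq bool) : Prop :=
  let steps := clos_refl_trans _ (Defs.step (tape w)) (start A, 0, [:: stackend A]) in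
  [\/ x = start_vertex w /\ st = [::],
      exists q i g, [/\ x = config_vertex q i, i < (size w).+2, st = stack_word g
        & steps (q, i, g)]
    | x = goal_vertex w /\ exists2 q, q \in final A &
        exists2 g, st = stack_word g & steps (q, (size w).+1, stackend A :: g)].

Lemma visited_step w x u y st st' : (x, u, y) \in automaton_edges w ->
  drun u st = Some st' -> visited w x st -> visited w y st'.
Proof.
have big q i : i < (size w).+2 -> config_vertex q i < start_vertex w.
  exact: config_vertex_lt.
have sg : start_vertex w < goal_vertex w by [].
rewrite inE mem_cat => /or3P[/eqP[-> -> ->]|/mapP[q qf [-> -> ->]]|].
- rewrite drun_pushes => -[<-] [[_ ->]|[q [i [g [ex im _ _]]]]|[ex _]].
  + apply: Or32; exists (start A), 0, [:: stackend A]; split => //.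
    exact: rt_refl.
  + by have := big q i im; rewrite -ex ltnn.
  + by move: sg; rewrite -ex ltnn.
- move=> Hd [[ex _]|[q' [i [g [ex im es Hs]]]]|[ex _]].
  + by have := big q _ (ltnSn (size w).+1); rewrite ex ltnn.
  + have [eq ei] := config_vertex_inj ex; apply: Or33; split=> //; rewrite mem_enum in qf; exists q => //.
    have := @drun_popsP (sym_word (stackend A)) _ _ Hd; rewrite es => /stack_word_pop[g' eg es'].
    by exists g' => //; rewrite -eg eq ei.
  + by have := big q _ (ltnSn (size w).+1); rewrite ex; lia.
case/flatten_mapP => i; rewrite mem_iota add0n => /= im /mapP[[[[[[q1 a] Z] q2] g'] d]].
rewrite mem_filter => /andP[/andP[/= /eqP ea cm] tr] [-> -> ->].
move=> /drun_replaceP[st0 es ->] [[ex _]|[q' [i' [g [ex im' es' Hs]]]]|[ex _]].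
- by have := big q1 _ im; rewrite ex ltnn.
- have [eq ei] := config_vertex_inj ex.
  have [g0 eg est0] : exists2 g0, g = Z :: g0 & st0 = stack_word g0.
    by apply: stack_word_pop; rewrite -es'.
  have im1 : i <= (size w).+1 by rewrite -ltnS.
  have [em mm] := moved_step (delta_move tr) cm im1.
  apply: Or32; exists q2, (moved d i), (g' ++ g0); split=> //.
    by rewrite stack_word_cat est0.
  apply: rt_trans Hs _; apply: rt_step; rewrite eg -eq -ei.
  by apply: (@Defs.Step A _ _ _ _ _ d) => //; rewrite ?size_tape // -ea.
- by have := big q1 _ im; rewrite ex; lia.
Qed.

Lemma automaton_edgesP w : accepts w <->
  exists2 l, word_walk (automaton_edges w) (start_vertex w) l (goal_vertex w)
    & drun l [::] = Some [::].
Proof.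
split.
  move=> [q qf /steps_walk[l W D]].
  exists (pushes (sym_word (stackend A)) ++ l ++ (pops (sym_word (stackend A)) ++ [::])).
    apply: word_walk_cons; first exact: mem_head.
    apply: word_walk_cat; first by rewrite (_ : nat_of_ord _ = config_vertex (start A) 0) //; exact: W.
    apply: word_walk_cons (word_walk_nil _ _).
    rewrite inE mem_cat; apply/or3P; apply: Or32; apply/mapP; exists q => //.
    by rewrite mem_enum.
  rewrite /stack_word /= !cats0 in D.
  rewrite cats0 drun_cat drun_pushes [obind _ _]/= cats0 drun_cat D [obind _ _]/=.
  by have := drun_pops (sym_word (stackend A)) [::]; rewrite cats0.
move=> [l W D]; have H0 : visited w (start_vertex w) [::] by apply: Or31.
have gen x l' y : word_walk (automaton_edges w) x l' y -> forall st st',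
    drun l' st = Some st' -> visited w x st -> visited w y st'.
  elim=> [x' st _ [<-]//|x' y' z u l0 xy _ IH st st2].
  rewrite drun_cat; case E: (drun u st) => [st'|] //= D' V.
  exact: IH D' (visited_step xy E V).
have := gen _ _ _ W _ _ D H0.
case=> [[]|[q [i [g [ex im _ _]]]]|[_ [q qf [g eg Hs]]]].
- by rewrite /goal_vertex /start_vertex; lia.
- by have := config_vertex_lt q im; rewrite -ex /goal_vertex; lia.
- by exists q => //; rewrite (stack_word_nil (esym eg)) in Hs.
Qed.

End AutomatonGraph.

(** * Writing the configuration graph *)

Lemma expand_cat f E1 E2 :
  expand f (E1 ++ E2) = expand f E1 ++ expand (fresh_end f E1) E2.
Proof.
elim: E1 f => [|[[u w] v] E1 IH] f /=; first by rewrite /fresh_end addn0.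
by rewrite IH catA fresh_end_cons.
Qed.

Lemma fresh_end1 f u w v : fresh_end f [:: (u, w, v)] = f + (size w).-1.
Proof. by rewrite /fresh_end /= addn0. Qed.

Lemma fresh_end_cat f E1 E2 : fresh_end f (E1 ++ E2) = fresh_end (fresh_end f E1) E2.
Proof. by rewrite /fresh_end map_cat sumn_cat addnA. Qed.

Definition graph_bits W (E : seq (nat * nat * paren)) :=
  flatten [seq true :: edge_bits W e | e <- E].

Lemma graph_bits_cat W E1 E2 : graph_bits W (E1 ++ E2) = graph_bits W E1 ++ graph_bits W E2.
Proof. by rewrite /graph_bits map_cat flatten_cat. Qed.

Lemma graph_bits_cons W e E : graph_bits W (e :: E) = true :: edge_bits W e ++ graph_bits W E.
Proof. by []. Qed.

(* Variables: 0 the size of the input, 1 the number of vertices, 2 the width of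
   their codes, 5 the current vertex of a subdivided edge, 6 the next new vertex,
   7 the end of the subdivided edge, 8 the head position, 9 the position of the
   right end marker, 11 the scanned letter, 12 the width of its code; the others
   are scratch. *)
Definition edge_item (y : nat) (c : paren) : prog :=
  Seq (Emit [:: true]) (Seq (emit_bits 4 2 (Var 5)) (Seq (emit_bits 4 2 (Var y))
    (Emit (code_paren c)))).

Fixpoint chain_prog (w : seq paren) : prog :=
  if w is c :: w' then
    if w' is _ :: _ then
      Seq (edge_item 6 c) (Seq (Set_ 5 (Var 6)) (Seq (Set_ 6 (succ 6)) (chain_prog w')))
    else edge_item 7 c
  else Skip.

Definition edge_prog (eu : expr) (w : seq paren) (ev : expr) : prog :=
  Seq (Set_ 5 eu) (Seq (Set_ 7 ev) (chain_prog w)).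

Section Emission.
Variables (inp : seq bool) (N M B : nat).
Notation wp := (wp inp N M B).
Variables (n V W i m1 a b : nat).
Hypothesis WM : W <= M.

Lemma wp_chain_prog w pw tmp x f y p o Q :
  x < B -> y < B -> f + size w < B ->
  (forall tmp' x', Q (LState [:: n; V; W; pw; tmp'; x'; f + (size w).-1; y; i; m1; p; a; b]
     (o ++ graph_bits W (chain x w f y)))) ->
  wp (chain_prog w) Q (LState [:: n; V; W; pw; tmp; x; f; y; i; m1; p; a; b] o).
Proof.
elim: w x f tmp o => [|c [|c' w] IH] x f tmp o xB yB fB HQ.
- by move: (HQ tmp x); rewrite /= addn0 cats0.
- apply: wp_seqI; apply: wp_emit; simp_state.
  apply: wp_seqI; apply: wp_emit_bits => //; simp_state => // t1.
  apply: wp_seqI; apply: wp_emit_bits => //; simp_state => // t2.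
  apply: wp_emit; simp_state; move: (HQ t2 x).
  by rewrite /graph_bits /edge_bits /= addn0 cats0 -!catA.
- have szE : size [:: c, c' & w] = (size (c' :: w)).+1 by [].
  rewrite szE in fB HQ; apply: wp_seqI.
  apply: wp_seqI; apply: wp_emit; simp_state.
  apply: wp_seqI; apply: wp_emit_bits => //; simp_state => // t1.
  apply: wp_seqI; apply: wp_emit_bits => //; simp_state; first by lia.
  move=> t2; apply: wp_emit; simp_state.
  apply: wp_seqI; apply: wp_set; simp_state; first by lia.
  apply: wp_seqI; apply: wp_set; simp_state; first by lia.
  rewrite addn1; apply: IH => //; try lia.
  move=> t3 x3; move: (HQ t3 x3); rewrite [_.+1.-1]/= [size (c' :: w)]/= -addSnnS.
  rewrite [chain x _ f y]/= -/(chain f (c' :: w) f.+1 y) graph_bits_cons.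
  by rewrite /edge_bits -!catA.
Qed.

Lemma wp_edge_prog eu w ev u v pw tmp x f y p o Q :
  (forall o tmp x y p, eval inp (LState [:: n; V; W; pw; tmp; x; f; y; i; m1; p; a; b] o) eu = u) ->
  (forall o tmp x y p, eval inp (LState [:: n; V; W; pw; tmp; x; f; y; i; m1; p; a; b] o) ev = v) ->
  u < B -> v < B -> f + size w < B ->
  (forall tmp' x' y', Q (LState [:: n; V; W; pw; tmp'; x'; fresh_end f [:: (u, w, v)]; y'; i; m1; p; a; b]
     (o ++ graph_bits W (expand f [:: (u, w, v)])))) ->
  wp (edge_prog eu w ev) Q (LState [:: n; V; W; pw; tmp; x; f; y; i; m1; p; a; b] o).
Proof.
move=> Eu Ev uB vB fB HQ.
apply: wp_seqI; apply: wp_set; rewrite Eu //; simp_state.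
apply: wp_seqI; apply: wp_set; rewrite Ev //; simp_state.
apply: wp_chain_prog => // t x'; move: (HQ t x' v).
by rewrite /fresh_end /= !addn0 cats0.
Qed.

End Emission.

Section Recognition.
Variable A : npda.
Notation S := #|state A|.
Notation rank := enum_rank.
Local Notation trans := (state A * letter A * stacksym A * state A * seq (stacksym A) * int)%type.

Definition trans_word (tr : trans) : seq paren :=
  let: (q1, a, Z, q2, g, d) := tr in replace_word Z g.

Definition vertex_expr (i : expr) (q : state A) : expr :=
  Bin Add (Bin Mul i (Cst S)) (Cst (rank q)).

Definition move_guard (d : int) : expr :=
  if d == 1%R then Bin Lt (Var 8) (Var 9)
  else if d == 0%R then Cst 1 else Bin Lt (Cst 0) (Var 8).

Definition move_expr (d : int) : expr :=
  if d == 1%R then Bin Add (Var 8) (Cst 1)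
  else if d == 0%R then Var 8 else Bin Sub (Var 8) (Cst 1).

(** The automaton is fixed, so each transition is unrolled into a program in which ranks and labels
    are literal constants; the product in the test is a conjunction. *)
Definition trans_prog (tr : trans) : prog :=
  let: (q1, a, Z, q2, g, d) := tr in
  If (Bin Mul (Bin Eq (Var 11) (Cst (rank a))) (move_guard d))
    (edge_prog (vertex_expr (Var 8) q1) (replace_word Z g)
       (vertex_expr (move_expr d) q2)) Skip.

Definition seq_progs (l : seq prog) : prog := foldr Seq Skip l.

Section Trans.
Variables (inp : seq bool) (N M B : nat).
Notation wp := (wp inp N M B).
Variables (n V W i m1 b : nat) (a : letter A).
Hypotheses (WM : W <= M) (im : i <= m1) (VB : (m1 + 1) * S <= B).

Lemma wp_trans_progs l pw tmp x f y p o Q :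
  f + sumn [seq size (trans_word tr) | tr <- l] < B ->
  (forall tr, tr \in l -> tr.2 \in [:: -1; 0; 1]%R) ->
  (forall tmp' x' y', Q (LState
     [:: n; V; W; pw; tmp'; x'; fresh_end f [seq trans_edge i tr | tr <- l & enabled i m1 a tr];
        y'; i; m1; p; nat_of_ord (rank a); b]
     (o ++ graph_bits W (expand f [seq trans_edge i tr | tr <- l & enabled i m1 a tr])))) ->
  wp (seq_progs (map trans_prog l)) Q
    (LState [:: n; V; W; pw; tmp; x; f; y; i; m1; p; nat_of_ord (rank a); b] o).
Proof.
elim: l tmp x f y o => [|tr l IH] tmp x f y o fB Hd HQ.
  by move: (HQ tmp x y); rewrite /graph_bits /fresh_end /= addn0 cats0.
have {}Hd : tr.2 \in [:: -1; 0; 1]%R /\ forall tr, tr \in l -> tr.2 \in [:: -1; 0; 1]%R.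
  by split=> [|tr' h]; apply: Hd; rewrite inE ?eqxx // h orbT.
case: Hd => dtr Hd.
have {}fB : f + (size (trans_word tr) + sumn [seq size (trans_word tr) | tr <- l]) < B := fB.
rewrite addnA in fB.
have lt (q : state A) j : j <= m1 -> j * S + rank q < B.
  move=> jm; have /= := config_vertex_lt q (_ : j < m1 + 1).
  by rewrite addn1 ltnS jm => /(_ isT) h; apply: leq_trans h _; rewrite -addn1.
case: tr dtr fB HQ => [[[[[q1 c] Z] q2] g] d] dtr fB HQ.
rewrite /= in dtr; rewrite [trans_word _]/= in fB; rewrite [seq_progs _]/=.
apply: wp_seqI; apply: wp_if; simp_state.
  move=> gd; have [ca cm] : (c == a) /\ can_move d i m1.
    move: gd; case: (nat_of_ord (rank a) =P _) => [/ord_inj/enum_rank_inj ->|] //.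
    rewrite eqxx mul1n /move_guard /can_move.
    by case: ifP => _; [|case: ifP => _]; simp_state => //; case: (_ < _).
  have ef : [seq trans_edge i tr | tr <- (q1, c, Z, q2, g, d) :: l & enabled i m1 a tr] =
    [:: trans_edge i (q1, c, Z, q2, g, d)] ++
      [seq trans_edge i tr | tr <- l & enabled i m1 a tr].
    by rewrite [seq.filter _ (_ :: _)]/= /enabled /= ca cm.
  rewrite {}ef fresh_end_cat expand_cat graph_bits_cat catA in HQ.
  have [_ mm] := moved_step dtr cm im.
  apply: (@wp_edge_prog _ _ _ _ _ _ _ _ _ _ _ _ _ _ _
     (config_vertex q1 i) (config_vertex q2 (moved d i))) => //.
  + move=> *; rewrite /vertex_expr /move_expr /moved /config_vertex.
    by do ?[case: ifP => _]; simp_state; rewrite ?addn1 ?subn1.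
  + exact: lt.
  + exact: lt.
  + lia.
  move=> t1 x1 y1; apply: IH => //.
    by rewrite fresh_end1; lia.
move=> gd; have ne : enabled i m1 a (q1, c, Z, q2, g, d) = false.
  rewrite /enabled /=; apply/negP => /andP[/eqP ca cm]; move: gd.
  rewrite ca eqxx mul1n /move_guard; move: cm; rewrite /can_move.
  by do ?[case: ifP => _]; simp_state => // ->.
rewrite [seq.filter _ (_ :: _)]/= ne in HQ; apply: IH => //.
by lia.
Qed.

End Trans.

End Recognition.

Section RecognitionProgram.
Variable A : npda.
Notation S := #|state A|.
Notation rank := enum_rank.

Definition end_word := sym_word (stackend A).

Definition start_expr : expr := Bin Mul (succ 9) (Cst S).
Definition goal_expr : expr := Bin Add start_expr (Cst 1).

Definition final_prog (q : state A) : prog :=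
  edge_prog (vertex_expr (Var 9) q) (pops end_word) goal_expr.

Definition letter_width := up_log 2 #|letter A|.

Definition letter_prog : prog :=
  If (Bin Eq (Var 8) (Cst 0)) (Set_ 11 (Cst (rank (lend A))))
    (If (Bin Eq (Var 8) (Var 9)) (Set_ 11 (Cst (rank (rend A))))
      (read_num 11 10 12 3 (Bin Mul (Bin Sub (Var 8) (Cst 1)) (Var 12)))).

Definition trans_size := sumn [seq size (trans_word tr) | tr <- delta A].
(** One push of the end-of-stack symbol at the start and one pop for each final state. *)
Definition end_size := (size end_word) * #|final A|.+1.

Definition recognition_prog : prog :=
  Seq (Set_ 9 (Bin Add (Bin Div (Var 0) (Cst letter_width)) (Cst 1)))
  (Seq (Set_ 12 (Cst letter_width))
  (Seq (Set_ 1 (Bin Add (Bin Mul (succ 9) (Cst (S + trans_size))) (Cst (2 + end_size))))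
  (Seq (compute_up_log 2 3 1)
  (Seq (emit_unary (Var 1))
  (Seq (emit_bits 4 2 start_expr)
  (Seq (emit_bits 4 2 goal_expr)
  (Seq (Set_ 6 (Bin Add start_expr (Cst 2)))
  (Seq (edge_prog start_expr (pushes end_word) (Cst (rank (start A))))
  (Seq (seq_progs (map final_prog (enum (final A))))
  (Seq (Set_ 8 (Cst 0))
  (Seq (For true (succ 9)
     (Seq letter_prog (Seq (seq_progs (map (@trans_prog A) (delta A))) (Set_ 8 (succ 8)))))
  (Emit [:: false])))))))))))).

(** The number of vertices is written before the edges, while the number of enabled transitions
    depends on the letters. This upper bound depends on the length only; the surplus vertices are
    isolated. *)
Definition vertex_count m := (m.+2 * (S + trans_size)) + (2 + end_size).

Definition word_code (w : seq (letter A)) := flatten [seq code_elt a | a <- w].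

Lemma letter_width_gt0 : 0 < letter_width.
Proof.
rewrite /letter_width up_log_gt0 //=.
rewrite (cardD1 (lend A)) (cardD1 (rend A)) !inE /= eq_sym.
by rewrite (lend_neq_rend A).
Qed.

Lemma size_word_code w : size (word_code w) = size w * letter_width.
Proof.
elim: w => // a w IH; rewrite /word_code /= size_cat size_bits mulSn.
by congr (_ + _).
Qed.

Lemma word_code_at inp w i : inp = word_code w -> i < size w ->
  at_ inp (i * letter_width) (bits letter_width (rank (nth (lend A) w i))).
Proof.
move=> -> iw; have := at_full (word_code w).
rewrite {2}/word_code -{2}(cat_take_drop i w) (drop_nth (lend A)) // map_cat flatten_cat /=.
rewrite !at_cat -/(word_code (take i w)) size_word_code size_takel ?(ltnW iw) // add0n.
by case/and3P.
Qed.

Definition edges_upto (w : seq (letter A)) k :=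
  (start_vertex w, pushes end_word, nat_of_ord (rank (start A))) ::
  final_edges w ++ flatten [seq position_edges w i | i <- iota 0 k].

Lemma edges_uptoS (w : seq (letter A)) k : edges_upto w k.+1 = edges_upto w k ++ position_edges w k.
Proof.
rewrite /edges_upto -addn1 iotaD map_cat flatten_cat /= cats0 add0n.
by rewrite -cat_cons -!catA.
Qed.

Lemma sumn_filter_le (T : Type) (f : T -> nat) (p : pred T) l :
  sumn [seq f x | x <- l & p x] <= sumn [seq f x | x <- l].
Proof. by elim: l => //= x l IH; case: (p x) => /=; lia. Qed.

Definition edges_size (E : seq (nat * seq paren * nat)) := sumn [seq size e.1.2 | e <- E].

Lemma edges_size_cat E1 E2 : edges_size (E1 ++ E2) = edges_size E1 + edges_size E2.
Proof. by rewrite /edges_size map_cat sumn_cat. Qed.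

Lemma position_edges_size (w : seq (letter A)) k : edges_size (position_edges w k) <= trans_size.
Proof.
rewrite /edges_size /(position_edges w k) -map_comp.
rewrite (@eq_map _ _ _ (fun tr => size (trans_word tr))).
  exact: sumn_filter_le.
by move=> [[[[[q1 c] Z] q2] g] d].
Qed.

Lemma final_edges_size (w : seq (letter A)) : edges_size (final_edges w) = size end_word * #|final A|.
Proof.
rewrite /edges_size /(final_edges w) -map_comp cardE.
by elim: (enum _) => [|q l IH] /=; rewrite ?muln0 // mulnS -IH size_map.
Qed.

Lemma edges_upto_size (w : seq (letter A)) k : edges_size (edges_upto w k) <= end_size + k * trans_size.
Proof.
elim: k => [|k IH]; last first.
  by rewrite edges_uptoS edges_size_cat; have := position_edges_size w k; rewrite mulSn; lia.
rewrite /edges_upto /= cats0 /end_size mulnS addn0.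
by rewrite -(final_edges_size w) /pushes /edges_size /= size_map size_rev.
Qed.

Lemma fresh_end_le f E : fresh_end f E <= f + edges_size E.
Proof.
rewrite /fresh_end /edges_size leq_add2l.
by elim: E => //= e E IH; lia.
Qed.

Definition first_fresh (w : seq (letter A)) := ((size w).+2 * S).+2.

(** The second summand reserves vertices for the positions still to be treated, which bounds the
    counter of new vertices in every round of the main loop. *)
Lemma edges_upto_fresh (w : seq (letter A)) k : k <= (size w).+2 ->
  fresh_end (first_fresh w) (edges_upto w k) + (((size w).+2 - k) * trans_size) <=
  vertex_count (size w).
Proof.
move=> kw; have := fresh_end_le (first_fresh w) (edges_upto w k).
have := edges_upto_size w k; rewrite /vertex_count /first_fresh mulnDr.
have -> : (size w).+2 * trans_size = k * trans_size + ((size w).+2 - k) * trans_size.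
  by rewrite -mulnDl subnKC.
by lia.
Qed.

Lemma wp_final_progs inp N M B n V W i m1 a b l pw tmp x f y p o Q :
  W <= M -> (m1 + 1) * S + 2 <= B -> f + size end_word * size l < B ->
  let E := [seq (config_vertex q m1, pops end_word, ((m1 + 1) * S).+1) | q <- l] in
  (forall tmp' x' y', Q (LState
     [:: n; V; W; pw; tmp'; x'; fresh_end f E; y'; i; m1; p; a; b]
     (o ++ graph_bits W (expand f E)))) ->
  wp inp N M B (seq_progs (map final_prog l)) Q
    (LState [:: n; V; W; pw; tmp; x; f; y; i; m1; p; a; b] o).
Proof.
move=> WM SB; elim: l tmp x f y o => [|q l IH] tmp x f y o fB E HQ.
  by move: (HQ tmp x y); rewrite /E /graph_bits /fresh_end /= addn0 cats0.
have {}fB : f + size end_word + size end_word * size l < B by rewrite -addnA -mulnS.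
rewrite [seq_progs _]/=.
have lt : config_vertex q m1 < B.
  by have := config_vertex_lt q (ltnSn m1); rewrite -addn1; lia.
apply: wp_seqI; apply: (@wp_edge_prog _ _ _ _ _ _ _ _ _ _ _ _ _ _ _
     (config_vertex q m1) ((m1 + 1) * S).+1) => //.
- by move=> *; rewrite /goal_expr /start_expr; simp_state; rewrite addn1.
- by lia.
- by rewrite /pops size_map; lia.
move=> t1 x1 y1; apply: IH.
  by rewrite fresh_end1 /pops size_map; lia.
move=> t2 x2 y2; move: (HQ t2 x2 y2).
rewrite /E (_ : map _ (q :: l) = [:: (config_vertex q m1, pops end_word, ((m1 + 1) * S).+1)] ++
  [seq (config_vertex q m1, pops end_word, ((m1 + 1) * S).+1) | q <- l]) //.
by rewrite fresh_end_cat expand_cat graph_bits_cat catA.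
Qed.

Definition recognition_edges w := expand (first_fresh w) (automaton_edges w).

Lemma recognition_prog_spec w N M B : let n := size (word_code w) in
  let V := vertex_count (size w) in let W := up_log 2 V in
  V <= N -> W <= M -> letter_width <= M -> 2 * V < B -> n + 2 < B ->
  trans_size < B -> 2 ^ letter_width < B ->
  wp (word_code w) N M B recognition_prog
    (fun s => out s = unary V ++ bits W (start_vertex w) ++ bits W (goal_vertex w) ++
       code_list (edge_bits W) (recognition_edges w))
    (init (word_code w)).
Proof.
set inp := word_code w; move=> n V W VN WM bM VB nB tB bB.
set m := size w in V W VN WM VB *.
have nE : n = m * letter_width by rewrite /n /inp size_word_code.
have b0 := letter_width_gt0.
have mn : m <= n by rewrite nE leq_pmulr.
have VE : V = (m.+2 * S + m.+2 * trans_size) + (2 + end_size).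
  by rewrite /V /vertex_count mulnDr.
have ltb : letter_width < B by apply: leq_ltn_trans bB; rewrite ltnW // ltn_expl.
rewrite /init -/n.
apply: wp_seqI; apply: wp_set; simp_state; rewrite nE mulnK //; first by alia.
rewrite -nE addn1.
apply: wp_seqI; apply: wp_set; simp_state; first by alia.
have VE' : (m.+1 + 1) * (S + trans_size) + (2 + end_size) = V by rewrite addn1.
apply: wp_seqI; apply: wp_set; simp_state; rewrite VE'; first by alia.
apply: wp_seqI; apply: wp_compute_up_log => //; simp_state; try alia.
rewrite -/W.
apply: wp_seqI; apply: wp_emit_unary; simp_state; first by [].
have S0 : 0 < S by apply: leq_ltn_trans (ltn_ord (rank (start A))).
have sE : (m.+1 + 1) * S = start_vertex w by rewrite addn1.
have sV : start_vertex w + 2 <= V by rewrite VE -sE addn1; alia.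
have gE : goal_vertex w = (start_vertex w).+1 by [].
apply: wp_seqI; apply: wp_emit_bits => //; rewrite /start_expr; simp_state;
  rewrite ?sE //; first by alia.
move=> t1; apply: wp_seqI; apply: wp_emit_bits => //; rewrite /goal_expr /start_expr;
  simp_state; rewrite ?sE ?addn1 -?gE //; first by alia.
move=> t2; apply: wp_seqI; apply: wp_set; simp_state; rewrite sE; first by alia.
rewrite addn2 -[(start_vertex w).+2]/(first_fresh w) -!catA.
rewrite cat0s; set hdr := unary V ++ bits W (start_vertex w) ++ bits W (goal_vertex w).
set f0 := first_fresh w.
have fr k : k <= m.+2 -> fresh_end f0 (edges_upto w k) + (m.+2 - k) * trans_size <= V.
  exact: edges_upto_fresh.
have szf : f0 + end_size <= V by rewrite VE /f0 /first_fresh -/m; alia.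
have ese : end_size = size end_word + size end_word * #|final A| by rewrite /end_size mulnS.
apply: wp_seqI; apply: (@wp_edge_prog _ _ _ _ _ _ _ _ _ _ _ _ _ _ _
     (start_vertex w) (rank (start A))) => //.
- by alia.
- by have : rank (start A) < S := ltn_ord _; rewrite -sE addn1 in sV; alia.
- by rewrite /pushes size_map size_rev; alia.
move=> t3 x3 y3.
set e0 := [:: (start_vertex w, _, _)].
have fe0 : fresh_end f0 e0 + size end_word * #|final A| < B.
  by rewrite fresh_end1 /pushes size_map size_rev; alia.
apply: wp_seqI; apply: wp_final_progs => //.
- by rewrite sE; alia.
- by rewrite -cardE.
rewrite (_ : [seq _ | q <- enum (final A)] = final_edges w); last first.
  by rewrite /final_edges gE -sE.
move=> t4 x4 y4; rewrite -fresh_end_cat -catA -graph_bits_cat -expand_cat.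
have -> : e0 ++ final_edges w = edges_upto w 0 by rewrite /edges_upto /= cats0.
apply: wp_seqI; apply: wp_set; simp_state; first by alia.
apply: wp_seqI; apply: (@wp_for _ _ _ _ _ _ _ _ _ (fun k s => exists pw tmp x y p a,
  s = LState [:: n; V; W; pw; tmp; x; fresh_end f0 (edges_upto w k); y; k; m.+1; p; a;
    letter_width] (hdr ++ graph_bits W (expand f0 (edges_upto w k))))).
- rewrite /= /env /= addn1; apply: leq_trans VN; rewrite VE.
  by have := leq_pmulr m.+2 S0; alia.
- by exists (2 ^ W), t4, x4, y4, 0, 0.
- move=> k s; simp_state; rewrite addn1 => km [pw [tmp [x [y [p [a ->]]]]]].
  pose c := nth (lend A) (tape w) k.
  apply: (@wp_seq _ _ _ _ _ _ (fun s => exists pw p, s =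
    LState [:: n; V; W; pw; tmp; x; fresh_end f0 (edges_upto w k); y; k; m.+1; p;
    nat_of_ord (rank c); letter_width] (hdr ++ graph_bits W (expand f0 (edges_upto w k))))).
    have rl (l : letter A) : rank l < B.
      by apply: ltn_trans bB; apply: enum_rank_lt.
    apply: wp_if; simp_state; case: (k =P 0) => [k0|k0] // _.
      apply: wp_set; simp_state; first exact: rl.
      by exists pw, p; rewrite /c k0.
    apply: wp_if; simp_state; case: (k =P m.+1) => [k1|k1] // _.
      apply: wp_set; simp_state; first exact: rl.
      by exists pw, p; rewrite /c k1 /= nth_rcons ltnn eqxx.
    (* The left end marker occupies position 0 of the tape, which shifts the word by one. *)
    have cE : c = nth (lend A) w (k - 1).
      rewrite /c; case: (k) k0 k1 km => // k' _ k1 km; rewrite subn1 /= nth_rcons.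
      by case: ltngtP => //; rewrite -/m; alia.
    have k1m : k - 1 < m by alia.
    have bnd : (k - 1) * letter_width + letter_width <= n.
      by rewrite nE -mulSnr leq_mul2r; apply/orP; right; alia.
    apply: (@wp_read_num _ _ _ _ _ _ _ _ _ (rank c)) => //; simp_state => //.
    + by alia.
    + by rewrite cE; apply: word_code_at.
    + exact: enum_rank_lt.
    by eexists; eexists.
  move=> s' [pw' [p' ->]].
  have frk := fr k (ltnW km).
  have frk' : trans_size <= (m.+2 - k) * trans_size by rewrite leq_pmull // subn_gt0.
  apply: wp_seqI; apply: wp_trans_progs => //.
  + by rewrite sE; alia.
  + by rewrite -/trans_size; alia.
  + by case=> [[[[[q1 a'] Z] q2] g] d] /delta_move.
  move=> t5 x5 y5; apply: wp_set; simp_state; first by alia.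
  exists pw', t5, x5, y5, p', (rank c).
  by rewrite addn1 edges_uptoS fresh_end_cat expand_cat graph_bits_cat catA.
- move=> s; simp_state; rewrite addn1 => -[pw [tmp [x [y [p [a ->]]]]]].
  apply: wp_emit; simp_state; rewrite /hdr -!catA; do 3 congr (_ ++ _).
  by rewrite cats1.
Qed.

End RecognitionProgram.

Section RecognitionReduction.
Variable A : npda.
Notation S := #|state A|.

Lemma edges_upto_all (w : seq (letter A)) : edges_upto w (size w).+2 = automaton_edges w.
Proof. by []. Qed.

Lemma vertex_count_gt0 m : 0 < vertex_count A m.
Proof. by rewrite /vertex_count addnA addnC addnA addnS. Qed.

Lemma recognition_edges_uniq (w : seq (letter A)) :
  uniq [seq e.1 | e <- recognition_edges w].
Proof. exact: (expand_uniq (@automaton_edges_wf A w) (leqnn _)). Qed.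

(** [make_graph] takes its vertices in ['I_n.+1], so the positive vertex count enters through its
    predecessor. *)
Lemma recognition_edges_lt (w : seq (letter A)) x y c : (x, y, c) \in recognition_edges w ->
  x < (vertex_count A (size w)).-1.+1 /\ y < (vertex_count A (size w)).-1.+1.
Proof.
rewrite prednK ?vertex_count_gt0 // => /(expand_bounds (@automaton_edges_wf A w) (leqnn _)).
have := edges_upto_fresh (leqnn (size w).+2); rewrite edges_upto_all subnn mul0n addn0.
by move=> h [hx hy]; split; apply: leq_trans h.
Qed.

Lemma goal_vertex_lt (w : seq (letter A)) : goal_vertex w < (vertex_count A (size w)).-1.+1.
Proof.
rewrite prednK ?vertex_count_gt0 // /goal_vertex /vertex_count mulnDr.
lia.
Qed.

Lemma start_vertex_lt (w : seq (letter A)) : start_vertex w < (vertex_count A (size w)).-1.+1.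
Proof. exact: ltn_trans (goal_vertex_lt w). Qed.

Definition recognition_graph (w : seq (letter A)) : dyck_graph :=
  make_graph (start_vertex w) (goal_vertex w) (recognition_edges_uniq w)
    (@recognition_edges_lt w).

Lemma recognition_graphP w : dyck_reachable (recognition_graph w) <-> accepts w.
Proof.
have wf := @automaton_edges_wf A w.
have gN : goal_vertex w < ((size w).+2 * S).+2 by [].
have sN : start_vertex w < ((size w).+2 * S).+2 by rewrite ltnS leqnSn.
apply: iff_trans (iff_sym (automaton_edgesP w)).
apply: iff_trans; first by apply: make_graphP; [exact: start_vertex_lt | exact: goal_vertex_lt].
split=> -[l W D]; exists l => //.
  by have [H _] := walk_expand wf (leqnn _) gN W; apply: H.
exact: word_walk_expand wf W.
Qed.

Lemma recognition_graph_code w : let W := up_log 2 (vertex_count A (size w)) in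
  code_graph (recognition_graph w) = unary (vertex_count A (size w)) ++
    bits W (start_vertex w) ++ bits W (goal_vertex w) ++
    code_list (edge_bits W) (recognition_edges w).
Proof.
rewrite /recognition_graph make_graph_code.
- by rewrite prednK ?vertex_count_gt0.
- exact: start_vertex_lt.
- exact: goal_vertex_lt.
Qed.

Lemma size_chain x w f v : size (chain x w f v) = size w.
Proof. by elim: w x f => [|c [|c' w] IH] x f //; rewrite [LHS]/= -/(chain f (c' :: w) f.+1 v) IH. Qed.

Lemma size_expand f E : size (expand f E) = edges_size E.
Proof.
elim: E f => //= -[[u w] v] E IH f.
by rewrite size_cat size_chain IH.
Qed.

Lemma recognition_graph_size w : size (code_graph (recognition_graph w)) <=
  vertex_count A (size w) * (6 + 4 * up_log 2 (vertex_count A (size w))).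
Proof.
set V := vertex_count A (size w); rewrite recognition_graph_code -/V; set W := up_log 2 V.
rewrite !size_cat !size_bits /unary !size_rcons size_nseq.
have V0 : 0 < V := vertex_count_gt0 _.
have -> : size (flatten [seq true :: edge_bits W e | e <- recognition_edges w]) =
    size (recognition_edges w) * (3 + 2 * W).
  elim: (recognition_edges w) => //= -[[x y] c] E IH.
  by rewrite /= !size_cat !size_bits IH; case: c => /=; lia.
(* Subdivision yields one edge per letter of a label, and the total length of the labels is already
   a part of the vertex count. *)
have EV : size (recognition_edges w) <= V.
  rewrite size_expand -edges_upto_all; apply: leq_trans (edges_upto_size _ _) _.
  by rewrite /V /vertex_count mulnDr; lia.
have := leq_mul EV (leqnn (3 + 2 * W)).
move: (size (recognition_edges w)) => e h.
have : W <= V * W by rewrite leq_pmull.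
by lia.
Qed.

Lemma up_log_mul K n : up_log 2 (K * (n + 2)) <= K.+1 * lg n.
Proof.
apply: (@leq_trans (K + lg n)); last first.
  by rewrite mulSn addnC leq_add2l leq_pmulr // lg_gt0.
apply: up_log_min => //; rewrite expnD; apply: leq_mul.
  by rewrite ltnW // ltn_expl.
exact: up_logP.
Qed.

Lemma recognition_reduces_dyck : reduces false (recognition A) dyck2_reachability.
Proof.
pose K := S + trans_size A + (2 + end_size A).
(* The product bounds the size of the output, [2 * K] serves the bound [2 * V < B] on words, and
   [letter_width A] bounds the loop that reads a letter. *)
pose a := K * (4 * K + 10) + 2 * K + letter_width A + 4.
exists (fun w => recognition_graph (sval w)), (recognition_prog A), a; split.
- by rewrite /a; lia.
- have dch w : long_depth (chain_prog w) = 0.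
    by elim: w => [|c [|c' w] IH] //; rewrite /= -/(chain_prog (c' :: w)) IH.
  have dS p1 p2 : long_depth (Seq p1 p2) = maxn (long_depth p1) (long_depth p2) by [].
  have dF c e p : long_depth (For c e p) = c + long_depth p by [].
  have de eu w ev : long_depth (edge_prog eu w ev) = 0 by rewrite !dS dch.
  have ds (T : Type) (F : T -> prog) l : (forall x, long_depth (F x) = 0) ->
      long_depth (seq_progs (map F l)) = 0.
    by move=> H; elim: l => // x l IH; rewrite [seq_progs _]/= dS H IH.
  have dt tr : long_depth (@trans_prog A tr) = 0.
    case: tr => [[[[[q1 c] Z] q2] g] d].
    rewrite -[LHS]/(maxn (long_depth (edge_prog (vertex_expr (Var 8) q1)
      (replace_word Z g) (vertex_expr (move_expr d) q2))) 0).
    by rewrite de.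
  rewrite /recognition_prog !(dS, dF) dch !ds // => q.
  by rewrite /final_prog de.
move=> [w ww] n; rewrite [sval _]/= .
have {}nE : n = size (word_code w) by [].
have mn : size w <= n by rewrite nE size_word_code leq_pmulr // letter_width_gt0.
pose V := vertex_count A (size w).
have VK : V <= K * (n + 2).
  rewrite /V /vertex_count /K mulnDl; apply: leq_add.
    by rewrite mulnC leq_mul2l; apply/orP; right; lia.
  by rewrite leq_pmulr; lia.
have WK : up_log 2 V <= K.+1 * lg n.
  by apply: leq_trans (up_log_mul K n); apply: leq_up_log.
have L0 := lg_gt0 n.
have aK : 2 * K + 1 < a by rewrite /a; lia.
have K2 : 2 <= K by rewrite /K; lia.
have big := linear_le_poly n aK; set B := (n + 2) ^ a in big.
split.
- rewrite -[X in wp X]/(word_code w).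
  apply: (@wp_mono _ _ _ _ _ (fun s => out s = code_graph (recognition_graph w))) => //.
  rewrite recognition_graph_code; apply: recognition_prog_spec.
  + by apply: leq_trans VK _; rewrite leq_mul2r; apply/orP; right; lia.
  + by apply: leq_trans WK _; rewrite leq_mul2r; apply/orP; right; rewrite /a; nia.
  + by apply: leq_trans (leq_pmulr _ L0); rewrite /a; lia.
  + by rewrite -/V -/B; lia.
  + by rewrite -nE -/B; nia.
  + by rewrite -/B; apply: leq_trans big; rewrite /K; nia.
  + apply: (@leq_trans (2 ^ a)); first by rewrite ltn_exp2l // /a; lia.
    by apply: leq_exp2r_homo; lia.
- apply: leq_trans (recognition_graph_size w) _; rewrite -/V.
  apply: (@leq_trans ((K * (n + 2)) * ((4 * K + 10) * lg n))).
    by apply: leq_mul => //; nia.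
  rewrite mulnACA leq_mul2r; apply/orP; right; rewrite /a; lia.
- rewrite /= /language /=; split; first by move=> [_ /recognition_graphP].
  by move/recognition_graphP.
Qed.

End RecognitionReduction.

(** * From PDA emptiness to recognition for a fixed 2NPDA *)

Definition paren_letter (p : paren) : 'I_7 := inord (2 + paren_code p).
Definition sep : 'I_7 := inord 6.
Definition left_end : 'I_7 := inord 0.
Definition right_end : 'I_7 := inord 1.

Local Notation btrans := (bool * 'I_7 * 'I_3 * bool * seq 'I_3 * int)%type.

(* In state [false] the machine executes a block on its stack, in state [true] it
   looks for the next block to be executed. *)
Definition idle_moves : seq (bool * 'I_7 * bool * int) :=
  [:: (false, left_end, false, 1%R); (false, sep, true, 0%R); (true, sep, false, 1%R)] ++
  [seq (true, l, true, 1%R) | l <- enum 'I_7] ++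
  [seq (true, l, true, (-1)%R) | l <- enum 'I_7].

Definition idle_trans (k : bool * 'I_7 * bool * int) (Z : 'I_3) : btrans :=
  let: (q1, l, q2, d) := k in (q1, l, Z, q2, [:: Z], d).

Definition push_trans (b : bool) (Z : 'I_3) : btrans :=
  (false, paren_letter (opn b), Z, false, [:: sym b; Z], 1%R).

Definition pop_trans (b : bool) : btrans :=
  (false, paren_letter (cls b), sym b, false, [::], 1%R).

Definition block_delta : seq btrans :=
  [seq idle_trans k Z | k <- idle_moves, Z <- enum 'I_3] ++
  [seq push_trans b Z | b <- [:: false; true], Z <- enum 'I_3] ++
  [seq pop_trans b | b <- [:: false; true]].

Lemma block_deltaP tr : reflect
  [\/ exists2 k, k \in idle_moves & exists Z, tr = idle_trans k Z,
      exists b Z, tr = push_trans b Z | exists b, tr = pop_trans b]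
  (tr \in block_delta).
Proof.
rewrite /block_delta mem_cat [_ \in _ ++ [seq pop_trans _ | _ <- _]]mem_cat; apply: (iffP or3P) => -[].
- by case/allpairsPdep => k [Z [kk _ ->]]; apply: Or31; exists k => //; exists Z.
- by case/allpairsPdep => b [Z [_ _ ->]]; apply: Or32; exists b, Z.
- by case/mapP => b _ ->; apply: Or33; exists b.
- move=> [k kk [Z ->]]; apply: Or31; apply/allpairsPdep; exists k, Z.
  by rewrite mem_enum.
- move=> [b [Z ->]]; apply: Or32; apply/allpairsPdep; exists b, Z.
  by rewrite mem_enum; case: b.
- by move=> [b ->]; apply: Or33; apply: map_f; case: b.
Qed.

Lemma idle_movesP q1 l q2 d : (q1, l, q2, d) \in idle_moves ->
  [\/ [/\ q1 = false, l = left_end, q2 = false & d = 1%R],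
      [/\ q1 = false, l = sep, q2 = true & d = 0%R],
      [/\ q1 = true, l = sep, q2 = false & d = 1%R]
    | [/\ q1 = true, q2 = true & d = 1%R \/ d = (-1)%R]].
Proof.
rewrite mem_cat !inE => /orP[/or3P[]/eqP[-> -> -> ->]|].
- exact: Or41.
- exact: Or42.
- exact: Or43.
by rewrite mem_cat => /orP[]/mapP[l' _ [-> _ -> ->]]; apply: Or44; split => //; [left | right].
Qed.

Lemma block_delta_move q1 a Z q2 g d : (q1, a, Z, q2, g, d) \in block_delta ->
  d \in [:: -1; 0; 1]%R.
Proof.
case/block_deltaP => [[[[[q l] q'] d'] kk [Z' [_ _ _ _ _ ->]]]|[b [Z' []]]|[b []]].
- by case/idle_movesP: kk => [[_ _ _ ->]|[_ _ _ ->]|[_ _ _ ->]|[_ _ [->|->]]].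
- by move=> _ _ _ _ _ ->.
- by move=> _ _ _ _ _ ->.
Qed.

Lemma block_delta_stackend q1 a Z q2 g d : (q1, a, Z, q2, g, d) \in block_delta ->
  if Z == bottom then exists2 g', g = rcons g' bottom & bottom \notin g'
  else bottom \notin g.
Proof.
case/block_deltaP => [[[[[q l] q'] d'] kk [Z' [_ _ -> _ -> _]]]|[b [Z' []]]|[b []]].
- case: eqP => [->|/eqP ZN]; first by exists [::].
  by rewrite inE eq_sym (negPf ZN).
- move=> _ _ -> _ -> _; case: eqP => [->|/eqP ZN].
    by exists [:: sym b] => //; rewrite inE eq_sym sym_neq_bottom.
  by rewrite !inE eq_sym sym_neq_bottom eq_sym (negPf ZN).
- by move=> _ _ -> _ -> _; rewrite sym_neq_bottom.
Qed.

Lemma left_right_neq : left_end != right_end.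
Proof. by rewrite -val_eqE /= !inordK. Qed.

Definition block_machine : npda :=
  @NPDA bool 'I_7 'I_3 block_delta false [set true] left_end right_end
    bottom left_right_neq block_delta_move block_delta_stackend.

Definition block_word (bs : seq (seq paren)) : seq 'I_7 :=
  flatten [seq rcons (map paren_letter b) sep | b <- bs].

Lemma val_paren_letter c : val (paren_letter c) = 2 + paren_code c.
Proof. by rewrite /= inordK //; case: c. Qed.

Lemma paren_letter_inj : injective paren_letter.
Proof.
move=> c c' /(congr1 val); rewrite !val_paren_letter => /addnI.
exact: (can_inj paren_codeK).
Qed.

Lemma paren_letter_neq c :
  [/\ paren_letter c != left_end, paren_letter c != right_end & paren_letter c != sep].
Proof. by rewrite -!val_eqE !val_paren_letter /= !inordK //; case: c. Qed.

Lemma block_word_is_word bs : @is_word block_machine (block_word bs).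
Proof.
have H l : l \in block_word bs -> l != left_end /\ l != right_end.
  case/flatten_mapP => b _; rewrite mem_rcons inE => /orP[/eqP->|/mapP[c _ ->]].
    by rewrite -!val_eqE /= !inordK.
  by have [-> ->] := paren_letter_neq c.
apply/andP; split; apply/negP => /H[]; by rewrite /= eqxx.
Qed.

(** * Runs of the block machine *)

Section Run.
Variables (b0 : seq paren) (bs : seq (seq paren)).
Let blocks := b0 :: bs.
Let tp := left_end :: rcons (block_word blocks) right_end.
Let steps := clos_refl_trans _ (@Defs.step block_machine tp).

Lemma block_word_cat l1 l2 : block_word (l1 ++ l2) = block_word l1 ++ block_word l2.
Proof. by rewrite /block_word map_cat flatten_cat. Qed.

Lemma tape_at bl1 v1 v2 bl2 : blocks = bl1 ++ (v1 ++ v2) :: bl2 ->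
  let i := (size (block_word bl1) + size v1).+1 in
  i < size tp /\ nth left_end tp i = head sep (map paren_letter v2).
Proof.
move=> e i; have et : tp = (left_end :: block_word bl1 ++ map paren_letter v1) ++
    rcons (map paren_letter v2) sep ++ rcons (block_word bl2) right_end.
  rewrite /tp e block_word_cat /= /block_word /= -/(block_word bl2) map_cat.
  by rewrite !rcons_cat /= -!catA.
have ei : i = size (left_end :: block_word bl1 ++ map paren_letter v1).
  by rewrite /= size_cat size_map.
rewrite et ei; split.
  by rewrite size_cat -[ltnLHS]addn0 ltn_add2l size_cat size_rcons.
by rewrite nth_cat ltnn subnn; case: v2 {e et}.
Qed.

Lemma tape_end : nth left_end tp (size (block_word blocks)).+1 = right_end.
Proof. by rewrite /= nth_rcons ltnn eqxx. Qed.

(** The left end marker shifts the blocks by one, so the last letter of [block_word bl1] stands at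
    the index [size (block_word bl1)]. *)
Lemma sep_position i : nth left_end tp i = sep -> exists2 bl1, bl1 != [::] &
  exists2 bl2, blocks = bl1 ++ bl2 & i = size (block_word bl1).
Proof.
case: i => [|i] /=; first by move/(congr1 val); rewrite /= !inordK.
rewrite nth_rcons; case: ltnP => [|_]; last first.
  by case: eqP => _ /(congr1 val); rewrite /= !inordK.
elim: blocks i => //= b l IH i.
rewrite /block_word /= -/(block_word l) size_cat nth_cat => il.
case: ltnP => [ib|bi].
  rewrite nth_rcons size_map; move: ib; rewrite size_rcons size_map ltnS leq_eqVlt.
  case: ltngtP => //= [ib _|-> _] h.
    move: h; rewrite (nth_map RoundO) // => /eqP.
    by have [_ _ /negPf ->] := paren_letter_neq (nth RoundO b i).
  by exists [:: b] => //; exists l; rewrite // /block_word /= cats0 size_rcons size_map.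
move=> h; have il' : i - size (rcons (map paren_letter b) sep) < size (block_word l).
  by rewrite ltn_subLR.
have [bl1 n1 [bl2 e1 e2]] := IH _ il' h.
exists (b :: bl1) => //; exists bl2; first by rewrite e1.
rewrite /block_word /= -/(block_word bl1) size_cat -e2.
by rewrite addnS subnKC.
Qed.

(** A block is entered through the separator before it. The first block has none, so it is executed
    exactly once, at the start; the others follow in any order and any number of times. *)
Definition chosen (u : seq paren) :=
  exists2 js, {subset js <= bs} & u = b0 ++ flatten js.

(** In state [false] the word executed so far is [u ++ v1], with [v1] the part of the current block
    before the head. In the last case the machine has passed the final separator in state [false]:
    it is stuck on the right end marker, so its history is not recorded. *)
Definition block_inv (c : config block_machine) : Prop := exists2 st, c.2 = stack_of st &
  if c.1.1 then exists2 u, chosen u & drun u [::] = Some st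
  else [\/ c.1.2 = 0 /\ st = [::],
    exists bl1 v1 v2 bl2 u, [/\ blocks = bl1 ++ (v1 ++ v2) :: bl2,
      c.1.2 = (size (block_word bl1) + size v1).+1,
      bl1 = [::] /\ u = [::] \/ bl1 <> [::] /\ chosen u & drun (u ++ v1) [::] = Some st]
    | c.1.2 = (size (block_word blocks)).+1].

Lemma stack_of_cons b st : stack_of (b :: st) = sym b :: stack_of st.
Proof. by []. Qed.

Lemma in_bs bl1 v bl2 : bl1 <> [::] -> blocks = bl1 ++ v :: bl2 -> v \in bs.
Proof. by case: bl1 => // b bl1 _ [_ ->]; rewrite mem_cat mem_head orbT. Qed.

Lemma chosen_rcons u v : chosen u -> v \in bs -> chosen (u ++ v).
Proof.
move=> [js sub ->] vb; exists (rcons js v).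
  by move=> w; rewrite mem_rcons inE => /orP[/eqP->//|]; apply: sub.
by rewrite flatten_rcons catA.
Qed.

Lemma block_inv_step x y : block_inv x -> @Defs.step block_machine tp x y -> block_inv y.
Proof.
move=> I S; case: S I => q1 Z q2 g' d g i j ilt jlt ij tr [/= st est I].
have lz : nth left_end tp 0 = left_end by [].
have plE c : paren_letter c <> left_end /\ paren_letter c <> sep.
  by have [h1 _ h3] := paren_letter_neq c; split; apply/eqP.
have sl : sep <> left_end by move/(congr1 val); rewrite /= !inordK.
have rE : right_end <> left_end /\ right_end <> sep.
  by split; move/(congr1 val); rewrite /= !inordK.
have rp c : right_end <> paren_letter c.
  by have [_ /eqP h _] := paren_letter_neq c; move=> e; apply: h.
case/block_deltaP: tr => [[[[[q l] q'] d'] kk [Z' [eq el eZ eq' eg ed]]]|[b [Z' tr]]|[b tr]].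
- subst q1 Z q2 g' d; exists st; rewrite //=.
  case/idle_movesP: kk => [[eq' l0 eq ed]|[eq' l0 eq ed]|[eq' l0 eq ed]|[eq' eq ed]]; subst q q' .
  (* The four kinds of idle moves are, in order: leaving the left end marker, ending a block,
     entering a block, and wandering. *)
  + subst d'; case: I => [[i0 st0]|[bl1 [v1 [v2 [bl2 [u [e ei _ _]]]]]]|ei].
    * apply: Or32; exists [::], [::], b0, bs, [::]; split; rewrite ?st0 //; last by left.
      by rewrite /=; lia.
    * have [_ h] := tape_at e; move: el; rewrite l0 ei h.
      by case: v2 {h e} => [|c v2] /= h; [case: (sl h) | have [[]] := plE c].
    * by move: el; rewrite ei tape_end l0 => h; case: rE => /(_ h).
  + subst d'; case: I => [[i0 st0]|[bl1 [v1 [v2 [bl2 [u [e ei hu hd]]]]]]|ei].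
    * by move: el; rewrite i0 lz l0 => h; case: sl.
    * have [_ h] := tape_at e; move: el; rewrite l0 ei h.
      case: v2 {h} e => [|c v2] /= e h; last by have [_ []] := plE c.
      rewrite cats0 in e; exists (u ++ v1) => //.
      case: hu => [[e1 ->]|[n1 hu]]; last by apply: chosen_rcons hu (in_bs n1 e).
      by exists [::] => //; rewrite e1 in e; case: e => ->; rewrite cats0.
    * by move: el; rewrite ei tape_end l0 => h; case: rE => _ /(_ h).
  + subst d'; rewrite l0 in el; have [bl1 n1 [bl2 e ei]] := sep_position el.
    have ej : j = (size (block_word bl1)).+1 by rewrite -ei; lia.
    (* If the separator was the last one, there is no block to enter and the head is on the right
       end marker. *)
    case: bl2 e => [|v bl2] e; first by apply: Or33; rewrite ej e cats0.
    case: I => u hu hd; apply: Or32; exists bl1, [::], v, bl2, u; split => //.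
    * by rewrite addn0.
    * by right; split=> //; apply/eqP.
    * by rewrite cats0.
  + exact: I.
- case: tr => eq el eZ eq' eg ed; subst q1 Z q2 g' d; exists (b :: st).
    by rewrite stack_of_cons -est.
  case: I => [[i0 st0]|[bl1 [v1 [v2 [bl2 [u [e ei hu hd]]]]]]|ei].
  + by move: el; rewrite i0 lz => h; have [[]] := plE (opn b).
  + have [_ h] := tape_at e; move: el; rewrite ei h.
    case: v2 {h} e => [|c v2] /= e h; first by have [_ []] := plE (opn b).
    have {}h := paren_letter_inj h; subst c.
    apply: Or32; exists bl1, (rcons v1 (opn b)), v2, bl2, u; split=> //.
    * by rewrite cat_rcons.
    * by rewrite size_rcons; lia.
    * by rewrite -cats1 catA drun_cat hd; case: (b).
  + by move: el; rewrite ei tape_end => /rp.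
- case: tr => eq el eZ eq' eg ed; subst q1 Z q2 g' d.
  case: st est I => [|b' st]; first by move=> [/eqP]; rewrite sym_neq_bottom.
  rewrite stack_of_cons => -[/sym_inj eb eg] I; subst b'; exists st => //.
  case: I => [[i0 st0]|[bl1 [v1 [v2 [bl2 [u [e ei hu hd]]]]]]|ei] //.
  + have [_ h] := tape_at e; move: el; rewrite ei h.
    case: v2 {h} e => [|c v2] /= e h; first by have [_ []] := plE (cls b).
    have {}h := paren_letter_inj h; subst c.
    apply: Or32; exists bl1, (rcons v1 (cls b)), v2, bl2, u; split=> //.
    * by rewrite cat_rcons.
    * by rewrite size_rcons; lia.
    * by rewrite -cats1 catA drun_cat hd; case: (b).
  + by move: el; rewrite ei tape_end => /rp.
Qed.

Lemma tp_size : size tp = (size (block_word blocks)).+2.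
Proof. by rewrite /= size_rcons. Qed.

Lemma block_step q1 Z q2 g' d g i j : i < size tp -> j < size tp ->
  (j%:Z = i%:Z + d)%R -> (q1, nth left_end tp i, Z, q2, g', d) \in block_delta ->
  steps (q1, i, Z :: g) (q2, j, g' ++ g).
Proof.
move=> ilt jlt ij tr; apply: rt_step.
exact: (@Defs.Step block_machine _ _ _ _ _ d).
Qed.

Lemma stack_of_head st : exists Z g, stack_of st = Z :: g.
Proof. by case: st => [|b st]; eexists; eexists. Qed.

Lemma idle_step q1 q2 d i j st : i < size tp -> j < size tp ->
  (j%:Z = i%:Z + d)%R -> (q1, nth left_end tp i, q2, d) \in idle_moves ->
  steps (q1, i, stack_of st) (q2, j, stack_of st).
Proof.
move=> ilt jlt ij kk; have [Z [g ->]] := stack_of_head st.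
apply: (block_step (g' := [:: Z]) (d := d)) => //.
by apply/block_deltaP; apply: Or31; exists (q1, nth left_end tp i, q2, d) => //; exists Z.
Qed.

Lemma seek i j st : i < size tp -> j < size tp ->
  steps (true, i, stack_of st) (true, j, stack_of st).
Proof.
have up k i' : i' + k < size tp -> steps (true, i', stack_of st) (true, i' + k, stack_of st).
  elim: k i' => [|k IH] i' h; first by rewrite addn0; apply: rt_refl.
  apply: (@rt_trans _ _ _ (true, i'.+1, stack_of st)).
    apply: (@idle_step _ _ 1%R); try lia.
    by rewrite !mem_cat map_f ?mem_enum // ?orbT.
  by rewrite addnS -addSn; apply: IH; lia.
have down k i' : i' + k < size tp -> steps (true, i' + k, stack_of st) (true, i', stack_of st).
  elim: k i' => [|k IH] i' h; first by rewrite addn0; apply: rt_refl.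
  apply: (@rt_trans _ _ _ (true, i'.+1, stack_of st)).
    by rewrite addnS -addSn; apply: IH; lia.
  apply: (@idle_step _ _ (-1)%R); try lia.
  by rewrite !mem_cat [_ \in map (fun l => (_, l, _, (-1)%R)) _]map_f ?mem_enum // !orbT.
move=> ilt jlt; have [ij|/ltnW ji] := leqP i j.
  by rewrite -(subnKC ij); apply: up; rewrite subnKC.
by rewrite -(subnKC ji); apply: down; rewrite subnKC.
Qed.

Lemma execute bl1 v1 v2 bl2 st st' : blocks = bl1 ++ (v1 ++ v2) :: bl2 ->
  drun v2 st = Some st' ->
  steps (false, (size (block_word bl1) + size v1).+1, stack_of st)
        (true, (size (block_word bl1) + size (v1 ++ v2)).+1, stack_of st').
Proof.
elim: v2 v1 st => [|c v2 IH] v1 st e.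
  move=> [<-]; have [ilt el] := tape_at e; rewrite cats0.
  apply: (@idle_step _ _ 0%R) => //; first by rewrite GRing.addr0.
  by rewrite el /= !inE eqxx !orbT.
rewrite -cat1s drun_cat; case E: (drun [:: c] st) => [st1|//] Hd.
have [ilt el] := tape_at e; rewrite [head _ _]/= in el.
have e' : blocks = bl1 ++ (rcons v1 c ++ v2) :: bl2 by rewrite cat_rcons.
have [jlt _] := tape_at e'; rewrite size_rcons in jlt.
have H := IH _ _ e' Hd; rewrite size_rcons cat_rcons in H.
apply: rt_trans H.
have push b : c = opn b -> st1 = b :: st -> steps
    (false, (size (block_word bl1) + size v1).+1, stack_of st)
    (false, (size (block_word bl1) + (size v1).+1).+1, stack_of st1).
  move=> ec ->; have [Z [g eZ]] := stack_of_head st.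
  rewrite stack_of_cons eZ; apply: (block_step (g' := [:: sym b; Z]) (d := 1%R)) => //; first lia.
  by apply/block_deltaP; apply: Or32; exists b, Z; rewrite el ec.
have pop b : c = cls b -> st = b :: st1 -> steps
    (false, (size (block_word bl1) + size v1).+1, stack_of st)
    (false, (size (block_word bl1) + (size v1).+1).+1, stack_of st1).
  move=> ec ->; rewrite stack_of_cons.
  apply: (block_step (g' := [::]) (d := 1%R)) => //; first lia.
  by apply/block_deltaP; apply: Or33; exists b; rewrite el ec.
case: (c) E push pop => /=.
- by move=> [<-] H _; apply: (H false).
- by case: st => [|[] st] // [<-] _ H; apply: (H false).
- by move=> [<-] H _; apply: (H true).
- by case: st => [|[] st] // [<-] _ H; apply: (H true).
Qed.

Lemma block_machineP : @accepts block_machine (block_word blocks) <->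
  exists2 u, chosen u & drun u [::] = Some [::].
Proof.
split.
  move=> [q qf H]; rewrite inE in qf; move/eqP: qf => qf; subst q.
  have [st est /= [u hu hd]] : block_inv (true, (size (block_word blocks)).+1, [:: bottom]).
    apply: clos_rt_invariant H _; first exact: block_inv_step.
    by exists [::] => //; apply: Or31.
  exists u => //; rewrite hd; case: st est {hd} => // b st [].
  by case: st.
move=> [u [js sub ->] Hd]; exists true; first by rewrite inE.
have sz := tp_size.
have go js' st : {subset js' <= bs} -> forall i, i < size tp ->
    drun (flatten js') st = Some [::] ->
    steps (true, i, stack_of st) (true, (size (block_word blocks)).+1, [:: bottom]).
  elim: js' st => [|v js' IH] st sub' i ilt; first by move=> [->]; apply: (seek [::] ilt); rewrite sz.
  rewrite [flatten _]/= drun_cat; case E: (drun v st) => [st1|//] H.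
  have vb : v \in bs by apply: sub'; rewrite mem_head.
  pose k := index v bs; pose bl1 := b0 :: take k bs; pose bl2 := drop k.+1 bs.
  have e : blocks = bl1 ++ ([::] ++ v) :: bl2.
    rewrite /blocks /bl1 /bl2 /= -{1}(cat_take_drop k bs) (drop_nth v) ?index_mem //.
    by rewrite nth_index.
  have [jlt _] := tape_at e; rewrite addn0 in jlt.
  (* The block before [v] is singled out because the machine enters [v] through its closing
     separator. *)
  have e1 : blocks = belast b0 (take k bs) ++ (last b0 (take k bs) ++ [::]) :: v :: bl2.
    by rewrite e cats0 -[RHS]cat_rcons -lastI.
  have [slt sl] := tape_at e1; rewrite [head _ _]/= in sl.
  have sj : size (block_word bl1) = (size (block_word (belast b0 (take k bs))) +
     size (last b0 (take k bs))).+1.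
    rewrite /bl1 lastI -cats1 block_word_cat size_cat /block_word /= cats0.
    by rewrite size_rcons size_map addnS.
  apply: (rt_trans _ _ _ _ _ (seek st ilt slt)).
  apply: (@rt_trans _ _ _ (false, (size (block_word bl1)).+1, stack_of st)).
    apply: (@idle_step _ _ 1%R) => //; first by rewrite sj; lia.
    by rewrite sl !inE eqxx !orbT.
  have := execute e E; rewrite addn0 => X; apply: rt_trans X _.
  apply: IH => //; first by move=> w wj; apply: sub'; rewrite inE wj orbT.
  have e2 : blocks = bl1 ++ (v ++ [::]) :: bl2 by rewrite cats0.
  by have [] := tape_at e2.
rewrite drun_cat in Hd; case E: (drun b0 [::]) Hd => [st|//] Hd.
have e0 : blocks = [::] ++ ([::] ++ b0) :: bs by [].
have [j0 _] := tape_at e0.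
apply: (@rt_trans _ _ _ (false, 1, [:: bottom])).
  by apply: (@idle_step _ _ 1%R _ _ [::]) => //; rewrite !inE eqxx.
have := execute e0 E => X; apply: rt_trans X _; apply: (go _ _ sub _ _ Hd).
have e2 : blocks = [::] ++ (b0 ++ [::]) :: bs by rewrite cats0.
by have [] := tape_at e2.
Qed.

End Run.

(** * The transitions of a PDA as operations on an encoded configuration *)

Section PDAToBlocks.
Variable P : npda.
Hypothesis P_pda : is_pda P.
Local Notation trans := (state P * letter P * stacksym P * state P * seq (stacksym P) * int)%type.

Lemma code_elt_inj (T : finType) (x y : T) l l' :
  code_elt x ++ l = code_elt y ++ l' -> x = y /\ l = l'.
Proof.
move/eqP; rewrite eqseq_cat ?size_bits // => /andP[/eqP e /eqP ->]; split=> //.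
apply: enum_rank_inj; apply: ord_inj; apply: bits_inj e; exact: enum_rank_lt.
Qed.

(* The marker bits make the code of a stack symbol nonempty even if there is only
   one symbol. *)
Definition marked_word (g : seq (stacksym P)) : seq bool :=
  flatten [seq true :: code_elt Z | Z <- g].

(** The leading [false] tells a known letter from [any_letter], so that a block made for one case
    fails on the other. *)
Definition exact (a : letter P) : seq bool := false :: code_elt a.
Lemma exact_inj a a' l l' : exact a ++ l = exact a' ++ l' -> a = a' /\ l = l'.
Proof. by case=> /code_elt_inj. Qed.

(* After a right move the scanned letter is unknown; a [letter_block] guesses it. *)
Definition any_letter : seq bool := [:: true].

(* A configuration of the automaton: what is known of the scanned letter, the
   state, the stack and a final [false] that detects the empty stack. *)
Definition config_word (m : seq bool) (q : state P) (g : seq (stacksym P)) : seq bool :=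
  m ++ code_elt q ++ marked_word g ++ [:: false].

Definition head_word (a : letter P) (q : state P) (Z : stacksym P) : seq bool :=
  exact a ++ code_elt q ++ marked_word [:: Z].

Lemma config_word_cons a q Z g :
  config_word (exact a) q (Z :: g) = head_word a q Z ++ marked_word g ++ [:: false].
Proof. by rewrite /config_word /head_word /marked_word /= cats0 -!catA. Qed.

Definition start_block : seq paren :=
  pushes (config_word (exact (lend P)) (start P) [:: stackend P]).

Definition letter_block (a : letter P) : seq paren :=
  pops any_letter ++ pushes (exact a).

(** It consumes an entire accepting configuration with its closing [false]. All other blocks end by
    pushing a nonempty word, so only this kind can empty the stack. *)
Definition final_block (q : state P) : seq paren :=
  pops (config_word (exact (rend P)) q [:: stackend P]).

Definition next_mode (a : letter P) (d : int) := if d == 1%R then any_letter else exact a.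

Definition trans_block (tr : trans) : seq paren :=
  let: (q1, a, Z, q2, g, d) := tr in
  pops (head_word a q1 Z) ++
  pushes (next_mode a d ++ code_elt q2 ++ marked_word g).

(** A right move from [rend P] would leave the tape. *)
Definition trans_ok (tr : trans) : bool :=
  let: (q1, a, Z, q2, g, d) := tr in ~~ ((d == 1%R) && (a == rend P)).

(** [lend P] is never guessed, since an input word contains no end marker. [rend P] may be guessed,
    and [trans_ok] then makes it the last letter. *)
Definition pda_blocks : seq (seq paren) :=
  [seq letter_block a | a <- enum (letter P) & a != lend P] ++
  [seq final_block q | q <- enum (state P) & q \in final P] ++
  [seq trans_block tr | tr <- delta P & trans_ok tr].

Lemma marked_word_cat g1 g2 : marked_word (g1 ++ g2) = marked_word g1 ++ marked_word g2.
Proof. by rewrite /marked_word map_cat flatten_cat. Qed.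

Lemma marked_wordP Z g l : marked_word g ++ [:: false] = marked_word [:: Z] ++ l ->
  exists2 g', g = Z :: g' & l = marked_word g' ++ [:: false].
Proof.
rewrite /marked_word; case: g => [//|Z' g] /=; rewrite cats0 -catA => -[].
by move/code_elt_inj => [-> <-]; exists g.
Qed.

Lemma head_wordP a q g a' q' Z l :
  config_word (exact a) q g = head_word a' q' Z ++ l ->
  [/\ a = a', q = q' & exists2 g', g = Z :: g' & l = marked_word g' ++ [:: false]].
Proof.
rewrite /config_word /head_word -[RHS]catA => /exact_inj[->].
by rewrite -[RHS]catA => /code_elt_inj[-> /marked_wordP].
Qed.

Lemma pda_move tr : tr \in delta P -> tr.2 = 0%R \/ tr.2 = 1%R.
Proof. by move/(allP P_pda); rewrite !inE => /orP[]/eqP; [left | right]. Qed.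

Definition init_config : config P := (start P, 0, [:: stackend P]).
Definition csteps (tape : seq (letter P)) := clos_refl_trans _ (Defs.step tape).

(** [u] is the part of the tape guessed so far, after the left end marker. The run on it is valid
    for every continuation [suf], because the letters not yet guessed have not been read. The first
    case is absorbing: it is reached when a final block has been executed. *)
Definition pda_inv (st : seq bool) : Prop :=
  [\/ language P <> classical_sets.set0,
    exists a q g, st = config_word (exact a) q g /\ exists2 u,
      [/\ last (lend P) u = a, lend P \notin u & rend P \notin belast (lend P) u]
      & forall suf, csteps (lend P :: u ++ suf) init_config (q, size u, g)
  | exists q g, st = config_word any_letter q g /\ exists2 u,
      lend P \notin u /\ rend P \notin u
      & forall b suf, csteps (lend P :: u ++ b :: suf) init_config (q, (size u).+1, g)].

Lemma nth_last_cat (u suf : seq (letter P)) :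
  nth (lend P) (lend P :: u ++ suf) (size u) = last (lend P) u.
Proof. by rewrite -cat_cons nth_cat ltnSn; apply: (nth_last (lend P) (lend P :: u)). Qed.

Lemma pda_inv_block b st st' : b \in pda_blocks -> drun b st = Some st' ->
  pda_inv st -> pda_inv st'.
Proof.
move=> bb Hd [?|I|I]; first by apply: Or31.
- case: I => a [q [g [est [u [la lu ru] Hs]]]].
  move: bb; rewrite mem_cat => /orP[/mapP[a' _ eb]|].
    by move: Hd; rewrite eb est.
  rewrite mem_cat => /orP[/mapP[q']|/mapP[[[[[[q1 a1] Z] q2] g'] d]]].
    rewrite mem_filter => /andP[qf _] eb; apply: Or31.
    move: Hd; rewrite eb => /drun_popsP; rewrite est config_word_cons -catA.
    move=> /head_wordP[ea eq [g0 eg]].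
    case: g0 eg => // eg _.
    (* The final block has matched [rend P] as the scanned letter. It differs from [lend P], so [u]
       is nonempty, and [u] without its last letter is the accepted word. *)
    have ur : u != [::].
      by case: (u) la => //= e; move: (lend_neq_rend P); rewrite e ea eqxx.
    case/lastP: u ur la lu ru Hs => // v x _.
    rewrite last_rcons ea => ->; rewrite belast_rcons mem_rcons !inE !negb_or.
    move=> /andP[_ lv] /andP[_ rv] Hs.
    apply/eqP; apply/classical_sets.set0P; exists v; split; first by rewrite /= /is_word lv.
    exists q; first by rewrite eq.
    have := Hs [::]; rewrite cats0 size_rcons eg.
    by [].
  rewrite mem_filter => /andP[ok tr] eb.
  move: Hd; rewrite eb drun_cat; case E: (drun _ st) => [st1|//] /=.
  rewrite drun_pushes => -[<-]; move/drun_popsP: E; rewrite est.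
  move=> /head_wordP[ea eq [g0 eg est1]].
  subst a1 q1 st1; rewrite eg in Hs.
  have := pda_move tr; rewrite /= /next_mode => -[] ed; subst d => /=.
    apply: Or32; exists a, q2, (g' ++ g0); rewrite /config_word marked_word_cat -!catA.
    split=> //; exists u => // suf.
    apply: rt_trans (Hs suf) _; apply: rt_step.
    apply: (@Defs.Step P _ _ _ _ g' 0%R) => //; rewrite ?GRing.addr0 //.
    - by rewrite /= size_cat ltnS leq_addr.
    - by rewrite /= size_cat ltnS leq_addr.
    - by rewrite nth_last_cat la.
  apply: Or33; exists q2, (g' ++ g0); rewrite /config_word marked_word_cat -!catA.
  split=> //; exists u.
    (* The retained transitions move right only from letters other than [rend P], so the scanned
       letter, the last one of [u], is not [rend P] either. *)
    split=> //; have : rend P \notin lend P :: u.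
      rewrite lastI mem_rcons inE negb_or ru andbT la eq_sym.
      by move: ok; rewrite /trans_ok eqxx.
    by rewrite inE negb_or => /andP[].
  move=> b' suf; apply: rt_trans (Hs (b' :: suf)) _; apply: rt_step.
  apply: (@Defs.Step P _ _ _ _ g' 1%R) => //.
  - by rewrite /= size_cat ltnS leq_addr.
  - by rewrite /= size_cat /= addnS !ltnS leq_addr.
  - by rewrite -addn1.
  - by rewrite nth_last_cat la.
case: I => q [g [est [u [lu ru] Hs]]].
move: bb; rewrite mem_cat => /orP[/mapP[a]|]; last first.
  rewrite mem_cat => /orP[/mapP[q' _ eb]|/mapP[[[[[[q1 a1] Z] q2] g'] d] _ eb]].
    by move: Hd; rewrite eb est.
  by move: Hd; rewrite eb est.
rewrite mem_filter => /andP[al _] eb; move: Hd; rewrite eb est drun_cat /= drun_pushes => -[<-].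
apply: Or32; exists a, q, g; split; first by [].
exists (rcons u a).
  rewrite last_rcons mem_rcons inE negb_or eq_sym al lu belast_rcons inE negb_or ru.
  by rewrite andbT eq_sym lend_neq_rend.
by move=> suf; rewrite cat_rcons size_rcons; apply: Hs.
Qed.

Lemma start_inv : pda_inv (config_word (exact (lend P)) (start P) [:: stackend P]).
Proof.
apply: Or32; exists (lend P), (start P), [:: stackend P]; split=> //.
by exists [::] => // suf; apply: rt_refl.
Qed.

Definition reached_word st :=
  exists2 js, {subset js <= pda_blocks} & drun (start_block ++ flatten js) [::] = Some st.

Lemma reached_word_block b st st' : b \in pda_blocks -> reached_word st ->
  drun b st = Some st' -> reached_word st'.
Proof.
move=> bb [js sub Hd] Hb; exists (rcons js b).
  by move=> x; rewrite mem_rcons inE => /orP[/eqP->//|]; apply: sub.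
by rewrite flatten_rcons catA drun_cat Hd.
Qed.

Lemma steps_reached w c : is_word w -> csteps (lend P :: rcons w (rend P)) init_config c ->
  c.1.2 < (size w).+2 /\
  reached_word (config_word (exact (nth (lend P) (lend P :: rcons w (rend P)) c.1.2)) c.1.1 c.2).
Proof.
move=> /andP[lw rw]; set tp := lend P :: _ => H.
have sz : size tp = (size w).+2 by rewrite /= size_rcons.
apply: (clos_rt_invariant (P := fun c => c.1.2 < (size w).+2 /\
  reached_word (config_word (exact (nth (lend P) tp c.1.2)) c.1.1 c.2)) _ H); last first.
  split=> //; exists [::] => //; rewrite cats0.
  by rewrite /start_block drun_pushes cats0.
move=> x y [_ R] S; case: S R => q1 Z q2 g' d g i j ilt jlt ij tr R; rewrite /= -/tp in R *.
rewrite sz in ilt jlt; split=> //.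
pose a := nth (lend P) tp i; rewrite -/a in R tr.
have run ok : trans_ok (q1, a, Z, q2, g', d) = ok -> ok ->
    reached_word (config_word (next_mode a d) q2 (g' ++ g)).
  move=> e1 e2; apply: (reached_word_block _ R (b := trans_block (q1, a, Z, q2, g', d))).
    by rewrite !mem_cat; apply/or3P; apply: Or33; apply: map_f; rewrite mem_filter e1 e2.
  rewrite /trans_block drun_cat.
  by rewrite config_word_cons drun_pops /= drun_pushes /config_word marked_word_cat -!catA.
have := pda_move tr; rewrite /= => -[] ed; subst d.
  have -> : j = i by move: ij; rewrite GRing.addr0 => -[].
  exact: (run true).
have {ij} ej : j = i.+1 by rewrite -addn1; move: ij => /eqP; rewrite eqz_nat => /eqP.
have im : i < (size w).+1 by rewrite ej in jlt.
have okt : trans_ok (q1, a, Z, q2, g', 1%R).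
  rewrite /trans_ok eqxx /= /a /tp; case: (i) im => [|i'] im /=; first exact: lend_neq_rend.
  rewrite nth_rcons; rewrite ltnS in im; rewrite im.
  by apply: contra rw => /eqP <-; apply: mem_nth.
have R' := run true okt isT.
(* A right move is followed at once by the block that guesses the actual next letter of the tape, so
   the invariant only mentions configurations whose letter is known. *)
set b := nth (lend P) tp j.
apply: (reached_word_block _ R' (b := letter_block b)).
  rewrite mem_cat; apply/orP; left; apply: map_f; rewrite mem_filter mem_enum andbT.
  rewrite /b ej /= nth_rcons; case: ltngtP => [iw|iw|_].
  - by apply: contra lw => /eqP <-; apply: mem_nth.
  - by move: im iw; rewrite ltnS; case: ltngtP.
  - by rewrite eq_sym lend_neq_rend.
by rewrite /letter_block /next_mode eqxx drun_cat /config_word /= drun_pushes.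
Qed.

Lemma pda_blocksP : language P <> classical_sets.set0 <->
  exists2 u, chosen start_block pda_blocks u & drun u [::] = Some [::].
Proof.
split.
  move=> /eqP/classical_sets.set0P[w [ww [q qf H]]].
  have [_ R] := steps_reached ww H.
  rewrite /= nth_rcons ltnn eqxx in R.
  have [js sub Hd] : reached_word [::].
    apply: (reached_word_block _ R (b := final_block q)).
      rewrite !mem_cat; apply/or3P; apply: Or32; apply: map_f.
      by rewrite mem_filter qf mem_enum.
    by rewrite -[X in drun _ X]cats0 drun_pops.
  by exists (start_block ++ flatten js) => //; exists js.
move=> [_ [js sub ->]]; rewrite drun_cat /start_block drun_pushes cats0 /=.
have := start_inv; move: (config_word _ _ _) => st I Hd.
(* A configuration word is never empty, so on the empty stack the invariant leaves only the
   nonemptiness of the language. *)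
have : pda_inv [::].
  elim: js st I sub Hd => [|b js IH] st I sub /=; first by case=> <-.
  rewrite drun_cat; case E: (drun b st) => [st'|//] Hd.
  apply: IH Hd; last by move=> x xj; apply: sub; rewrite inE xj orbT.
  by apply: pda_inv_block E I; apply: sub; rewrite mem_head.
by case=> // [[a [q [g [] //]]]|[q [g [] //]]].
Qed.

Definition pda_word := block_word (start_block :: pda_blocks).

Lemma pda_wordP : language P <> classical_sets.set0 <->
  language block_machine pda_word.
Proof.
apply: iff_trans pda_blocksP _; apply: iff_trans (iff_sym (block_machineP _ _)) _.
split; last by case.
by split=> //; apply: block_word_is_word.
Qed.

End PDAToBlocks.

(** * Writing the blocks of a PDA *)

Definition paren_bits (c : paren) : seq bool := bits 3 (2 + paren_code c).
Definition parens_bits (u : seq paren) : seq bool := flatten [seq paren_bits c | c <- u].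
Definition sep_bits : seq bool := bits 3 6.

Lemma parens_bits_cat u v : parens_bits (u ++ v) = parens_bits u ++ parens_bits v.
Proof. by rewrite /parens_bits map_cat flatten_cat. Qed.

Lemma block_word_code bs : @flatten bool [seq code_elt a | a <- block_word bs] =
  flatten [seq parens_bits b ++ sep_bits | b <- bs].
Proof.
elim: bs => //= b bs IH; rewrite /block_word /= -/(block_word bs) map_cat flatten_cat IH.
congr (_ ++ _); rewrite map_rcons flatten_rcons; congr (_ ++ _).
  rewrite /parens_bits -map_comp; congr flatten; apply: eq_map => c /=.
  by rewrite inord_code //; case: c.
by rewrite inord_code.
Qed.

Lemma pushes_cat l1 l2 : pushes (l1 ++ l2) = pushes l2 ++ pushes l1.
Proof. by rewrite /pushes rev_cat map_cat. Qed.

Lemma pushes_cons b l : pushes (b :: l) = pushes l ++ pushes [:: b].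
Proof. exact: (pushes_cat [:: b]). Qed.

Lemma pops_cat l1 l2 : pops (l1 ++ l2) = pops l1 ++ pops l2.
Proof. by rewrite /pops map_cat. Qed.

Lemma pops_cons b l : pops (b :: l) = pops [:: b] ++ pops l.
Proof. by []. Qed.

(** A number is pushed from its highest bit and popped from its lowest, since [pushes] reverses its
    argument and [pops] does not. *)
Definition emit_pushes (w r : nat) : prog :=
  emit_high (paren_bits RoundO) (paren_bits SquareO) 9 8 w (Var r).
Definition emit_pops (w r : nat) : prog :=
  emit_low (paren_bits RoundC) (paren_bits SquareC) 9 w (Var r).
Definition emit_parens (u : seq paren) : prog := Emit (parens_bits u).

Lemma parens_bits_pushes l : parens_bits (pushes l) =
  flatten (map (emit_code (paren_bits RoundO) (paren_bits SquareO)) (rev l)).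
Proof.
rewrite /parens_bits /pushes -map_comp; congr flatten; apply: eq_map => b.
by rewrite /= /emit_code; case: b.
Qed.

Lemma parens_bits_pops l : parens_bits (pops l) =
  flatten (map (emit_code (paren_bits RoundC) (paren_bits SquareC)) l).
Proof.
rewrite /parens_bits /pops -map_comp; congr flatten; apply: eq_map => b.
by rewrite /= /emit_code; case: b.
Qed.

(* Variables: 0 the size of the input, 1 the reading position, 2, 3, 4 the numbers
   of states, letters and stack symbols, 5, 6, 7 the widths of their codes, 10 the
   start state, 11, 12 the end-of-tape symbols, 13 the end-of-stack symbol, 14 the
   position of the final states, 15 a loop index, 16-19 the components of the
   current transition, 20 the end of its pushed word; the others are scratch. *)
Definition emit_start_block : prog :=
  Seq (emit_parens (pushes [:: false])) (Seq (emit_pushes 7 13)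
  (Seq (emit_parens (pushes [:: true])) (Seq (emit_pushes 5 10)
  (Seq (emit_pushes 6 11) (Seq (emit_parens (pushes [:: false])) (Emit sep_bits)))))).

Definition emit_letter_blocks : prog :=
  Seq (Set_ 15 (Cst 0)) (For true (Var 3) (Seq
    (If (Bin Eq (Var 15) (Var 11)) Skip
      (Seq (emit_parens (pops [:: true])) (Seq (emit_pushes 6 15)
        (Seq (emit_parens (pushes [:: false])) (Emit sep_bits)))))
    (Set_ 15 (succ 15)))).

Definition emit_final_blocks : prog :=
  Seq (Set_ 15 (Cst 0)) (For true (Var 2) (Seq
    (If (Rd (Bin Add (Var 14) (Var 15)))
      (Seq (emit_parens (pops [:: false])) (Seq (emit_pops 6 12) (Seq (emit_pops 5 15)
        (Seq (emit_parens (pops [:: true])) (Seq (emit_pops 7 13)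
        (Seq (emit_parens (pops [:: false])) (Emit sep_bits)))))))
      Skip)
    (Set_ 15 (succ 15)))).

(* The pushed word is read backwards, as its top symbol is pushed last. *)
Definition emit_pushed_word : prog :=
  Seq (Set_ 21 (Var 20)) (For true (Var 0)
    (If (Bin Lt (Var 1) (Var 21))
      (Seq (Set_ 21 (Bin Sub (Var 21) (succ 7)))
      (Seq (read_num 22 23 7 8 (succ 21))
      (Seq (emit_pushes 7 22) (emit_parens (pushes [:: true])))))
      Skip)).

(** [Var 20] points to the 0 that closes the pushed word. Two bits further is the high bit of
    [d + 1]; for a PDA it is set exactly when the head moves right. *)
Definition emit_trans_block : prog :=
  Seq (emit_parens (pops [:: false])) (Seq (emit_pops 6 17) (Seq (emit_pops 5 16)
  (Seq (emit_parens (pops [:: true])) (Seq (emit_pops 7 18)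
  (Seq emit_pushed_word (Seq (emit_pushes 5 19)
  (Seq (If (Rd (Bin Add (Var 20) (Cst 2))) (emit_parens (pushes [:: true]))
     (Seq (emit_pushes 6 17) (emit_parens (pushes [:: false]))))
  (Emit sep_bits)))))))).

Definition trans_body : prog :=
  Seq (read_num 16 1 5 8 (succ 1)) (Seq (read_num 17 1 6 8 (Var 1))
  (Seq (read_num 18 1 7 8 (Var 1)) (Seq (read_num 19 1 5 8 (Var 1))
  (Seq (Set_ 20 (Var 1))
  (Seq (list_loop 20 0 (Set_ 20 (Bin Add (Var 20) (succ 7))))
  (Seq (If (Bin Mul (Rd (Bin Add (Var 20) (Cst 2))) (Bin Eq (Var 17) (Var 12)))
     Skip emit_trans_block)
  (Set_ 1 (Bin Add (Var 20) (Cst 3))))))))).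

Lemma flatten_iotaS (F : nat -> seq bool) k :
  flatten [seq F i | i <- iota 0 k.+1] = flatten [seq F i | i <- iota 0 k] ++ F k.
Proof. by rewrite -addn1 iotaD map_cat flatten_cat /= cats0. Qed.

Section Blocks.
Variables (inp : seq bool) (N M B : nat).
Notation wp := (wp inp N M B).
Variables (n Q L G wq wl wg q0 le re z0 fp : nat).
Hypotheses (nE : n = size inp) (nN : n <= N) (nB : n + 4 < B).
Hypotheses (wqM : wq <= M) (wlM : wl <= M) (wgM : wg <= M).
Hypotheses (wqB : 2 ^ wq < B) (wlB : 2 ^ wl < B) (wgB : 2 ^ wg < B).
Hypotheses (QN : Q <= N) (LN : L <= N) (QB : Q < B) (LB : L < B).

Local Notation St p pw tmp a q1 ra Z q2 e x r y o :=
  (LState [:: n; p; Q; L; G; wq; wl; wg; pw; tmp; q0; le; re; z0; fp; a; q1; ra; Z; q2; e; x; r; y] o).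

Lemma wp_emit_pushes w r R s : 9 != w -> 8 != w -> env s r < B -> env s w <= M ->
  2 ^ env s w < B ->
  R (LState (set_nth 0 (set_nth 0 (vars s) 9 (env s r)) 8 1)
     (out s ++ parens_bits (pushes (bits (env s w) (env s r))))) ->
  wp (emit_pushes w r) R s.
Proof. by move=> w9 w8 rB wM wB HR; apply: wp_emit_high; rewrite // -parens_bits_pushes. Qed.

Lemma wp_emit_pops w r R s : 9 != w -> env s r < B -> env s w <= M ->
  (forall v, R (LState (set_nth 0 (vars s) 9 v)
     (out s ++ parens_bits (pops (bits (env s w) (env s r)))))) ->
  wp (emit_pops w r) R s.
Proof. by move=> w9 rB wM HR; apply: wp_emit_low => // v; rewrite -parens_bits_pops. Qed.

Lemma wp_emit_start_block p pw tmp a q1 ra Z q2 e x r y o R :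
  q0 < B -> le < B -> z0 < B ->
  (forall pw' tmp', R (St p pw' tmp' a q1 ra Z q2 e x r y (o ++ parens_bits
     (pushes ((false :: bits wl le) ++ bits wq q0 ++ (true :: bits wg z0) ++ [:: false])) ++ sep_bits))) ->
  wp emit_start_block R (St p pw tmp a q1 ra Z q2 e x r y o).
Proof.
move=> qB lB zB HR.
apply: wp_seqI; apply: wp_emit; simp_state.
apply: wp_seqI; apply: wp_emit_pushes => //; simp_state.
apply: wp_seqI; apply: wp_emit; simp_state.
apply: wp_seqI; apply: wp_emit_pushes => //; simp_state.
apply: wp_seqI; apply: wp_emit_pushes => //; simp_state.
apply: wp_seqI; apply: wp_emit; simp_state.
apply: wp_emit; simp_state; move: (HR 1 le).
rewrite !(pushes_cat, pushes_cons _ (bits _ _)) !parens_bits_cat -!catA.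
by [].
Qed.

Definition letter_bits i := if i == le then [::] else
  parens_bits (pops [:: true] ++ pushes (false :: bits wl i)) ++ sep_bits.

Lemma wp_emit_letter_blocks p pw tmp a q1 ra Z q2 e x r y o R :
  (forall pw' tmp' a', R (St p pw' tmp' a' q1 ra Z q2 e x r y
     (o ++ flatten [seq letter_bits i | i <- iota 0 L]))) ->
  wp emit_letter_blocks R (St p pw tmp a q1 ra Z q2 e x r y o).
Proof.
move=> HR; apply: wp_seqI; apply: wp_set; simp_state; first lia.
apply: (@wp_for _ _ _ _ _ _ _ _ _ (fun i s => exists pw tmp, s =
   St p pw tmp i q1 ra Z q2 e x r y (o ++ flatten [seq letter_bits i | i <- iota 0 i]))).
- by [].
- by exists pw, tmp; rewrite cats0.
- move=> i s; simp_state => iL [pw' [tmp' ->]].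
  rewrite flatten_iotaS catA; set o' := o ++ _; apply: wp_seqI; apply: wp_if; simp_state => il.
    apply: wp_set; simp_state; first lia.
    exists pw', tmp'; rewrite addn1 /letter_bits; case: eqP il => // _ _.
    by rewrite cats0.
  apply: wp_seqI; apply: wp_emit; simp_state.
  apply: wp_seqI; apply: wp_emit_pushes => //; simp_state; first lia.
  apply: wp_seqI; apply: wp_emit; simp_state.
  apply: wp_emit; simp_state; apply: wp_set; simp_state; first lia.
  exists 1, i; rewrite addn1 /letter_bits; case: eqP il => // _ _.
  by rewrite (pushes_cons _ (bits _ _)) !parens_bits_cat /o' -!catA.
- by move=> s; simp_state => -[pw' [tmp' ->]].
Qed.

Definition final_bits (i : nat) := if nth false inp (fp + i) then
  parens_bits (pops ((false :: bits wl re) ++ bits wq i ++ (true :: bits wg z0) ++ [:: false]))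
    ++ sep_bits else [::].

Lemma wp_emit_final_blocks p pw tmp a q1 ra Z q2 e x r y o R :
  fp + Q <= n -> re < B -> z0 < B ->
  (forall pw' tmp' a', R (St p pw' tmp' a' q1 ra Z q2 e x r y
     (o ++ flatten [seq final_bits i | i <- iota 0 Q]))) ->
  wp emit_final_blocks R (St p pw tmp a q1 ra Z q2 e x r y o).
Proof.
move=> fQ rB zB HR; apply: wp_seqI; apply: wp_set; simp_state; first lia.
apply: (@wp_for _ _ _ _ _ _ _ _ _ (fun i s => exists pw tmp, s =
   St p pw tmp i q1 ra Z q2 e x r y (o ++ flatten [seq final_bits i | i <- iota 0 i]))).
- by [].
- by exists pw, tmp; rewrite cats0.
- move=> i s; simp_state => iL [pw' [tmp' ->]].
  rewrite flatten_iotaS catA; set o' := o ++ _; apply: wp_seqI.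
  have rd : nth false (inp ++ o') (fp + i) = nth false inp (fp + i).
    by rewrite nth_cat ifT // -nE; lia.
  apply: wp_if; simp_state; rewrite rd => il; last first.
    apply: wp_set; simp_state; first lia.
    exists pw', tmp'; rewrite addn1 /final_bits; case: (nth _ _ _) il => // _.
    by rewrite cats0.
  apply: wp_seqI; apply: wp_emit; simp_state.
  apply: wp_seqI; apply: wp_emit_pops => //; simp_state => // t1.
  apply: wp_seqI; apply: wp_emit_pops => //; simp_state => //; first lia.
  move=> t2; apply: wp_seqI; apply: wp_emit; simp_state.
  apply: wp_seqI; apply: wp_emit_pops => //; simp_state => // t3.
  apply: wp_seqI; apply: wp_emit; simp_state.
  apply: wp_emit; simp_state; apply: wp_set; simp_state; first lia.
  exists pw', t3; rewrite addn1 /final_bits; case: (nth _ _ _) il => // _.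
  by rewrite !(pops_cat, pops_cons _ (bits _ _)) !parens_bits_cat /o' -!catA.
- by move=> s; simp_state => -[pw' [tmp' ->]].
Qed.

Definition marked_bits (gs : seq nat) : seq bool :=
  flatten [seq true :: bits wg g | g <- gs].

Lemma size_marked_bits gs : size (marked_bits gs) = size gs * wg.+1.
Proof.
by elim: gs => // g gs IH; rewrite /marked_bits /= size_cat IH size_bits mulSn.
Qed.

Lemma wp_emit_pushed_word p gs pw tmp a q1 ra Z q2 x r y o R :
  let e := p + size gs * wg.+1 in
  at_ inp p (code_list (bits wg) gs) -> (forall g, g \in gs -> g < 2 ^ wg) ->
  (forall pw' tmp' x' r' y', R (St p pw' tmp' a q1 ra Z q2 e x' r' y'
     (o ++ parens_bits (pushes (marked_bits gs))))) ->
  wp emit_pushed_word R (St p pw tmp a q1 ra Z q2 e x r y o).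
Proof.
move=> e Hat gB HR.
have en : e < n.
  have := at_size _ Hat; rewrite /code_list size_rcons => /(_ isT).
  by rewrite -/(marked_bits gs) size_marked_bits -nE /e; lia.
have gse : size gs <= e.
  by rewrite /e; apply: leq_trans (leq_addl _ _); rewrite leq_pmulr.
apply: wp_seqI; apply: wp_set; simp_state; first lia.
(* Truncated subtraction keeps [size gs - k] at 0 once the whole word has been read, which covers
   the idle rounds. *)
apply: (@wp_for _ _ _ _ _ _ _ _ _ (fun k s => exists pw tmp r y, s =
   St p pw tmp a q1 ra Z q2 e (p + (size gs - k) * wg.+1) r y
    (o ++ parens_bits (pushes (marked_bits (drop (size gs - k) gs)))))).
- by [].
- by exists pw, tmp, r, y; rewrite subn0 drop_size cats0.
- move=> k s; simp_state => kn [pw' [tmp' [r' [y' ->]]]].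
  have [gk|kg] := leqP (size gs) k.
    apply: wp_if; simp_state; rewrite (eqP (gk : size gs - k == 0)) ?mul0n ?addn0 ?ltnn //.
    move=> _; exists pw', tmp', r', y'.
    by rewrite (_ : size gs - k.+1 = 0) ?mul0n ?addn0 //; lia.
  pose j := size gs - k.+1.
  have ej : size gs - k = j.+1 by rewrite /j; lia.
  have jg : j < size gs by rewrite /j; lia.
  have xe : p + j.+1 * wg.+1 <= e by rewrite /e leq_add2l leq_mul2r /=.
  rewrite ej -/j.
  apply: wp_if; simp_state; last by rewrite -[X in X < _]addn0 ltn_add2l mulSn.
  move=> _; apply: wp_seqI; apply: wp_set; simp_state; first lia.
  have -> : p + j.+1 * wg.+1 - (wg + 1) = p + j * wg.+1 by rewrite mulSn; lia.
  have Hj : at_ inp (p + j * wg.+1 + 1) (bits wg (nth 0 gs j)).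
    have egs : code_list (bits wg) gs = marked_bits (take j gs) ++ [:: true] ++
        bits wg (nth 0 gs j) ++ rcons (marked_bits (drop j.+1 gs)) false.
      rewrite /code_list -{1}(cat_take_drop j gs) (drop_nth 0) // map_cat flatten_cat.
      by rewrite rcons_cat /= rcons_cat.
    move: Hat; rewrite egs !at_cat size_marked_bits size_takel ?(ltnW jg) //.
    by case/and4P.
  apply: wp_seqI; apply: (@wp_read_num _ _ _ _ _ _ _ _ _ (nth 0 gs j)) => //; simp_state => //.
  + by rewrite mulSn in xe; lia.
  + by apply: gB; apply: mem_nth.
  apply: wp_seqI; apply: wp_emit_pushes => //; simp_state.
    by apply: ltn_trans wgB; apply: gB; apply: mem_nth.
  apply: wp_emit; simp_state.
  do 4 eexists; congr LState.
  rewrite (drop_nth 0 jg) /marked_bits /= -/(marked_bits _).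
  by rewrite -cat_cons pushes_cat (pushes_cons _ (bits _ _)) !parens_bits_cat -!catA.
- move=> s; simp_state => -[pw' [tmp' [r' [y' ->]]]].
  by rewrite (_ : size gs - n = 0) ?mul0n ?addn0 ?drop0 //; lia.
Qed.

Definition item_bits q1 a Z q2 gs (right : bool) : seq bool :=
  bits wq q1 ++ bits wl a ++ bits wg Z ++ bits wq q2 ++ code_list (bits wg) gs ++
  bits 2 (if right then 2 else 1).

Definition trans_bits q1 a Z q2 gs (right : bool) : seq bool :=
  if right && (a == re) then [::] else
  parens_bits (pops ((false :: bits wl a) ++ bits wq q1 ++ (true :: bits wg Z)) ++
    pushes ((if right then [:: true] else false :: bits wl a) ++ bits wq q2 ++
      marked_bits gs)) ++ sep_bits.

Lemma wp_trans_body p pw tmp a q1 ra Z q2 e x r y o R nq1 nra nZ nq2 gs right :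
  at_ inp p (true :: item_bits nq1 nra nZ nq2 gs right) ->
  nq1 < 2 ^ wq -> nra < 2 ^ wl -> nZ < 2 ^ wg -> nq2 < 2 ^ wq ->
  (forall g, g \in gs -> g < 2 ^ wg) ->
  (forall pw' tmp' q1' ra' Z' q2' e' x' r' y',
     R (St (p + (size (item_bits nq1 nra nZ nq2 gs right)).+1) pw' tmp' a q1' ra' Z' q2'
     e' x' r' y' (o ++ trans_bits nq1 nra nZ nq2 gs right))) ->
  wp trans_body R (St p pw tmp a q1 ra Z q2 e x r y o).
Proof.
move=> Hat q1B aB ZB q2B gB HR.
have szi : size (item_bits nq1 nra nZ nq2 gs right) =
    wq + (wl + (wg + (wq + ((size gs * wg.+1).+1 + 2)))).
  rewrite /item_bits /code_list !size_cat size_rcons -/(marked_bits gs) size_marked_bits.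
  by rewrite !size_bits.
have en := at_size _ Hat; rewrite [size (_ :: _)]/= szi -nE in en.
have {}en := en isT.
rewrite szi in HR.
move: Hat; rewrite -cat1s /item_bits !at_cat !size_bits addn1.
case/and5P=> _ at1 at2 at3 /and3P[at4 at5 at6].
apply: wp_seqI; apply: (@wp_read_num _ _ _ _ _ _ _ _ _ nq1) => //; simp_state;
  rewrite ?addn1 //; first alia.
apply: wp_seqI; apply: (@wp_read_num _ _ _ _ _ _ _ _ _ nra) => //; simp_state => //; first alia.
apply: wp_seqI; apply: (@wp_read_num _ _ _ _ _ _ _ _ _ nZ) => //; simp_state => //; first alia.
apply: wp_seqI; apply: (@wp_read_num _ _ _ _ _ _ _ _ _ nq2) => //; simp_state => //; first alia.
set p' := p.+1 + wq + wl + wg + wq in at5 at6 *.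
apply: wp_seqI; apply: wp_set; simp_state; first by rewrite /p'; alia.
apply: wp_seqI; apply: (@wp_list_loop _ _ _ _ _ (bits wg) gs _ _ p' _
  (fun l1 s => s = St p' (2 ^ wq) tmp a nq1 nra nZ nq2 (list_pos (bits wg) p' l1) x r y o)) => //.
- by rewrite /list_pos addn0.
- by move=> l1 s ->.
- move=> l1 g l2 s el -> ag; apply: wp_set; simp_state.
    have := at_size _ ag; rewrite [size _]/= size_bits -nE => /(_ isT); alia.
  by rewrite list_pos_rcons size_bits addn1.
move=> s ->; rewrite /list_pos -/(marked_bits gs) size_marked_bits.
set e' := p' + _.
have at6' : at_ inp e'.+1 (bits 2 (if right then 2 else 1)).
  by move: at6; rewrite /code_list size_rcons -/(marked_bits gs) size_marked_bits addnS.
have rd o' : nth false (inp ++ o') (e' + 2) = right.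
  by rewrite addn2 -addn1 (at_nth _ at6') ?size_bits //; case: (right).
have eB : e' + 3 < B by rewrite /e' /p'; alia.
have pE : e' + 3 = p + (wq + (wl + (wg + (wq + ((size gs * wg.+1).+1 + 2))))).+1.
  by rewrite /e' /p'; alia.
apply: wp_seqI; apply: wp_if; simp_state; rewrite rd => cond.
  apply: wp_set; simp_state => //; rewrite pE.
  move: (HR (2 ^ wq) tmp nq1 nra nZ nq2 e' x r y); rewrite /trans_bits.
  by move: cond; case: (right); case: (nra == re); rewrite ?cats0.
have ctr : right && (nra == re) = false.
  by move: cond; case: (right); case: (nra == re).
rewrite /trans_bits ctr in HR.
apply: wp_seqI; apply: wp_emit; simp_state.
have aB' : nra < B by apply: ltn_trans wlB.
have q1B' : nq1 < B by apply: ltn_trans wqB.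
have q2B' : nq2 < B by apply: ltn_trans wqB.
have ZB' : nZ < B by apply: ltn_trans wgB.
apply: wp_seqI; apply: wp_emit_pops => //; simp_state => // t1.
apply: wp_seqI; apply: wp_emit_pops => //; simp_state => // t2.
apply: wp_seqI; apply: wp_emit; simp_state.
apply: wp_seqI; apply: wp_emit_pops => //; simp_state => // t3.
apply: wp_seqI; apply: wp_emit_pushed_word => // pw4 t4 x4 r4 y4.
apply: wp_seqI; apply: wp_emit_pushes => //; simp_state.
set o5 := (_ ++ parens_bits (pushes (bits wq nq2))).
apply: wp_seqI; apply: (@wp_mono _ _ _ _ _ (fun s => exists pw' tmp', s =
   St p' pw' tmp' a nq1 nra nZ nq2 e' x4 r4 y4
    (o5 ++ parens_bits (pushes (if right then [:: true] else false :: bits wl nra))))).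
  move=> s1 [pw5 [t5 ->]]; apply: wp_emit; simp_state; apply: wp_set; simp_state => //.
  rewrite pE; move: (HR pw5 t5 nq1 nra nZ nq2 e' x4 r4 y4).
  rewrite !(pops_cat, pops_cons _ (bits _ _), pushes_cat) !parens_bits_cat /o5 -!catA.
  by [].
apply: wp_if; simp_state; rewrite rd => rt.
  apply: wp_emit; simp_state; exists 1, nq2; move: rt.
  by case: (right).
apply: wp_seqI; apply: wp_emit_pushes => //; simp_state.
apply: wp_emit; simp_state; exists 1, nra; move: rt.
by case: (right) => // _; rewrite (pushes_cons _ (bits _ _)) parens_bits_cat catA.
Qed.

End Blocks.

(** The first assignment pads the list of variables to its full length 24, so that every later state
    is a literal list of that length. *)
Definition pda_prog : prog :=
  Seq (Set_ 23 (Cst 0))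
  (Seq (scan_ones 1 0 (Cst 0)) (Seq (Set_ 2 (Var 1))
  (Seq (scan_ones 1 0 (succ 1)) (Seq (Set_ 3 (Bin Sub (Var 1) (succ 2)))
  (Seq (scan_ones 1 0 (succ 1))
  (Seq (Set_ 4 (Bin Sub (Bin Sub (Var 1) (succ 2)) (succ 3)))
  (Seq (compute_up_log 5 8 2) (Seq (compute_up_log 6 8 3) (Seq (compute_up_log 7 8 4)
  (Seq (read_num 10 1 5 8 (succ 1)) (Seq (Set_ 14 (Var 1))
  (Seq (read_num 11 1 6 8 (Bin Add (Var 1) (Var 2)))
  (Seq (read_num 12 1 6 8 (Var 1)) (Seq (read_num 13 1 7 8 (Var 1))
  (Seq emit_start_block (Seq emit_letter_blocks (Seq emit_final_blocks
  (list_loop 1 0 trans_body)))))))))))))))))).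

Lemma flatten_filter (T : Type) (F : T -> seq bool) (p : pred T) l :
  flatten [seq F x | x <- l & p x] = flatten [seq if p x then F x else [::] | x <- l].
Proof. by elim: l => //= x l <-; case: (p x). Qed.

Lemma map_enum_rank (T : finType) : [seq nat_of_ord (enum_rank x) | x <- enum T] = iota 0 #|T|.
Proof.
have sT : size (enum T) = #|T| by rewrite cardE.
apply: (@eq_from_nth _ 0) => [|i]; rewrite size_map sT ?size_iota // => iT.
have [x0 _] : {x0 : T | x0 \in enum T}.
  by case: (enum T) sT => [e|x l _]; [move: iT; rewrite -e | exists x; rewrite mem_head].
rewrite (nth_map x0) ?sT // nth_iota // add0n.
have -> : nth x0 (enum T) i = enum_val (Ordinal iT : 'I_#|T|) by rewrite (enum_val_nth x0).
by rewrite enum_valK.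
Qed.

Lemma flatten_enum_rank (T : finType) (F : nat -> seq bool) :
  flatten [seq F (enum_rank x) | x <- enum T] = flatten [seq F i | i <- iota 0 #|T|].
Proof. by rewrite -map_enum_rank -map_comp. Qed.

(** Stated for plain numbers and an arbitrary item type, which keeps the symbolic execution free of
    the finite types of the automaton. *)
Lemma wp_pda_prog inp N M B Q L G wq wl wg q0 le re z0 fp p0
    (T : Type) (f g : T -> seq bool) (l : seq T) :
  wq = up_log 2 Q -> wl = up_log 2 L -> wg = up_log 2 G ->
  fp = Q.+1 + L.+1 + G.+1 + wq -> p0 = fp + Q + wl + wl + wg ->
  at_ inp 0 (unary Q) -> at_ inp Q.+1 (unary L) -> at_ inp (Q.+1 + L.+1) (unary G) ->
  at_ inp (Q.+1 + L.+1 + G.+1) (bits wq q0) -> at_ inp (fp + Q) (bits wl le) ->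
  at_ inp (fp + Q + wl) (bits wl re) -> at_ inp (fp + Q + wl + wl) (bits wg z0) ->
  at_ inp p0 (code_list f l) ->
  q0 < 2 ^ wq -> le < 2 ^ wl -> re < 2 ^ wl -> z0 < 2 ^ wg ->
  (forall l1 x l2, l = l1 ++ x :: l2 -> exists q1 a Z q2 gs right,
    [/\ f x = item_bits wq wl wg q1 a Z q2 gs right,
        g x = trans_bits wq wl wg re q1 a Z q2 gs right,
        q1 < 2 ^ wq /\ q2 < 2 ^ wq, a < 2 ^ wl /\ Z < 2 ^ wg
      & forall h, h \in gs -> h < 2 ^ wg]) ->
  size inp + 2 <= N -> lg (size inp) <= M -> 8 * (size inp + 2) <= B ->
  wp inp N M B pda_prog (fun s => out s =
    (parens_bits (pushes ((false :: bits wl le) ++ bits wq q0 ++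
       (true :: bits wg z0) ++ [:: false])) ++ sep_bits) ++
    flatten [seq letter_bits wl le i | i <- iota 0 L] ++
    flatten [seq final_bits inp wq wl wg re z0 fp i | i <- iota 0 Q] ++
    flatten [seq g x | x <- l]) (init inp).
Proof.
move=> wqE wlE wgE fpE p0E at1 at2 at3 at4 at6 at7 at8 at9 q02 le2 re2 z02 items.
rewrite /init; have [n nE] : exists n, n = size inp by exists (size inp).
rewrite -nE => nN nM nB.
have sz k : size (unary k) = k.+1 by rewrite /unary size_rcons size_nseq.
have p0n : p0 < n.
  have := at_size _ at9; rewrite /code_list size_rcons -nE => /(_ isT).
  by apply: leq_trans; rewrite addnS ltnS leq_addr.
have Qn : Q < n by alia.
have Ln : L < n by alia.
have Gn : G < n by alia.
have wM k : k < n -> up_log 2 k <= M.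
  by move=> kn; apply: leq_trans nM; apply: leq_up_log; alia.
have wB k : k < n -> 2 ^ up_log 2 k < B.
  by move=> kn; have := exp2_up_log k; alia.
have wqB := wB _ Qn; have wlB := wB _ Ln; have wgB := wB _ Gn.
have wqM := wM _ Qn; have wlM := wM _ Ln; have wgM := wM _ Gn.
rewrite -wqE -wlE -wgE in wqB wlB wgB wqM wlM wgM.
apply: wp_seqI; apply: wp_set; simp_state; first alia.
apply: wp_seqI; apply: (@wp_scan_ones _ _ _ _ _ _ _ Q); simp_state => //; try alia.
apply: wp_seqI; apply: wp_set; simp_state; first alia.
rewrite add0n.
apply: wp_seqI; apply: (@wp_scan_ones _ _ _ _ _ _ _ L); simp_state; rewrite ?addn1 //; try alia.
apply: wp_seqI; apply: wp_set; simp_state; first alia.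
rewrite addn1 addKn.
apply: wp_seqI; apply: (@wp_scan_ones _ _ _ _ _ _ _ G); simp_state; rewrite ?addn1 -?addnS //; try alia.
apply: wp_seqI; apply: wp_set; simp_state; first alia.
have -> : Q.+1 + L.+1 + G - (Q + 1) - (L + 1) = G by alia.
apply: wp_seqI; apply: wp_compute_up_log => //; simp_state; try alia.
apply: wp_seqI; apply: wp_compute_up_log => //; simp_state; try alia.
apply: wp_seqI; apply: wp_compute_up_log => //; simp_state; try alia.
rewrite -wqE -wlE -wgE.
apply: wp_seqI; apply: (@wp_read_num _ _ _ _ _ _ _ _ _ q0) => //; simp_state;
  rewrite ?addn1 -?addnS //; try alia.
rewrite -fpE.
apply: wp_seqI; apply: wp_set; simp_state; first alia.
apply: wp_seqI; apply: (@wp_read_num _ _ _ _ _ _ _ _ _ le) => //; simp_state => //; first alia.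
apply: wp_seqI; apply: (@wp_read_num _ _ _ _ _ _ _ _ _ re) => //; simp_state => //; first alia.
apply: wp_seqI; apply: (@wp_read_num _ _ _ _ _ _ _ _ _ z0) => //; simp_state => //; first alia.
rewrite -p0E.
have q0B : q0 < B by apply: ltn_trans wqB.
have leB : le < B by apply: ltn_trans wlB.
have reB : re < B by apply: ltn_trans wlB.
have z0B : z0 < B by apply: ltn_trans wgB.
have nB4 : n + 4 < B by alia.
have nN' : n <= N by alia.
have QN : Q <= N by alia.
have LN : L <= N by alia.
have QB : Q < B by alia.
have LB : L < B by alia.
have fQ : fp + Q <= n by alia.
apply: wp_seqI; apply: wp_emit_start_block => // pw1 tmp1.
apply: wp_seqI; apply: wp_emit_letter_blocks => // pw2 tmp2 a2.
apply: wp_seqI; apply: wp_emit_final_blocks => // pw3 tmp3 a3; rewrite cat0s -!catA.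
set hdr := (X in LState _ X).
apply: (@wp_list_loop _ _ _ _ _ f l _ _ p0 _
  (fun l1 s => exists pw tmp q1 ra Z q2 e x r y, s =
   LState [:: n; list_pos f p0 l1; Q; L; G; wq; wl; wg; pw; tmp;
     q0; le; re; z0; fp; a3; q1; ra; Z; q2; e; x; r; y]
     (hdr ++ flatten [seq g x | x <- l1]))) => //.
- by exists pw3, tmp3, 0, 0, 0, 0, 0, 0, 0, 0; rewrite /list_pos addn0 cats0.
- by move=> l1 s [pw [tmp [q1 [ra [Z [q2 [e [x [r [y ->]]]]]]]]]].
- move=> l1 tr l2 s el [pw [tmp [q1 [ra [Z [q2 [e [x [r [y ->]]]]]]]]]].
  have [nq1 [na [nZ [nq2 [gs [right [fE gE [q1B q2B] [aB ZB] gB]]]]]]] := items _ _ _ el.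
  rewrite list_pos_rcons map_rcons flatten_rcons catA gE fE => ati.
  apply: wp_trans_body ati _ _ _ _ _ _ => //.
  by move=> *; do 10 eexists.
- move=> s [pw [tmp [q1 [ra [Z [q2 [e [x [r [y ->]]]]]]]]]].
  by simp_state; rewrite /hdr -!catA.
Qed.

(** * The encoded PDA as input of the program *)

Section PDACode.
Variable P : npda.
Hypothesis P_pda : is_pda P.
Notation rank x := (nat_of_ord (enum_rank x)).
Let inp := code_npda P.
Let n := size inp.
Let Q := #|state P|.
Let L := #|letter P|.
Let G := #|stacksym P|.
Let wq := up_log 2 Q.
Let wl := up_log 2 L.
Let wg := up_log 2 G.
Let fp := Q.+1 + L.+1 + G.+1 + wq.
Let p0 := fp + Q + wl + wl + wg.
Local Notation trans := (state P * letter P * stacksym P * state P * seq (stacksym P) * int)%type.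

Definition final_mask : seq bool := [seq q \in final P | q <- enum (state P)].

Lemma size_final_mask : size final_mask = Q.
Proof. by rewrite size_map /Q cardE. Qed.

Lemma pda_code_at :
  [/\ [/\ at_ inp 0 (unary Q), at_ inp Q.+1 (unary L) & at_ inp (Q.+1 + L.+1) (unary G)],
      [/\ at_ inp (Q.+1 + L.+1 + G.+1) (bits wq (rank (start P))),
        at_ inp fp final_mask, at_ inp (fp + Q) (bits wl (rank (lend P)))
        & at_ inp (fp + Q + wl) (bits wl (rank (rend P)))],
      at_ inp (fp + Q + wl + wl) (bits wg (rank (stackend P)))
    & at_ inp p0 (code_list (@trans_code P) (delta P))].
Proof.
have Hat : at_ inp 0 (unary Q ++ unary L ++ unary G ++ bits wq (rank (start P)) ++
    final_mask ++ bits wl (rank (lend P)) ++ bits wl (rank (rend P)) ++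
    bits wg (rank (stackend P)) ++ code_list (@trans_code P) (delta P)) := at_full inp.
have sz k : size (unary k) = k.+1 by rewrite /unary size_rcons size_nseq.
rewrite !at_cat !sz !size_bits size_final_mask add0n in Hat.
by case/and5P: Hat => ? ? ? ? /and5P[? ? ? ? ?]; split.
Qed.

Definition trans_item (tr : trans) : seq bool :=
  let: (q1, a, Z, q2, g, d) := tr in
  item_bits wq wl wg (rank q1) (rank a) (rank Z) (rank q2)
    [seq rank Z | Z <- g] (d == 1%R).

Definition trans_out (tr : trans) : seq bool :=
  let: (q1, a, Z, q2, g, d) := tr in
  trans_bits wq wl wg (rank (rend P)) (rank q1) (rank a) (rank Z) (rank q2)
    [seq rank Z | Z <- g] (d == 1%R).

Lemma trans_item_code tr : tr \in delta P -> trans_code tr = trans_item tr.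
Proof.
move=> tP; have := pda_move P_pda tP; case: tr tP => [[[[[q1 a] Z] q2] g] d] _ /= dE.
rewrite /trans_code /item_bits; do 4 congr (_ ++ _); congr (_ ++ _).
  by rewrite /code_list -map_comp.
by case: dE => ->.
Qed.

Lemma marked_bits_word (g : seq (stacksym P)) : marked_bits wg [seq rank Z | Z <- g] = marked_word g :> seq bool.
Proof. by rewrite /marked_bits -map_comp. Qed.

Lemma trans_outE tr : trans_out tr =
  if trans_ok tr then parens_bits (trans_block tr) ++ sep_bits else [::].
Proof.
case: tr => [[[[[q1 a] Z] q2] g] d].
rewrite /trans_out /trans_bits /trans_ok /trans_block /next_mode /head_word marked_bits_word.
have -> : (rank a == rank (rend P)) = (a == rend P).
  by rewrite (inj_eq (@ord_inj _)) (inj_eq enum_rank_inj).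
have -> : marked_word [:: Z] = true :: bits wg (rank Z) by rewrite /marked_word /= cats0.
by case: (_ && _) => //; case: eqP.
Qed.

Lemma pda_word_code : flatten [seq code_elt a | a <- pda_word P] =
  (parens_bits (start_block P) ++ sep_bits) ++
  flatten [seq letter_bits wl (rank (lend P)) i | i <- iota 0 L] ++
  flatten [seq final_bits inp wq wl wg (rank (rend P)) (rank (stackend P)) fp i | i <- iota 0 Q] ++
  flatten [seq trans_out tr | tr <- delta P].
Proof.
rewrite /pda_word block_word_code /= !map_cat !flatten_cat; congr (_ ++ _).
congr (_ ++ (_ ++ _)).
- rewrite -flatten_enum_rank -map_comp flatten_filter; congr flatten; apply: eq_map => a /=.
  rewrite /letter_bits (inj_eq (@ord_inj _)) (inj_eq enum_rank_inj).
  by case: eqP.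
- rewrite -flatten_enum_rank -map_comp flatten_filter; congr flatten; apply: eq_map => q /=.
  rewrite /final_bits; have [_ [_ Hf _ _] _ _] := pda_code_at.
  have := @at_nth inp fp final_mask [::] (rank q) Hf; rewrite cats0 size_final_mask => ->; last first.
    exact: ltn_ord.
  rewrite (nth_map q) -?cardE ?ltn_ord // nth_enum_rank.
  by case: ifP => // _; rewrite /final_block /config_word /exact /marked_word /= cats0.
- rewrite -map_comp flatten_filter; congr flatten; apply: eq_map => tr /=.
  by rewrite trans_outE.
Qed.

Lemma pda_prog_spec N M B : n + 2 <= N -> lg n <= M -> 8 * (n + 2) <= B ->
  wp inp N M B pda_prog (fun s => out s = flatten [seq code_elt a | a <- pda_word P])
    (init inp).
Proof.
move=> nN nM nB; rewrite pda_word_code.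
have [[at1 at2 at3] [at4 at5 at6 at7] at8 at9] := pda_code_at.
have -> : start_block P = pushes ((false :: bits wl (rank (lend P))) ++
    bits wq (rank (start P)) ++ (true :: bits wg (rank (stackend P))) ++ [:: false]).
  by rewrite /start_block /config_word /exact /marked_word /= cats0.
apply: wp_pda_prog (at9) _ _ _ _ _ _ _ _ => //; try exact: enum_rank_lt.
move=> l1 tr l2 el; have trd : tr \in delta P by rewrite el mem_cat mem_head orbT.
rewrite (trans_item_code trd); case: tr {el trd} => [[[[[q1 a] Z] q2] g] d].
exists (rank q1), (rank a), (rank Z), (rank q2), [seq rank Z | Z <- g], (d == 1%R).
split => //; try by split; apply: enum_rank_lt.
by move=> h /mapP[Z' _ ->]; apply: enum_rank_lt.
Qed.

End PDACode.

Lemma size_parens_bits u : size (parens_bits u) = 3 * size u.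
Proof. by elim: u => // c u IH; rewrite /parens_bits /= IH; lia. Qed.

Lemma size_pushes l : size (pushes l) = size l.
Proof. by rewrite size_map size_rev. Qed.

Lemma size_pops l : size (pops l) = size l.
Proof. exact: size_map. Qed.

Lemma size_letter_bits wl le i : size (letter_bits wl le i) <= 9 + 3 * wl.
Proof.
rewrite /letter_bits; case: ifP => // _.
by rewrite size_cat size_parens_bits size_cat size_pops size_pushes /= size_bits; lia.
Qed.

Lemma size_final_bits inp wq wl wg re z0 fp i :
  size (final_bits inp wq wl wg re z0 fp i) <= 12 + 3 * (wl + wq + wg).
Proof.
rewrite /final_bits; case: ifP => // _.
rewrite size_cat size_parens_bits size_pops /= !size_cat /= !size_cat /= !size_bits.
lia.
Qed.

Lemma size_trans_bits wq wl wg re q1 a Z q2 gs right :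
  size (trans_bits wq wl wg re q1 a Z q2 gs right) <=
  6 * size (item_bits wq wl wg q1 a Z q2 gs right).
Proof.
rewrite /trans_bits; case: ifP => // _.
rewrite /item_bits /code_list !size_cat size_rcons -/(marked_bits wg gs).
rewrite size_parens_bits size_cat size_pops size_pushes !size_cat /= size_marked_bits.
rewrite !size_bits; case: right; rewrite /= ?size_bits; lia.
Qed.

Lemma size_flatten_bound (T : Type) c (F : T -> seq bool) l :
  (forall x, size (F x) <= c) -> size (flatten [seq F x | x <- l]) <= size l * c.
Proof. by move=> Fc; elim: l => //= x l IH; rewrite size_cat mulSn leq_add. Qed.

(** The transition blocks are linear in the input. The logarithm comes from the letter and final
    blocks: letters and states are counted in unary in the input, and each of them may yield a block
    of O([lg n]) bits. *)
Lemma size_pda_word (P : npda) : is_pda P ->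
  size (flatten [seq code_elt a | a <- pda_word P]) <=
  40 * ((size (code_npda P) + 2) * lg (size (code_npda P))).
Proof.
move=> P_pda; rewrite pda_word_code //; set n := size (code_npda P); set T := map (@trans_out P) _.
set wq := up_log 2 #|state P|; set wl := up_log 2 #|letter P|.
set wg := up_log 2 #|stacksym P|.
set F := [seq _ | i <- iota 0 #|state P|]; set A := [seq _ | i <- iota 0 #|letter P|].
have en : n = #|state P|.+1 + #|letter P|.+1 + #|stacksym P|.+1 + wq + #|state P| +
    2 * wl + wg + size (code_list (@trans_code P) (delta P)).
  rewrite /n /code_npda -[code_list _ _]/(code_list (@trans_code P) (delta P)).
  move: (code_list _ _) => D; rewrite !size_cat /unary !size_rcons !size_nseq !size_bits.
  rewrite size_map -cardE -/wq -/wl -/wg.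
  by rewrite mul2n -addnn !addnA.
have wM k : k < n -> up_log 2 k <= lg n by move=> kn; apply: leq_up_log; lia.
have /wM wqM : #|state P| < n by lia.
have /wM wlM : #|letter P| < n by lia.
have /wM wgM : #|stacksym P| < n by lia.
have l0 := lg_gt0 n.
have szA : size (flatten A) <= #|letter P| * (9 + 3 * wl).
  by rewrite -[X in _ <= X * _](size_iota 0) size_flatten_bound // => i; apply: size_letter_bits.
have szF : size (flatten F) <= #|state P| * (12 + 3 * (wl + wq + wg)).
  by rewrite -[X in _ <= X * _](size_iota 0) size_flatten_bound // => i; apply: size_final_bits.
have szT : size (flatten T) <= 6 * n.
  apply: (@leq_trans (6 * size (code_list (@trans_code P) (delta P)))); last by lia.
  rewrite /code_list size_rcons /T; apply: (@leq_trans (6 * size (flatten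
    [seq true :: trans_code tr | tr <- delta P]))); last by lia.
  have -> : [seq true :: trans_code tr | tr <- delta P] =
      [seq true :: trans_item tr | tr <- delta P].
    by apply/eq_in_map => tr trd; rewrite trans_item_code.
  apply: size_flatten_map_le => -[[[[[q1 a] Z] q2] g] d] /=.
  by apply: leq_trans (size_trans_bits _ _ _ _ _ _ _ _ _ _) _; rewrite leq_mul2l leqnSn orbT.
have szS : size (parens_bits (start_block P) ++ sep_bits) <= 21 * lg n.
  rewrite size_cat size_parens_bits /start_block size_pushes /config_word /exact.
  rewrite /marked_word /= !size_cat /= !size_cat !size_bits -/wq -/wl -/wg /=; lia.
rewrite !size_cat in szS *.
have : #|letter P| * (9 + 3 * wl) <= #|letter P| * (21 * lg n).
  by rewrite leq_mul2l; apply/orP; right; lia.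
have : #|state P| * (12 + 3 * (wl + wq + wg)) <= #|state P| * (21 * lg n).
  by rewrite leq_mul2l; apply/orP; right; lia.
have : n <= n * lg n by rewrite leq_pmulr.
have : (#|letter P| + #|state P|) * (21 * lg n) <= n * (21 * lg n).
  by rewrite leq_mul2r; apply/orP; right; lia.
rewrite mulnDl; lia.
Qed.

Lemma pda_reduces_block : reduces true pda_emptiness (recognition block_machine).
Proof.
exists (fun P => exist _ (pda_word (sval P)) (block_word_is_word _) :
  instance (recognition block_machine)).
exists pda_prog, 40; split=> // -[P P_pda] n; split.
- apply: pda_prog_spec => //; first by rewrite leq_pmull.
    by rewrite leq_pmull.
  by apply: leq_trans (linear_le_poly _ _) => //; rewrite leq_mul2r orbT.
- exact: size_pda_word.
- have := pda_wordP P_pda; rewrite /= => <-; split => [-> //|]; exact: contrapT.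
Qed.

Theorem proposition20 (R : realType) :
  [/\ forall A : npda, truly_subcubic R (recognition A),
      truly_subcubic R pda_emptiness
    & truly_subcubic R dyck2_reachability]
  \/
  [/\ ~ (forall A : npda, truly_subcubic R (recognition A)),
      ~ truly_subcubic R pda_emptiness
    & ~ truly_subcubic R dyck2_reachability].
Proof.
have dyck_of_pda : truly_subcubic R pda_emptiness -> truly_subcubic R dyck2_reachability.
  move/subcubic_of_truly/(reduces_subcubic dyck_reduces_pda); exact: truly_of_subcubic.
have recognition_of_dyck A :
    truly_subcubic R dyck2_reachability -> truly_subcubic R (recognition A).
  move/subcubic_of_truly/(reduces_subcubic (recognition_reduces_dyck A)).
  exact: truly_of_subcubic.
have pda_of_recognition :
    truly_subcubic R (recognition block_machine) -> truly_subcubic R pda_emptiness.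
  move/subcubic_of_truly/(reduces_subcubic pda_reduces_block); exact: truly_of_subcubic.
(* The implications form a cycle, so a classical case distinction on one of the three problems
   settles all of them. *)
have [dyck|no_dyck] := pselect (truly_subcubic R dyck2_reachability).
  by left; split=> // [A|]; [|apply: pda_of_recognition]; apply: recognition_of_dyck.
right; split=> // [rec|pda]; apply: no_dyck; apply: dyck_of_pda => //.
exact: pda_of_recognition.
Qed.
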